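(* There is an open and dense subset $\mathcal{U}$ of $\mathcal{E}^{1,1}(\mathbb{T})$ (with the $C^{1,1}$ topology) such that every $T\in\mathcal{U}$ has a unique Lyapunov minimizing measure, and this measure is supported on a periodic orbit of $T$.
   Context: $\mathbb{T}=\mathbb{R}/\mathbb{Z}$ is the circle with its standard metric $d$. A $C^1$ map $T:\mathbb{T}\to\mathbb{T}$ is expanding if there are $C>0$ and $\lambda>1$ with $|DT^n(x)|\ge C\lambda^n$ for all $x\in\mathbb{T}$, $n\ge1$. For $\chi\in(0,1]$, $\mathcal{E}^{1,\chi}(\mathbb{T})$ is the space of $C^1$ expanding self-maps of $\mathbb{T}$ whose derivative is $\chi$-Hölder (Lipschitz when $\chi=1$), with the $C^{1,\chi}$ distance $d_{C^{1,\chi}}(S,T)=d_{C^0}(S,T)+d_{C^0}(DS,DT)+\sup_{x\neq y}\frac{|(DS-DT)(x)-(DS-DT)(y)|}{d(x,y)^{\chi}}$. For a $T$-invariant Borel probability measure $\mu$, its Lyapunov exponent is $\lambda_T(\mu)=\int\log|DT|\,d\mu$; $\alpha(T)$ is the infimum of $\lambda_T(\nu)$ over all $T$-invariant Borel probability measures $\nu$, and $\mu$ is a Lyapunov minimizing measure if $\lambda_T(\mu)=\alpha(T)$. *)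

(* Defs.v *)
From HB Require Import structures.
From mathcomp Require Import all_boot all_order all_algebra.
From mathcomp Require Import all_classical all_reals all_analysis.
Set Implicit Arguments. Unset Strict Implicit. Unset Printing Implicit Defensive.
Import Order.TTheory GRing.Theory Num.Theory.
Import numFieldNormedType.Exports.
Local Open Scope classical_set_scope.
Local Open Scope ring_scope.

(* The circle T = R/Z is represented by the fundamental domain [0,1) of R;
   a C^1 self-map of T is represented by a lift F : R -> R with
   F (x + 1) = F x + k for some integer k (the degree). *)
Section CircleDefs.
Variable R : realType.

Definition frac (x : R) : R := x - (Num.floor x)%:~R.

Definition cdist (x y : R) : R := Num.min (frac (x - y)) (1 - frac (x - y)).

Definition circ_map (F : R -> R) : R -> R := fun x => frac (F x).

Definition is_lift (F : R -> R) : Prop :=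
  exists k : int, forall x, F (x + 1) = F x + k%:~R.

Definition C1 (F : R -> R) : Prop :=
  (forall x, derivable F x 1) /\ continuous (derive1 F).

Definition lipschitz_circ (g : R -> R) : Prop :=
  exists L : R, forall x y, `|g x - g y| <= L * cdist x y.

(* |D T^n (x)| >= C lambda^n ; the lift of T^n is F^n *)
Definition expanding (F : R -> R) : Prop :=
  exists C lam : R, 0 < C /\ 1 < lam /\
    forall x (n : nat), (0 < n)%N -> C * lam ^+ n <= `|derive1 (iter n F) x|.

Definition E11 : set (R -> R) :=
  [set F | is_lift F /\ C1 F /\ lipschitz_circ (derive1 F) /\ expanding F].

Definition dC11 (S T : R -> R) : R :=
  sup [set cdist (S x) (T x) | x in [set: R]]
  + sup [set `|derive1 S x - derive1 T x| | x in [set: R]]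
  + sup [set `|(derive1 S xy.1 - derive1 T xy.1) - (derive1 S xy.2 - derive1 T xy.2)|
               / cdist xy.1 xy.2
         | xy in [set xy : R * R | cdist xy.1 xy.2 != 0]].

(* Borel probability measures on T = probability measures on R carried by [0,1) *)
Definition circ_prob (mu : probability R R) : Prop := mu `[0, 1[%classic = 1%E.

Definition invariant (F : R -> R) (mu : probability R R) : Prop :=
  circ_prob mu /\
  forall A : set R, measurable A -> mu (circ_map F @^-1` A) = mu A.

Definition lyap (F : R -> R) (mu : probability R R) : \bar R :=
  (\int[mu]_x (ln `|derive1 F x|)%:E)%E.

Definition alpha (F : R -> R) : \bar R :=
  ereal_inf [set lyap F nu | nu in [set nu | invariant F nu]].

Definition lyap_min (F : R -> R) (mu : probability R R) : Prop :=
  invariant F mu /\ lyap F mu = alpha F.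

Definition periodic_orbit_support (F : R -> R) (mu : probability R R) : Prop :=
  exists (p : R) (n : nat), (0 < n)%N /\ iter n (circ_map F) p = p /\
    mu [set iter i (circ_map F) p | i in [set i : nat | (i < n)%N]] = 1%E.

End CircleDefs.

(* Main.v *)
Require Import Defs.
From HB Require Import structures.
From mathcomp Require Import all_boot all_order all_algebra.
From mathcomp Require Import all_classical all_reals all_analysis measurable_realfun.
From mathcomp Require Import ring lra zify.
Set Implicit Arguments.
Unset Strict Implicit.
Unset Printing Implicit Defensive.
Import Defs.
Import Order.TTheory GRing.Theory Num.Theory.
Import numFieldNormedType.Exports.
Local Open Scope classical_set_scope.
Local Open Scope ring_scope.

(* Let f = log |F'|. A sub-action u (a penalised Mane potential) turns f, minus its
   least periodic average alpha, into a nonnegative Lipschitz function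
   f - alpha - u o F + u vanishing along a whole orbit. By counting words (an acyclic
   graph has at most one Hamiltonian path) this orbit has closed returns whose error
   decays faster than any power of their period; splitting such a return wherever the
   periodic orbit shadowing it comes close to itself produces a periodic orbit O on
   which the sum of f - alpha is tiny compared with the gap of O (after Bressaud-Quas,
   Contreras and Huang-Lian-Ma-Xu-Zhang). A C^{1,1}-small perturbation fixing O then
   lowers f near O by about eps (r - d(., O)), with r comparable to the gap. Replacing
   u o F by u o G costs only eps r d(., O), which for small r is absorbed by the corner
   eps d(., O); hence O, and its continuation for every nearby map G, beats all orbits
   that leave its neighbourhood. *)

(** * The circle and its distance *)

(** The constants are forced in the order [eps], separation ratio, exponent. The perturbation lowers
    the log-derivative along the orbit by about [eps * r], while a run near the orbit can lose a
    multiple of the total error [E] over one period. That multiple depends on [eps] but not on the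
    period [p], because [E] is a sum along the orbit and the loss per step is of order [E / p]. So
    [r], and with it the gap, must exceed [E] by a large factor fixed by [eps]. Each splitting of a
    pseudo-orbit multiplies [E] by [1 + C + Q], with [Q] this factor, and at least halves [p]. Hence
    [E * p ^+ a] stays under control once [2 ^+ a] exceeds [1 + C + Q]; as [eps] is arbitrary, the
    initial returns have to beat every power of the period. The sub-action [u] of the unperturbed
    map is kept for the perturbed map and all its neighbours, so only its Lipschitz constant enters
    the comparison. *)

Section CircleDistance.
Variable R : realType.
Implicit Types x y z : R.

Lemma frac_ge0 x : 0 <= frac x.
Proof. by rewrite /frac subr_ge0 floor_le. Qed.

Lemma frac_lt1 x : frac x < 1.
Proof. by rewrite /frac ltrBlDl -[1]/(1%:~R) -intrD floorD1_gt. Qed.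

Lemma frac_int x : exists n : int, frac x = x - n%:~R.
Proof. by exists (Num.floor x). Qed.

Lemma frac_addz x (n : int) : frac (x + n%:~R) = frac x.
Proof. rewrite /frac floorDrz ?intr_int // intrKfloor intrD; ring. Qed.

(** With [cdist_attained] this presents [cdist] as a minimum over integer translates, the form from
    which the triangle inequality and the passage between circle and lifts are read off. *)
Lemma cdist_le_dist_int x y (n : int) : cdist x y <= `|x - y - n%:~R|.
Proof.
have f0 := frac_ge0 (x - y); have f1 := frac_lt1 (x - y).
rewrite /cdist; set a := frac (x - y).
have -> : x - y - n%:~R = a + (Num.floor (x - y) - n)%:~R.
  by rewrite /a /frac intrB; ring.
set k := (_ - n)%R; have [k0|k0] := leP 0 k.
  have h : (0:R) <= k%:~R by rewrite ler0z.
  by rewrite ge_min ger0_norm ?lerDl ?h // addr_ge0.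
have h : (k%:~R : R) <= -1.
  by rewrite -[1]/(1%:~R) -intrN ler_int -ltzD1 addNr.
rewrite ge_min; apply/orP; right.
rewrite ler0_norm; move: f0 f1; rewrite -/a => f0 f1; lra.
Qed.

Lemma cdist_attained x y : exists n : int, `|x - y - n%:~R| = cdist x y.
Proof.
have f0 := frac_ge0 (x - y); have f1 := frac_lt1 (x - y).
rewrite /cdist /Num.min; case: ifP => _.
  by exists (Num.floor (x - y)); rewrite ger0_norm.
exists (Num.floor (x - y) + 1); rewrite intrD.
by rewrite /frac in f0 f1 *; rewrite ler0_norm; lra.
Qed.

Lemma cdist_le_dist x y : cdist x y <= `|x - y|.
Proof. by have := cdist_le_dist_int x y 0; rewrite subr0. Qed.

Lemma cdist_ge0 x y : 0 <= cdist x y.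
Proof. by have [n <-] := cdist_attained x y. Qed.

Lemma cdist_le_half x y : cdist x y <= 1 / 2.
Proof. rewrite /cdist ge_min; case: leP => h //=; lra. Qed.

Lemma cdistC x y : cdist x y = cdist y x.
Proof.
suff h (a b : R) : cdist a b <= cdist b a by apply/le_anti; rewrite !h.
have [n <-] := cdist_attained b a.
have := cdist_le_dist_int a b (- n); rewrite -normrN intrN.
by have -> : - (a - b - - n%:~R) = b - a - n%:~R by ring.
Qed.

Lemma cdist_triangle y x z : cdist x z <= cdist x y + cdist y z.
Proof.
have [n <-] := cdist_attained x y; have [m <-] := cdist_attained y z.
have := cdist_le_dist_int x z (n + m); rewrite intrD => /le_trans; apply.
apply: le_trans (ler_normD _ _); rewrite le_eqVlt; apply/orP; left.
by apply/eqP; congr `|_|; ring.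
Qed.

Lemma cdistxx x : cdist x x = 0.
Proof.
apply/le_anti; rewrite cdist_ge0 andbT.
by have := cdist_le_dist x x; rewrite subrr normr0.
Qed.

Lemma cdist_eq0 x y : cdist x y = 0 <-> exists n : int, x = y + n%:~R.
Proof.
split=> [h|[n ->]].
  have [n] := cdist_attained x y; rewrite h => /eqP; rewrite normr_eq0 => /eqP e.
  by exists n; lra.
apply/le_anti; rewrite cdist_ge0 andbT.
have := cdist_le_dist_int (y + n%:~R) y n.
by rewrite (_ : _ - _ - _ = 0) ?normr0 //; ring.
Qed.

Lemma cdist_addzl x y (n : int) : cdist (x + n%:~R) y = cdist x y.
Proof.
have h : cdist (x + n%:~R) x = 0 by apply/cdist_eq0; exists n.
have := cdist_triangle x (x + n%:~R) y; have := cdist_triangle (x + n%:~R) x y.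
rewrite (cdistC x (_ + _)) h !add0r => h1 h2.
by apply/le_anti; rewrite h1 h2.
Qed.

Lemma cdist_addzr x y (n : int) : cdist x (y + n%:~R) = cdist x y.
Proof. by rewrite cdistC cdist_addzl cdistC. Qed.

Lemma cdist_eq0_trans x y z : cdist x y = 0 -> cdist x z = cdist y z.
Proof. by move=> /cdist_eq0[n ->]; rewrite cdist_addzl. Qed.

Lemma cdist_small x y : `|x - y| <= 1 / 2 -> cdist x y = `|x - y|.
Proof.
move=> h; apply/le_anti; rewrite cdist_le_dist /=.
have [n <-] := cdist_attained x y.
have [->|n0] := eqVneq n 0; first by rewrite subr0.
have : (1 : R) <= `|n%:~R|.
  by rewrite -intr_norm -[1]/(1%:~R) ler_int -gtz0_ge1 normr_gt0.
have : `|n%:~R : R| <= `|x - y - n%:~R| + `|x - y|.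
  rewrite -normrN; apply: le_trans (ler_normB _ _).
  by rewrite le_eqVlt; apply/orP; left; apply/eqP; congr `|_|; ring.
move=> h1 h2; move: h h1 h2.
lra.
Qed.

Definition periodic1 (T : Type) (g : R -> T) := forall x, g (x + 1) = g x.

Lemma periodic1z (T : Type) (g : R -> T) (n : int) x :
  periodic1 g -> g (x + n%:~R) = g x.
Proof.
move=> hg; have hn k y : g (y + k%:R) = g y.
  by elim: k => [|k IH]; rewrite ?addr0 // -natr1 addrA hg.
case: n => k; first by rewrite -pmulrn hn.
by rewrite NegzE intrN -pmulrn -(hn k.+1) subrK.
Qed.

Definition lipschitz1 (L : R) (g : R -> R) := forall x y, `|g x - g y| <= L * `|x - y|.

(** Since [cdist (x + 1) x = 0], such a [g] has period 1: Lipschitz functions on the circle are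
    handled on the line, without a quotient. *)
Definition clip (L : R) (g : R -> R) := forall x y, `|g x - g y| <= L * cdist x y.

Lemma clip_periodic L g : clip L g -> periodic1 g.
Proof.
move=> h x; apply/eqP; rewrite -subr_eq0 -normr_le0.
have e : cdist (x + 1) x = 0 by apply/cdist_eq0; exists 1.
by have := h (x + 1) x; rewrite e mulr0.
Qed.

Lemma clip_eq L g x y : clip L g -> cdist x y = 0 -> g x = g y.
Proof.
by move=> /clip_periodic h /cdist_eq0[n ->]; rewrite periodic1z.
Qed.

Lemma lipschitz_clip L g : periodic1 g -> lipschitz1 L g -> clip L g.
Proof.
move=> hp hg x y; have [n <-] := cdist_attained x y.
by have := hg x (y + n%:~R); rewrite periodic1z // opprD addrA.
Qed.

Lemma clip_lipschitz L g : 0 <= L -> clip L g -> lipschitz1 L g.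
Proof. by move=> L0 hg x y; rewrite (le_trans (hg x y)) // ler_wpM2l // cdist_le_dist. Qed.

Lemma clip_bounded L g : clip L g -> 0 <= L -> forall x, `|g x| <= `|g 0| + L.
Proof.
move=> hg L0 x; have h := hg x 0; have := cdist_le_half x 0 => h2.
have : L * cdist x 0 <= L by rewrite ler_piMr //; lra.
have := ler_normD (g x - g 0) (g 0); rewrite subrK; lra.
Qed.

Lemma lipschitz_continuous L g : lipschitz1 L g -> continuous g.
Proof.
move=> hg x; apply/cvgrPdist_le => /= e e0.
have M0 : 0 < `|L| + 1 by rewrite ltr_pwDr.
near=> y.
have : `|x - y| <= e / (`|L| + 1).
  near: y; have d0 : 0 < e / (`|L| + 1) by rewrite divr_gt0.
  by have /cvgrPdist_le/(_ _ d0) := @cvg_id _ (nbhs x).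
rewrite ler_pdivlMr // => h; apply: le_trans (hg x y) _.
apply: le_trans h; rewrite mulrC ler_wpM2l //.
by apply: le_trans (ler_norm L) _; rewrite lerDl.
Unshelve. all: by end_near. Qed.

End CircleDistance.

(** * Expanding maps and shadowing *)

Section Expanding.
Variable R : realType.
Implicit Types (x y z : R) (F G H : R -> R).

(** After reduction to the target 0 and [0 < g 0], the values at [M] and [- M] lie outside the range
    from 0 to [g 0 + 1]. Were both above it, [g 0 + 1] would be taken on both sides of 0, against
    injectivity; so one is nonpositive and the intermediate value theorem applies. *)
Lemma expansive_surjective (g : R -> R) (c : R) :
  continuous g -> 0 < c -> (forall x y, c * `|x - y| <= `|g x - g y|) ->
  forall v, exists x, g x = v.
Proof.
move=> gc c0 ge v.
wlog v0 : g gc ge v / v = 0.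
  move=> hw; have [||x hx] := hw (fun x => g x - v) _ _ 0 erefl.
  - by move=> x; apply: cvgB; [exact: gc|exact: cvg_cst].
  - by move=> x y; rewrite opprB addrA subrK.
  - by exists x; lra.
rewrite {}v0 {v}.
have [g00|g00] := eqVneq (g 0) 0; first by exists 0.
wlog g0 : g gc ge g00 / 0 < g 0.
  move=> h; case: (ltgtP (g 0) 0) => g0; last by rewrite g0 eqxx in g00.
    have [||||x hx] := h (fun x => - g x).
    - by move=> x; apply: cvgN; exact: gc.
    - by move=> x y; rewrite -opprD normrN.
    - by rewrite oppr_eq0.
    - by rewrite oppr_gt0.
    - by exists x; lra.
  exact: (h g).
have ivt a b u : a <= b -> Num.min (g a) (g b) <= u <= Num.max (g a) (g b) ->
    exists2 x, x \in `[a, b] & g x = u.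
  by move=> ab; apply: IVT => //; exact: continuous_subspaceT.
pose M := (g 0 + 1) / c.
have M0 : 0 < M by rewrite divr_gt0 // addr_gt0.
have big x : `|x| = M -> g x <= 0 \/ g 0 + 1 <= g x.
  move=> xM; have := ge x 0; rewrite subr0 xM /M mulrC divfK ?gt_eqF // ler_normr.
  case/orP => h; [right|left]; lra.
have hm : `|(- M)| = M by rewrite normrN gtr0_norm.
have [h1|h1] := big M (gtr0_norm M0).
  case: (ivt 0 M 0 (ltW M0)); last by move=> x _; exists x.
  by rewrite ge_min h1 orbT le_max (ltW g0).
have [h2|h2] := big (- M) hm.
  case: (ivt (- M) 0 0); rewrite ?oppr_le0 ?(ltW M0) //; last by move=> x _; exists x.
  by rewrite ge_min h2 /= le_max (ltW g0) orbT.
have [|x x1 gx] := ivt 0 M (g 0 + 1) (ltW M0).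
  by rewrite ge_min lerDl ler01 /= le_max h1 orbT.
have [||y y1 gy] := ivt (- M) 0 (g 0 + 1).
- by rewrite oppr_le0 ltW.
- by rewrite ge_min lerDl ler01 orbT /= le_max h2.
have xy : x = y.
  apply/eqP; rewrite -subr_eq0 -normr_le0 -(pmulr_rle0 _ c0).
  by rewrite (le_trans (ge x y)) // gx gy subrr normr0.
move: x1 y1; rewrite !in_itv /= xy => /andP[y0 _] /andP[_ y0'].
have yz : y = 0 by apply/le_anti; rewrite y0 y0'.
by move: gy; rewrite yz; lra.
Qed.

(* [H] is a coordinate on the universal cover in which [G] expands at every
   step, whereas [expanding] only gives expansion after many steps. *)
Record adapted (H G : R -> R) (h b kap B : R) : Prop := Adapted {
  adapted_kap : 1 < kap;
  adapted_lift : is_lift G;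
  adapted_lip : lipschitz1 B G;
  adapted_shift : forall x, H (x + 1) = H x + h;
  adapted_ge : forall x y, `|x - y| <= `|H x - H y|;
  adapted_le : forall x y, `|H x - H y| <= b * `|x - y|;
  adapted_expand : forall x y, kap * `|H x - H y| <= `|H (G x) - H (G y)| }.

Lemma lift_cdist0 G x y : is_lift G -> cdist x y = 0 -> cdist (G x) (G y) = 0.
Proof.
move=> [k hk] /cdist_eq0[n ->].
have h (m : nat) t : cdist (G (t + m%:R)) (G t) = 0.
  elim: m => [|m IH]; first by rewrite addr0 cdistxx.
  by rewrite -natr1 addrA hk cdist_addzl.
case: n => m; first by rewrite -pmulrn h.
by rewrite NegzE intrN -pmulrn -[RHS](h m.+1 (y - m.+1%:R)) subrK cdistC.
Qed.

Lemma iter_cdist0 G n x y :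
  is_lift G -> cdist x y = 0 -> cdist (iter n G x) (iter n G y) = 0.
Proof. by move=> hG xy; elim: n => //= n; apply: lift_cdist0. Qed.

Lemma lipschitz_lift_cdist (B : R) G x y :
  is_lift G -> lipschitz1 B G -> cdist (G x) (G y) <= B * cdist x y.
Proof.
move=> lG hB; have [n <-] := cdist_attained x y.
have := hB x (y + n%:~R); rewrite opprD addrA; apply: le_trans.
have <- : cdist (G (y + n%:~R)) (G x) = cdist (G x) (G y).
  by rewrite cdistC; rewrite ![cdist (G x) _]cdistC; apply/cdist_eq0_trans/lift_cdist0/cdist_eq0 => //; exists n.
by rewrite cdistC cdist_le_dist.
Qed.

Lemma near_lift_ex y t : exists s, cdist s t = 0 /\ `|y - s| = cdist y t.
Proof.
have [n hn] := cdist_attained y t; exists (t + n%:~R).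
by rewrite opprD addrA; split => //; apply/cdist_eq0; exists n.
Qed.

Section Adapted.
Variables (H G : R -> R) (h b kap B : R).
Hypothesis aG : adapted H G h b kap B.
Let k1 : 1 < kap := adapted_kap aG.
Let lG : is_lift G := adapted_lift aG.

Lemma adapted_b1 : 1 <= b.
Proof.
have := le_trans (adapted_ge aG 1 0) (adapted_le aG 1 0).
by rewrite subr0 normr1 mulr1.
Qed.
Let b1 := adapted_b1.

Lemma adapted_contG : continuous G.
Proof. exact: lipschitz_continuous (adapted_lip aG). Qed.

Lemma adapted_contH : continuous H.
Proof. exact: lipschitz_continuous (adapted_le aG). Qed.

Lemma adapted_inj x y : H x = H y -> x = y.
Proof.
move=> e; have := adapted_ge aG x y.
by rewrite e subrr normr0 normr_le0 subr_eq0 => /eqP.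
Qed.

Lemma adapted_shiftz (n : int) x : H (x + n%:~R) = H x + n%:~R * h.
Proof.
have hn (m : nat) t : H (t + m%:R) = H t + m%:R * h.
  elim: m => [|m IH]; first by rewrite addr0 mul0r addr0.
  by rewrite -natr1 addrA (adapted_shift aG) IH mulrDl mul1r addrA.
case: n => m; first by rewrite -pmulrn hn.
rewrite NegzE intrN -pmulrn mulNr.
by apply/eqP; rewrite -subr_eq opprK -hn subrK.
Qed.

Lemma adapted_iter n x y :
  kap ^+ n * `|H x - H y| <= `|H (iter n G x) - H (iter n G y)|.
Proof.
elim: n => [|n IH]; first by rewrite expr0 mul1r.
rewrite exprS -mulrA iterS iterS; apply: le_trans (adapted_expand aG _ _).
by rewrite ler_wpM2l // ltW // (lt_trans ltr01).
Qed.

Lemma continuous_iter n : continuous (iter n G).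
Proof.
elim: n => [|n IH] x; first exact: cvg_id.
by rewrite /=; apply: continuous_comp; [exact: IH|exact: adapted_contG].
Qed.

(** Provides backward orbits: [subaction_step] uses it to end an orbit segment exactly at a lift of
    a given point. *)
Lemma iter_surj n v : exists x, iter n G x = v.
Proof.
have b0 : 0 < b by rewrite (lt_le_trans ltr01).
have kn : 1 <= kap ^+ n by rewrite exprn_ege1 // ltW.
apply: (@expansive_surjective _ b^-1); rewrite ?invr_gt0 //.
  exact: continuous_iter.
move=> x y; rewrite mulrC ler_pdivrMr // mulrC.
apply: le_trans (adapted_le aG _ _); apply: le_trans (adapted_iter n x y).
by apply: le_trans (adapted_ge aG x y) _; rewrite ler_peMl.
Qed.

(** As [H] is expanded by [kap ^+ p] along [iter p G], the difference [H (iter p G z) - H z] is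
    itself expansive in [z], hence takes the value [m * h]; injectivity of [H] does the rest. *)
Lemma closing (m : int) p : (0 < p)%N -> exists z, iter p G z = z + m%:~R.
Proof.
move=> p0.
have kp : 1 < kap ^+ p by rewrite exprn_egt1 // -lt0n.
have [||x y|z hz] := @expansive_surjective
    (fun z => H (iter p G z) - H z) (kap ^+ p - 1) _ _ _ (m%:~R * h).
- by move=> x; apply: cvgB; [|exact: adapted_contH];
    apply: (@continuous_comp _ _ _ (iter p G) H);
    [exact: continuous_iter|exact: adapted_contH].
- by rewrite subr_gt0.
- rewrite mulrBl mul1r.
  have h1 := adapted_iter p x y; have h2 := adapted_ge aG x y.
  have h3 : (kap ^+ p - 1) * `|x - y| <= (kap ^+ p - 1) * `|H x - H y|.
    by rewrite ler_wpM2l // subr_ge0 ltW.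
  have h4 := lerB_dist (H (iter p G x) - H (iter p G y)) (H x - H y).
  rewrite (_ : H (iter p G x) - H x - (H (iter p G y) - H y) =
    H (iter p G x) - H (iter p G y) - (H x - H y)); last by ring.
  lra.
exists z; apply: adapted_inj; rewrite adapted_shiftz.
by move: hz; lra.
Qed.

(** The pseudo-orbit is lifted so that each jump becomes a distance on the line, and [closing] gives
    an orbit with the same total displacement. The [H]-distances [D i] between the two satisfy
    [kap * D i <= D i.+1 + b * jump] and [D p = D 0]; summing over the period gives the bound. The
    form as a sum is what Birkhoff sums and the later splitting consume. *)
Lemma shadowing (x : nat -> R) p : (0 < p)%N -> cdist (x p) (x 0) = 0 ->
  exists z, cdist (iter p G z) z = 0 /\
   \sum_(i < p) cdist (iter i G z) (x i)
     <= b / (kap - 1) * \sum_(i < p) cdist (G (x i)) (x i.+1).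
Proof.
move=> p0 xp.
have [X [X0 XS]] : exists X : nat -> R, X 0 = x 0 /\ forall n,
    cdist (X n.+1) (x n.+1) = 0 /\ `|G (X n) - X n.+1| = cdist (G (X n)) (x n.+1).
  pose nl y t := projT1 (cid (near_lift_ex y t)).
  pose X := fix X n := if n is m.+1 then nl (G (X m)) (x m.+1) else x 0.
  exists X; split => // n; exact: (projT2 (cid (near_lift_ex _ _))).
have Xx n : cdist (X n) (x n) = 0 by case: n => [|n]; [rewrite X0 cdistxx|case: (XS n)].
have XE n : `|G (X n) - X n.+1| = cdist (G (x n)) (x n.+1).
  by have [_ ->] := XS n; apply: cdist_eq0_trans; apply: lift_cdist0.
have /cdist_eq0[m Xm] : cdist (X p) (X 0) = 0.
  by rewrite X0 (cdist_eq0_trans _ (Xx p)).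
have [z hz] := closing m p0; exists z; split; first by rewrite hz cdist_addzl cdistxx.
pose D i := `|H (iter i G z) - H (X i)|.
have DS i : kap * D i <= D i.+1 + b * cdist (G (x i)) (x i.+1).
  apply: le_trans (adapted_expand aG _ _) _.
  rewrite -XE; apply: le_trans (lerD (lexx _) (adapted_le aG _ _)).
  by rewrite /D iterS; apply: le_trans (ler_normB _ _); rewrite opprB addrA subrK.
have Dp : D p = D 0.
  by rewrite /D hz Xm !adapted_shiftz; congr `|_|; rewrite /=; ring.
have kk : 0 < kap - 1 by rewrite subr_gt0.
rewrite mulrAC ler_pdivlMr //.
apply: (@le_trans _ _ ((\sum_(i < p) D i) * (kap - 1))).
  rewrite ler_wpM2r ?(ltW kk) //; apply: ler_sum => i _.
  have -> : cdist (iter i G z) (x i) = cdist (iter i G z) (X i).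
    by rewrite ![cdist (iter i G z) _]cdistC; apply/esym/cdist_eq0_trans.
  exact: le_trans (cdist_le_dist _ _) (adapted_ge aG _ _).
have : \sum_(i < p) (kap * D i) <= \sum_(i < p) (D i.+1 + b * cdist (G (x i)) (x i.+1)).
  by apply: ler_sum => i _; exact: DS.
rewrite big_split /= -!mulr_sumr.
have -> : \sum_(i < p) D i.+1 = \sum_(i < p) D i.
  have := big_ord_recl p D (idx := 0) (op := +%R).
  rewrite big_ord_recr /= Dp => e.
  by rewrite (eq_bigr (fun i : 'I_p => D (bump 0 i))) //; lra.
lra.
Qed.

(** Distances contract geometrically backwards in time, so the one at time [n] dominates the sum. *)
Lemma iter_sum_dist n x y :
  \sum_(i < n) `|iter i G x - iter i G y|
    <= b / (kap - 1) * `|iter n G x - iter n G y|.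
Proof.
have kk : 0 < kap - 1 by rewrite subr_gt0.
rewrite mulrAC ler_pdivlMr //.
apply: le_trans (adapted_le aG _ _).
pose D i := `|H (iter i G x) - H (iter i G y)|.
apply: (@le_trans _ _ ((\sum_(i < n) D i) * (kap - 1))).
  rewrite ler_wpM2r ?(ltW kk) //.
  by apply: ler_sum => i _; rewrite /D (adapted_ge aG).
rewrite -/(D n); elim: n => [|n IH]; first by rewrite big_ord0 mul0r normr_ge0.
rewrite big_ord_recr /= mulrDl; have := adapted_expand aG (iter n G x) (iter n G y).
rewrite -!iterS -/(D n) -/(D n.+1); lra.
Qed.

Lemma iter_contract i n x y :
  kap ^+ n * `|iter i G x - iter i G y| <= b * `|iter (n + i) G x - iter (n + i) G y|.
Proof.
apply: le_trans (adapted_le aG _ _); rewrite !iterD.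
apply: le_trans (adapted_iter _ _ _).
by rewrite ler_wpM2l ?exprn_ge0 ?(ltW (lt_trans ltr01 k1)) // (adapted_ge aG).
Qed.

End Adapted.
End Expanding.

(** * Sub-actions *)

Section SubAction.
Variable R : realType.
Variables (H F f : R -> R) (h b kap B L : R).
Hypothesis aF : adapted H F h b kap B.
Hypothesis L0 : 0 <= L.
Hypothesis fL : clip L f.
Let k1 : 1 < kap := adapted_kap aF.
Let lF : is_lift F := adapted_lift aF.

Lemma adapted_const_ge0 : 0 <= b / (kap - 1).
Proof. by rewrite divr_ge0 ?(le_trans ler01 (adapted_b1 aF)) // subr_ge0 ltW. Qed.
Let C := b / (kap - 1).
Let C0 : 0 <= C := adapted_const_ge0.

Definition birkhoff (G g : R -> R) n x := \sum_(i < n) g (iter i G x).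

Lemma birkhoffS G g n x : birkhoff G g n.+1 x = birkhoff G g n x + g (iter n G x).
Proof. by rewrite /birkhoff big_ord_recr. Qed.

Lemma birkhoffD G g m n x :
  birkhoff G g (m + n) x = birkhoff G g m x + birkhoff G g n (iter m G x).
Proof.
elim: n => [|n IH]; first by rewrite addn0 {3}/birkhoff big_ord0 addr0.
by rewrite addnS !birkhoffS IH -iterD addrA addnC.
Qed.

Lemma birkhoff_cdist0 G g n x y (l : R) : is_lift G -> clip l g ->
  cdist x y = 0 -> birkhoff G g n x = birkhoff G g n y.
Proof.
move=> lG gl xy; apply: eq_bigr => i _.
by apply: clip_eq gl _; exact: iter_cdist0.
Qed.

Definition orbit_averages := [set r | exists p z, (0 < p)%N /\
  cdist (iter p F z) z = 0 /\ r = birkhoff F f p z / p%:R].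

(** Taken over periodic orbits instead of invariant measures, so that shadowing alone gives
    [birkhoff_lower]. *)
Definition min_average := inf orbit_averages.
Let alpha := min_average.

Lemma orbit_averages_lb : has_lbound orbit_averages.
Proof.
exists (- (`|f 0| + L)) => r [p [z [p0 [_ ->]]]].
rewrite ler_pdivlMr ?ltr0n // /birkhoff -[X in _ * X%:R]card_ord.
rewrite mulr_natr -sumr_const; apply: ler_sum => i _.
by have := clip_bounded fL L0 (iter i F z); rewrite ler_norml => /andP[].
Qed.

Lemma min_average_le p z : (0 < p)%N -> cdist (iter p F z) z = 0 ->
  p%:R * alpha <= birkhoff F f p z.
Proof.
move=> p0 hz; rewrite mulrC -ler_pdivlMr ?ltr0n //.
by apply: (ge_inf orbit_averages_lb); exists p, z.
Qed.

(** The segment is closed by a single jump of size at most [1 / 2]; the shadowing periodic orbit has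
    average at least [alpha], and the defect does not grow with [n]. *)
Lemma birkhoff_lower n x : n%:R * alpha - L * C <= birkhoff F f n x.
Proof.
case: n => [|n]; first by rewrite mul0r sub0r /birkhoff big_ord0 oppr_le0 mulr_ge0.
pose y i := if (i == n.+1)%N then x else iter i F x.
have [|z [hz hs]] := shadowing aF (x := y) (ltn0Sn n); first by rewrite /y eqxx cdistxx.
have he : \sum_(i < n.+1) cdist (F (y i)) (y i.+1) <= 1.
  rewrite big_ord_recr /= big1 ?add0r => [|i _].
    by apply: le_trans (cdist_le_half _ _) _; lra.
  rewrite /y !ltn_eqF ?ltnS ?ltn_ord //; first by rewrite cdistxx.
  by rewrite ltnW.
have := min_average_le (ltn0Sn n) hz.
have : birkhoff F f n.+1 z <= birkhoff F f n.+1 x + L * (C * 1).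
  apply: (@le_trans _ _ (birkhoff F f n.+1 x + L * \sum_(i < n.+1) cdist (iter i F z) (y i))).
    rewrite mulr_sumr -big_split /=; apply: ler_sum => i _.
    have := fL (iter i F z) (iter i F x); rewrite /y ltn_eqF //.
    by rewrite ler_norml => /andP[_]; lra.
  by rewrite lerD2l ler_wpM2l // (le_trans hs) // ler_wpM2l.
lra.
Qed.

Lemma birkhoff_distortion n x y :
  birkhoff F f n x <= birkhoff F f n y + L * C * `|iter n F x - iter n F y|.
Proof.
rewrite -mulrA; apply: (@le_trans _ _ (birkhoff F f n y + L *
   \sum_(i < n) `|iter i F x - iter i F y|)); last first.
  by rewrite lerD2l ler_wpM2l // (iter_sum_dist aF).
rewrite mulr_sumr -big_split /=; apply: ler_sum => i _.
by have := clip_lipschitz L0 fL (iter i F x) (iter i F y); rewrite ler_norml => /andP[_]; lra.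
Qed.

Let Lam := L * C.
Let Lam0 : 0 <= Lam. Proof. exact: mulr_ge0. Qed.

(** A segment may end anywhere, at a price. The penalty makes the infimum Lipschitz at once; its
    rate [Lam] is the constant of [birkhoff_distortion], so moving the end point onto [y] costs no
    more than the penalty saved. *)
Definition action_costs y := [set r | exists n x,
  r = birkhoff F f n x - n%:R * alpha + Lam * cdist (iter n F x) y].

Definition subaction y := inf (action_costs y).
Local Notation u := subaction.

Lemma action_costs_lb y : lbound (action_costs y) (- (L * C)).
Proof.
move=> r [n [x ->]]; have := birkhoff_lower n x.
by have := mulr_ge0 Lam0 (cdist_ge0 (iter n F x) y); lra.
Qed.

Lemma subaction_le n x y :
  u y <= birkhoff F f n x - n%:R * alpha + Lam * cdist (iter n F x) y.
Proof. by apply: ge_inf; [exists (- (L * C)); exact: action_costs_lb|exists n, x]. Qed.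

Lemma subaction_ge y v :
  (forall n x, v <= birkhoff F f n x - n%:R * alpha + Lam * cdist (iter n F x) y) ->
  v <= u y.
Proof.
move=> hv; apply: lb_le_inf.
  by exists (birkhoff F f 0 y - 0%:R * alpha + Lam * cdist (iter 0 F y) y), 0%N, y.
by move=> r [n [x ->]].
Qed.

Lemma subaction_clip : clip Lam u.
Proof.
suff hs y z : u y <= u z + Lam * cdist y z.
  by move=> y z; have := hs y z; have := hs z y; rewrite (cdistC z) ler_norml; lra.
rewrite -lerBlDr; apply: subaction_ge => n x.
have := subaction_le n x y.
have : Lam * cdist (iter n F x) y <= Lam * (cdist (iter n F x) z + cdist z y).
  by rewrite ler_wpM2l // cdist_triangle.
rewrite mulrDr (cdistC z y); lra.
Qed.

(** A segment ending near [y] is pulled back along the same branch to one ending at a lift of [y];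
    distortion charges at most the penalty, and one further step reaches [F y] with penalty zero. *)
Lemma subaction_step y : u (F y) <= u y + f y - alpha.
Proof.
rewrite -lerBlDr -lerBlDr; apply: subaction_ge => n x.
have [j hj] := cdist_attained (iter n F x) y.
have [x' hx'] := iter_surj aF n (y + j%:~R).
have := birkhoff_distortion n x' x; rewrite hx'.
have -> : `|y + j%:~R - iter n F x| = cdist (iter n F x) y.
  by rewrite -hj -normrN; congr `|_|; ring.
have := subaction_le n.+1 x' (F y).
rewrite birkhoffS iterS hx'.
have e0 : cdist (y + j%:~R) y = 0 by rewrite cdist_addzl cdistxx.
rewrite (lift_cdist0 lF e0) (clip_eq fL e0) mulr0 -natr1 mulrDl mul1r -/Lam.
lra.
Qed.

Definition reduced x := f x - alpha - u (F x) + u x.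

Lemma reduced_ge0 x : 0 <= reduced x.
Proof. by have := subaction_step x; rewrite /reduced; lra. Qed.

Lemma lipschitz1_ge0 (l : R) g : lipschitz1 l g -> 0 <= l.
Proof.
by move=> /(_ 1 0); rewrite subr0 normr1 mulr1; apply: le_trans.
Qed.

Lemma reduced_clip : clip (L + Lam * B + Lam) reduced.
Proof.
move=> x y; have h1 := fL x y; have h2 := subaction_clip x y.
have h3 := subaction_clip (F x) (F y).
have h4 : Lam * cdist (F x) (F y) <= Lam * B * cdist x y.
  by rewrite -mulrA ler_wpM2l // (lipschitz_lift_cdist _ _ lF (adapted_lip aF)).
move: h1 h2 h3; rewrite /reduced !ler_norml => /andP[? ?] /andP[? ?] /andP[? ?].
by rewrite !mulrDl; apply/andP; split; lra.
Qed.

Lemma birkhoff_reduced n x :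
  birkhoff F reduced n x = birkhoff F f n x - n%:R * alpha - u (iter n F x) + u x.
Proof.
elim: n => [|n IH]; first by rewrite /birkhoff !big_ord0 /=; lra.
by rewrite !birkhoffS IH /reduced -natr1 iterS; lra.
Qed.

Lemma reduced_lip0 : 0 <= L + Lam * B + Lam.
Proof.
by rewrite !addr_ge0 // mulr_ge0 //; exact: lipschitz1_ge0 (adapted_lip aF).
Qed.

Lemma reduced_iter_continuous i : continuous (fun x => reduced (iter i F x)).
Proof.
move=> x; apply: (@continuous_comp _ _ _ (iter i F) reduced).
  exact: continuous_iter aF _ _.
exact: lipschitz_continuous (clip_lipschitz reduced_lip0 reduced_clip) _.
Qed.

Lemma birkhoff_periodic_shift g (l : R) p z j : clip l g -> cdist (iter p F z) z = 0 ->
  birkhoff F g p (iter j F z) = birkhoff F g p z.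
Proof.
move=> gl hz; have := birkhoffD F g p j z; rewrite addnC birkhoffD.
by rewrite (birkhoff_cdist0 j lF gl hz); lra.
Qed.

(** Minimise the [N]-step sum of [reduced]. A positive minimum [g x] would force every periodic
    average of [f] up to [alpha + g x / N], against the definition of [alpha] as an infimum. *)
Lemma reduced_zero_segment N : exists2 x, x \in `[0, 1] &
  forall i, (i < N)%N -> reduced (iter i F x) = 0.
Proof.
pose g := birkhoff F reduced N.
have [] := @EVT_min R g 0 1 ler01.
  apply: continuous_subspaceT; rewrite /g; elim: N {g} => [|N IH] x.
    rewrite (_ : birkhoff F reduced 0 = fun=> 0); first exact: cvg_cst.
    by apply/funext => t; rewrite /birkhoff big_ord0.
  rewrite (_ : birkhoff F reduced N.+1 =
    fun t => birkhoff F reduced N t + reduced (iter N F t)); last first.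
    by apply/funext => t; rewrite birkhoffS.
  by apply: cvgD; [exact: IH|exact: reduced_iter_continuous].
move=> x x01 gx; exists x => // i iN.
suff g0 : g x <= 0.
  apply/le_anti; rewrite reduced_ge0 andbT (le_trans _ g0) //.
  rewrite /g /birkhoff (bigD1 (Ordinal iN)) //= lerDl sumr_ge0 // => j _.
  exact: reduced_ge0.
rewrite leNgt; apply/negP => gx0.
have N0 : (0 < N)%N by case: (N) iN.
have gall y : g x <= g y.
  have -> : g y = g (frac y).
    apply: birkhoff_cdist0 lF reduced_clip _.
    by rewrite cdistC /frac -intrN cdist_addzl cdistxx.
  by apply: gx; rewrite in_itv /= frac_ge0 ltW // frac_lt1.
suff : alpha + g x / N%:R <= alpha.
  by rewrite gerDl leNgt divr_gt0 // ltr0n.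
rewrite {2}/alpha; apply: lb_le_inf.
  (* The constant pseudo-orbit of period 1 is shadowed by a fixed point, so the set of averages is
     nonempty. *)
  have [|z [hz _]] := shadowing aF (x := fun=> 0) (ltn0Sn 0); first exact: cdistxx.
  by exists (birkhoff F f 1 z / 1%:R), 1%N, z.
move=> r [p [z [p0 [hz ->]]]].
have P0 : (0 : R) < p%:R by rewrite ltr0n.
have NN0 : (0 : R) < N%:R by rewrite ltr0n.
have e1 : birkhoff F reduced p z = birkhoff F f p z - p%:R * alpha.
  by rewrite birkhoff_reduced (clip_eq subaction_clip hz); lra.
(* Double counting: going round the periodic orbit, each value of [reduced] occurs in [N]
   windows. *)
have e2 : \sum_(j < p) g (iter j F z) = N%:R * birkhoff F reduced p z.
  rewrite /g /birkhoff exchange_big /= -[N in N%:R]card_ord mulrC mulr_natr -sumr_const.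
  apply: eq_bigr => k _.
  rewrite -[RHS](birkhoff_periodic_shift k reduced_clip hz).
  by apply: eq_bigr => j _; rewrite -!iterD addnC.
have : p%:R * g x <= N%:R * birkhoff F reduced p z.
  rewrite -e2 -[p in p%:R]card_ord mulrC mulr_natr -sumr_const.
  by apply: ler_sum => j _.
rewrite e1 ler_pdivlMr // => hh.
rewrite -(ler_pM2l NN0) (le_trans _ (_ : p%:R * g x + N%:R * (p%:R * alpha) <= _)) //.
  rewrite le_eqVlt; apply/orP; left; apply/eqP; field.
  by rewrite gt_eqF.
by move: hh; rewrite mulrBr; lra.
Qed.

(** Compactness: the starting points of ever longer zero segments cluster at some [y], and
    positivity of [reduced] at time [i] would be an open condition violated by all late ones. *)
Lemma reduced_zero_orbit : exists x, forall i, reduced (iter i F x) = 0.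
Proof.
pose x N := s2val (cid2 (reduced_zero_segment N)).
have x01 N : x N \in `[0, 1] := s2valP (cid2 (reduced_zero_segment N)).
have xz N i : (i < N)%N -> reduced (iter i F (x N)) = 0.
  exact: (s2valP' (cid2 (reduced_zero_segment N))).
have := @segment_compact R 0 1 (x @ \oo) _.
case; first by exists 0%N => // n _; exact: x01.
move=> y [_ ycl]; exists y => i; apply/eqP; rewrite eq_le reduced_ge0 andbT leNgt.
apply/negP => ry.
have [||z [/= -> ]] := ycl [set z | reduced (iter i F z) = 0]
   [set z | 0 < reduced (iter i F z)].
- by exists i.+1 => // n /= /xz.
- have := @reduced_iter_continuous i y => /(_ [set t | 0 < t]); apply.
  exact: lt_nbhsr.
by rewrite /= ltxx.
Qed.

End SubAction.

(** * Counting words *)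

Section Words.
Variables (A : finType) (w : nat -> A).

Definition word n i : n.-tuple A := [tuple w (i + k) | k < n].

Definition words n : {set n.-tuple A} := [set t | `[< exists i, word n i = t >]].

(** Consecutive edges of a walk may be witnessed at unrelated positions of [w], so a closed walk is
    a return only up to jumps between occurrences of the same word. *)
Definition follows n (s t : n.-tuple A) :=
  `[< exists i, word n i = s /\ word n (i + n) = t >].

Definition closed_walk n m := exists (s : n.-tuple A) p,
  [/\ p != [::], path (@follows n) s p, last s p = s & (size p <= m)%N].

Lemma word_eq n i i' k : word n i = word n i' -> (k < n)%N -> w (i + k) = w (i' + k).
Proof.
move=> e kn; have := congr1 (fun t => tnth t (Ordinal kn)) e.
by rewrite !tnth_mktuple.
Qed.

Lemma follows_word n i : follows (word n i) (word n (i + n)).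
Proof. by apply/asboolP; exists i. Qed.

Definition word_path n m i := mkseq (fun k => word n (i + k * n)) m.

Lemma word_path_sorted n m i : sorted (@follows n) (word_path n m i).
Proof.
apply/(sortedP (word n i)) => k; rewrite size_mkseq => km.
rewrite !nth_mkseq ?(ltnW km) // mulSn (addnC n) addnA.
exact: follows_word.
Qed.

Lemma word_path_sub n m i : {subset word_path n m i <= words n}.
Proof.
move=> t /mapP[k _ ->]; rewrite inE; apply/asboolP; by exists (i + k * n)%N.
Qed.

(** The stretch of the path between two occurrences of a repeated word would be a closed walk. *)
Lemma word_path_uniq n m i : ~ closed_walk n (m + m) -> uniq (word_path n m i).
Proof.
apply: contra_notT => /(uniqPn (word n i)) [a [b [ab]]].
rewrite size_mkseq => bm; rewrite !nth_mkseq ?(ltn_trans ab) // => e.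
exists (word n (i + a * n)), (mkseq (fun k => word n (i + (a + k.+1) * n)) (b - a)).
split.
- by rewrite -size_eq0 size_mkseq subn_eq0 -ltnNge.
- apply/(pathP (word n i)) => k; rewrite size_mkseq => kb.
  rewrite nth_mkseq //.
  have -> : (i + (a + k.+1) * n = i + (a + k) * n + n)%N by rewrite addnS mulSn (addnC n) addnA.
  case: k kb => [|k] kb /=; first by rewrite addn0 follows_word.
  by rewrite nth_mkseq ?(ltnW kb) // follows_word.
- rewrite -nth_last size_mkseq.
  rewrite nth_mkseq; last by rewrite ltn_predL subn_gt0.
  by rewrite prednK ?subn_gt0 // subnKC ?e // ltnW.
- by rewrite size_mkseq (leq_trans (leq_subr _ _)) // (leq_trans (ltnW bm)) // leq_addr.
Qed.

(* A finite acyclic graph has at most one Hamiltonian path, so a path of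
   distinct words is determined by the set of its vertices. *)
Lemma word_path_inj n m i i' : ~ closed_walk n (m + m) ->
  word_path n m i =i word_path n m i' -> word_path n m i = word_path n m i'.
Proof.
move=> nc ii'; have u := word_path_uniq i nc; have u' := word_path_uniq i' nc.
pose X := word_path n m i.
pose e : rel (n.-tuple A) := [rel s t | [&& follows s t, s \in X & t \in X]].
have short s t : connect e s t -> exists p, [/\ path (@follows n) s p, t = last s p & (size p <= m)%N].
  move=> /connectP[p0 p0s ->]; case: (shortenP p0s) => p ps /= /andP[_ up] _.
  exists p; split => //; first by apply: sub_path ps => x y /= /andP[].
  rewrite -[m](size_mkseq (fun k => word n (i + k * n))) -/(word_path n m i).
  apply: uniq_leq_size => // y yp.
  elim: p s {up p0s} ps yp => //= z p IH s /andP[/and3P[_ _ zX] zp].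
  by rewrite inE => /orP[/eqP->|yp]; [exact: zX|exact: IH zp yp].
(* Distinct words reachable from each other would give a closed walk of length at most [m + m]. So
   reachability inside [X] is an order, and both paths are sorted for it. *)
have anti : antisymmetric (connect e).
  move=> s t /andP[/short[p [sp tl pm]] /short[q [tq sl qm]]].
  apply/eqP/negPn/negP => st; apply: nc; exists s, (p ++ q); split.
  - by case: p {sp pm} tl => //= ts; rewrite ts eqxx in st.
  - by rewrite cat_path sp -tl.
  - by rewrite last_cat -tl.
  - by rewrite size_cat leq_add.
have srt j : word_path n m j =i X -> sorted (connect e) (word_path n m j).
  move=> jX; apply/(sortedP (word n i)) => k km; apply: connect1; apply/and3P; split.
  - by have /(sortedP (word n i)) := word_path_sorted n m j; apply.
  - by have <- := jX (nth (word n i) (word_path n m j) k); rewrite mem_nth // ltnW.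
  - by have <- := jX (nth (word n i) (word_path n m j) k.+1); rewrite mem_nth.
apply: (sorted_eq (@connect_trans _ e) anti); [exact: srt|exact/srt/fsym|exact: uniq_perm].
Qed.

Lemma word_path_word n m i i' : (0 < n)%N ->
  word_path n m i = word_path n m i' -> word (m * n) i = word (m * n) i'.
Proof.
move=> n0 e; apply: eq_from_tnth => k; rewrite !tnth_mktuple.
have km : (k %/ n < m)%N by rewrite ltn_divLR.
have := congr1 (fun s => nth (word n i) s (k %/ n)) e.
rewrite !nth_mkseq // => /word_eq/(_ (ltn_pmod k n0)).
by rewrite -!addnA -divn_eq.
Qed.

Lemma ffact_leq_exp n m : (n ^_ m <= n ^ m)%N.
Proof.
by elim: m => // m IH; rewrite ffactnSr expnSr leq_mul // leq_subr.
Qed.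

(** A word of length [m * n] is determined by the set of its [m] blocks, so a binomial coefficient
    bounds their number; m! is the gain over counting sequences of blocks. *)
Lemma words_card_mul n m : (0 < n)%N -> ~ closed_walk n (m + m) ->
  (#|words (m * n)| * m`! <= #|words n| ^ m)%N.
Proof.
move=> n0 nc.
pose pos (t : (m * n).-tuple A) :=
  if pselect (exists i, word (m * n) i = t) is left e then projT1 (cid e) else 0%N.
have posP t : t \in words (m * n) -> word (m * n) (pos t) = t.
  by rewrite inE => /asboolP ht; rewrite /pos; case: pselect => // ?; case: cid.
pose phi t := [set s in word_path n m (pos t)].
have phi_inj : {in words (m * n) &, injective phi}.
  move=> s t sW tW /setP st; rewrite -(posP s) // -(posP t) //.
  apply: word_path_word => //; apply: word_path_inj => // x.
  by have := st x; rewrite !inE.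
rewrite -(card_in_imset phi_inj).
apply: leq_trans (ffact_leq_exp _ _); rewrite -bin_ffact leq_mul2r; apply/orP; right.
rewrite -cards_draws; apply: subset_leq_card; apply/fintype.subsetP => B /imsetP[t tW ->].
rewrite inE; apply/andP; split.
  by apply/fintype.subsetP => s; rewrite inE; exact: word_path_sub.
rewrite cardsE; apply/eqP.
by have /card_uniqP -> := word_path_uniq (pos t) nc; rewrite size_mkseq.
Qed.

Lemma words_card_gt0 n : (0 < #|words n|)%N.
Proof. by apply/card_gt0P; exists (word n 0); rewrite inE; apply/asboolP; exists 0%N. Qed.

End Words.

(** * Growth rates and the existence of short closed walks *)

Section Rate.
Variable R : realType.

Lemma bernoulli (t : R) n : 1 <= t -> 1 + n%:R * (t - 1) <= t ^+ n.
Proof.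
move=> t1; elim: n => [|n IH]; first by rewrite mul0r addr0.
have h : 1 <= t ^+ n by rewrite exprn_ege1.
have : (t - 1) * 1 <= (t - 1) * t ^+ n by rewrite ler_wpM2l // subr_ge0.
by rewrite exprS -natr1; lra.
Qed.

Lemma expr_gt (t a : R) : 1 < t -> exists r : nat, a < t ^+ r.
Proof.
move=> t1; have t0 : 0 < t - 1 by rewrite subr_gt0.
exists (Num.Def.truncn (a / (t - 1))).+1.
apply: lt_le_trans (bernoulli _ (ltW t1)).
have : a / (t - 1) < (Num.Def.truncn (a / (t - 1))).+1%:R.
  exact: truncnS_gt.
by rewrite ltr_pdivrMr //; lra.
Qed.

(* Without short closed walks the growth rate of the number of words would
   drop by the factor [t] from length [n] to length [m n * n], again and again. *)
Lemma closed_walk_exists (A : finType) (w : nat -> A) (t : R) (m : nat -> nat) n0 :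
  1 < t -> (0 < n0)%N ->
  (forall n, (0 < n)%N -> (0 < m n)%N /\ t ^+ (m n * n) <= (m n)`!%:R) ->
  exists2 n, (n0 <= n)%N & closed_walk w n (m n + m n).
Proof.
move=> t1 n00 hm; apply/not_exists2P => hno.
have t0 : 0 <= t by rewrite ltW // (lt_trans ltr01).
(* Going from [n] to [m n * n] preserves the savings made so far and adds one factor [t] per letter,
   since the factorial of [m n] is at least [t ^+ (m n * n)]. With [t ^+ r] above the size of [A] no
   word would be left. *)
have claim r : exists2 n, (n0 <= n)%N &
    #|words w n|%:R * t ^+ (r * n) <= #|A|%:R ^+ n.
  elim: r => [|r [n nn hn]].
    exists n0 => //; rewrite mul0n mulr1 -natrX ler_nat.
    by rewrite -card_tuple max_card.
  have n_gt0 := leq_trans n00 nn; have [m0 hmn] := hm _ n_gt0.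
  exists (m n * n)%N; first by rewrite (leq_trans nn) // leq_pmull.
  have [//|nc] := hno n.
  have := words_card_mul n_gt0 nc; rewrite -(ler_nat R) natrM natrX => hc.
  rewrite mulSn exprD mulrA.
  apply: (@le_trans _ _ (#|words w n|%:R ^+ m n * t ^+ (r * (m n * n)))).
    rewrite ler_wpM2r ?exprn_ge0 //; apply: le_trans hc.
    by rewrite ler_wpM2l.
  have -> : (r * (m n * n) = r * n * m n)%N by rewrite mulnAC mulnA mulnAC.
  rewrite exprM -exprMn [(m n * n)%N]mulnC [#|A|%:R ^+ _]exprM lerXn2r // nnegrE ?mulr_ge0 ?exprn_ge0 //.
have [r hr] := expr_gt (#|A|%:R) t1.
have [n nn] := claim r.
apply/negP; rewrite -ltNge.
have n_gt0 := leq_trans n00 nn.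
apply: (@lt_le_trans _ _ (t ^+ (r * n))).
  by rewrite exprM ltrXn2r // ?nnegrE ?exprn_ge0 // -lt0n.
rewrite ler_peMl ?exprn_ge0 // ler1n words_card_gt0 //.
Qed.

(** A crude Stirling bound: for [m = k + k] and [k >= t ^+ (2 * n)] it makes m! at least
    [t ^+ (m * n)], as [closed_walk_exists] asks. *)
Lemma factorial_lower k : (k ^ k <= (k + k)`!)%N.
Proof.
have h n : (k`! * k ^ n <= (k + n)`!)%N.
  elim: n => [|n IH]; first by rewrite expn0 muln1 addn0.
  rewrite addnS factS expnS mulnCA leq_mul // (leq_trans (leq_addr n k)) //.
by apply: leq_trans (h k); rewrite leq_pmull // fact_gt0.
Qed.

End Rate.

(** * Periodic orbits with a large gap *)

Section GoodOrbit.
Variable R : realType.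
Variables (H F : R -> R) (h b kap B : R).
Hypothesis aF : adapted H F h b kap B.
Let k1 : 1 < kap := adapted_kap aF.
Let lF : is_lift F := adapted_lift aF.
Let C := b / (kap - 1).
Let C0 : 0 <= C := adapted_const_ge0 aF.
Let B0 : 0 <= B := lipschitz1_ge0 (adapted_lip aF).
Let kap0 : 0 < kap := lt_trans ltr01 k1.

(** The lifts cannot drift to different integer translates, because one step takes them at most
    [B * d <= 1 / 2] apart. *)
Lemma lifts_follow d n y y' : B * d <= 1 / 2 -> `|y - y'| <= 1 / 2 ->
  (forall k, (k < n)%N -> cdist (iter k F y) (iter k F y') <= d) ->
  forall k, (k < n)%N -> `|iter k F y - iter k F y'| = cdist (iter k F y) (iter k F y').
Proof.
move=> Bd yy hd; elim=> [|k IH] kn; first by rewrite /= cdist_small.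
rewrite cdist_small //=.
apply: le_trans (adapted_lip aF _ _) _; apply: le_trans Bd.
by rewrite ler_wpM2l // IH ?hd // ltnW.
Qed.

(** After time [i] the orbits still run together for [n.-1 - i] steps, and expansion read backwards
    contracts their distance at time [i]. *)
Lemma follow_contract d n y y' i : B * d <= 1 / 2 ->
  (forall k, (k < n)%N -> cdist (iter k F y) (iter k F y') <= d) ->
  (i < n)%N -> kap ^+ (n.-1 - i) * cdist (iter i F y) (iter i F y') <= b * d.
Proof.
move=> Bd hd iN; have [m hm] := cdist_attained y y'.
pose y2 := y' + m%:~R.
have e2 k : cdist (iter k F y) (iter k F y') = cdist (iter k F y) (iter k F y2).
  rewrite ![cdist (iter k F y) _]cdistC; apply/cdist_eq0_trans/iter_cdist0 => //.
  by rewrite cdist_addzr cdistxx.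
have hd2 k : (k < n)%N -> cdist (iter k F y) (iter k F y2) <= d by rewrite -e2; apply: hd.
have fol := lifts_follow Bd _ hd2.
have y12 : `|y - y2| <= 1 / 2 by rewrite /y2 opprD addrA hm cdist_le_half.
have nn : (n.-1 < n)%N by rewrite ltn_predL; case: (n) iN.
rewrite e2 -fol //.
apply: le_trans (iter_contract aF _ _ _ _) _.
rewrite ler_wpM2l ?(le_trans ler01 (adapted_b1 aF)) // subnK; last by rewrite -ltnS prednK //; case: (n) iN.
by rewrite fol // hd2.
Qed.

Lemma periodic_window (e : nat -> R) p s l : (forall k, 0 <= e k) ->
  (forall k, e (k + p)%N = e k) -> (l <= p)%N ->
  \sum_(k < l) e (s + k)%N <= \sum_(k < p) e k.
Proof.
move=> e0 ep lp.
have -> : \sum_(k < p) e k = \sum_(k < p) e (s + k)%N.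
  elim: s => // s ->; case: p ep {lp} => [|p] ep; first by rewrite !big_ord0.
  rewrite [LHS]big_ord_recl [RHS]big_ord_recr /= addn0 [RHS]addrC; congr (_ + _).
    by rewrite addSnnS ep.
  by apply: eq_bigr => k _; rewrite /bump /= add1n addnS.
rewrite -!(big_mkord xpredT (fun k => e (s + k)%N)) [X in _ <= X](@big_cat_nat _ _ _ l) //=.
by rewrite lerDl sumr_ge0.
Qed.

(* If two points of the shadowing periodic orbit are too close, the pseudo-orbit
   splits there into two; keeping the shorter one multiplies the error by at most
   [2 ^+ a] and at least halves the period, so [E * p ^+ a] does not increase. *)
Lemma pseudo_orbit_split (K : R -> Prop) (Q : R) a : 0 <= Q -> 1 + C + Q <= 2 ^+ a ->
  forall p (x : nat -> R) (E : R), (0 < p)%N -> x p = x 0%N -> (forall i, K (x i)) -> 0 < E ->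
  \sum_(i < p) cdist (F (x i)) (x i.+1) <= E ->
  exists p' (x' : nat -> R) (E' z : R), [/\ (0 < p')%N, forall i, K (x' i), 0 < E',
    E' * p'%:R ^+ a <= E * p%:R ^+ a &
    [/\ cdist (iter p' F z) z = 0, \sum_(i < p') cdist (iter i F z) (x' i) <= C * E' &
      forall i j, (i < j)%N -> (j < p')%N -> Q * E' <= cdist (iter i F z) (iter j F z)]].
Proof.
move=> Q0 hQ p; elim/ltn_ind: p => p IH x E p0 xp xK E0 xE.
have [|z [hz hs]] := shadowing aF p0 (x := x); first by rewrite xp cdistxx.
have hD : \sum_(i < p) cdist (iter i F z) (x i) <= C * E.
  by rewrite (le_trans hs) // ler_wpM2l.
have [gap|] := pselect (forall i j, (i < j)%N -> (j < p)%N ->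
    Q * E <= cdist (iter i F z) (iter j F z)).
  by exists p, x, E, z.
move=> /existsNP[i /existsNP[j /not_implyP[ij /not_implyP[jp /negP]]]].
rewrite -ltNge => hij.
pose y k := x (k %% p)%N.
have yp k : y (k + p)%N = y k by rewrite /y modnDr.
have yx k : (k < p)%N -> y k = x k by move=> kp; rewrite /y modn_small.
have yxS k : (k < p)%N -> y k.+1 = x k.+1.
  rewrite leq_eqVlt => /predU1P[->|]; last exact: yx.
  by rewrite /y modnn xp.
(* The two shadowing distances are different terms of one sum, so together they cost only [C * E];
   the failed gap adds [Q * E]. *)
have xij : cdist (x i) (x j) <= (C + Q) * E.
  have ip := ltn_trans ij jp.
  have : cdist (iter i F z) (x i) + cdist (iter j F z) (x j) <= C * E.
    apply: le_trans hD; rewrite (bigD1 (Ordinal ip)) //= lerD2l.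
    rewrite (bigD1 (Ordinal jp)) /=; last by rewrite -val_eqE /= gtn_eqF.
    by rewrite lerDl sumr_ge0 // => k _; exact: cdist_ge0.
  have := cdist_triangle (iter i F z) (x i) (x j).
  have := cdist_triangle (iter j F z) (iter i F z) (x j).
  rewrite (cdistC (x i) (iter i F z)) mulrDl; lra.
pose e k := cdist (F (y k)) (y k.+1).
have e_per k : e (k + p)%N = e k by rewrite /e yp -addSn yp.
have eE : \sum_(k < p) e k <= E.
  by apply: le_trans xE; apply: ler_sum => k _; rewrite /e yx ?yxS.
(* A window closed up by a jump of this size has error at most [(1 + C + Q) * E <= 2 ^+ a * E], and
   [l + l <= p] pays the factor [2 ^+ a] back. *)
have window s l : (0 < l)%N -> (l + l <= p)%N -> cdist (y (s + l)%N) (y s) <= (C + Q) * E ->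
  exists p' (x' : nat -> R) (E' z : R), [/\ (0 < p')%N, forall i, K (x' i), 0 < E',
    E' * p'%:R ^+ a <= E * p%:R ^+ a &
    [/\ cdist (iter p' F z) z = 0, \sum_(i < p') cdist (iter i F z) (x' i) <= C * E' &
      forall i j, (i < j)%N -> (j < p')%N -> Q * E' <= cdist (iter i F z) (iter j F z)]].
  move=> l0 llp hl.
  have lp : (l < p)%N by rewrite (leq_trans _ llp) // -[X in (X < _)%N]addn0 ltn_add2l.
  pose x' k := if k == l then y s else y (s + k)%N.
  have E'0 : 0 < (1 + C + Q) * E by rewrite mulr_gt0 // -addrA ltr_pwDl // addr_ge0.
  have [|||p' [x2 [E' [z' [? ? ? hE' ?]]]]] := IH l lp x' ((1 + C + Q) * E) l0 _ _ E'0.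
  - by rewrite /x' eqxx eq_sym gtn_eqF // addn0.
  - by move=> k; rewrite /x'; case: ifP => _; exact: xK.
  - case: l l0 llp lp hl @x' => // l _ llp lp hl x'.
    apply: (@le_trans _ _ (\sum_(k < l.+1) e (s + k)%N + (C + Q) * E)).
      rewrite !big_ord_recr /= -addrA lerD //.
        rewrite le_eqVlt; apply/orP; left; apply/eqP; apply: eq_bigr => k _.
        by rewrite /x' /e !ltn_eqF ?addnS // ?ltnS ?(ltnW (ltn_ord k)) // ltn_ord.
      rewrite /x' /e eqxx ltn_eqF // -addnS.
      by apply: le_trans (cdist_triangle (y (s + l.+1)%N) _ _) _; rewrite lerD2l.
    rewrite -[1 + C + Q]addrA (mulrDl 1) mul1r lerD2r; apply: le_trans eE.
    apply: periodic_window => //; last exact: ltnW.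
    by move=> k; exact: cdist_ge0.
  exists p', x2, E', z'; split => //; apply: le_trans hE' _.
  apply: (@le_trans _ _ (2 ^+ a * E * l%:R ^+ a)).
    by rewrite ler_wpM2r ?exprn_ge0 // ler_wpM2r // ltW.
  rewrite mulrAC mulrC ler_wpM2l ?(ltW E0) // -exprMn lerXn2r ?nnegrE //.
  by rewrite -natrM ler_nat mul2n -addnn.
(* The arc from [i] to [j] and the one from [j] to [i + p] have total length [p]; one of them has at
   most half of it. *)
have ji : (0 < j - i)%N by rewrite subn_gt0.
have [hl|hl] := leqP (j - i + (j - i)) p.
  apply: (window i (j - i)%N) => //; rewrite subnKC ?(ltnW ij) //.
  by rewrite !yx // ?(ltn_trans ij) // cdistC.
have ijp : (i + p = j + (p - (j - i)))%N by move: ij jp; clear; lia.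
apply: (window j (p - (j - i))%N); [by move: ij jp; clear; lia|by move: hl ij jp; clear; lia|].
by rewrite -ijp yp !yx // (ltn_trans ij).
Qed.

Definition cell J (y : R) : 'I_J.+1 := inord (Num.Def.truncn (J%:R * frac y)).

Lemma cell_eq J y y' : (0 < J)%N -> cell J y = cell J y' -> cdist y y' <= J%:R^-1.
Proof.
move=> J0 e; have J0' : (0 : R) < J%:R by rewrite ltr0n.
have tJ (t : R) : (Num.Def.truncn (J%:R * frac t) < J.+1)%N.
  rewrite ltnS -(ler_nat R); apply: (@le_trans _ _ (J%:R * frac t)).
    by rewrite truncn_le // mulr_ge0 // frac_ge0.
  by rewrite ler_piMr // ltW // frac_lt1.
have := congr1 (@nat_of_ord _) e; rewrite !inordK // => e2.
have ht (t : R) : (Num.Def.truncn (J%:R * frac t))%:R <= J%:R * frac t <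
    (Num.Def.truncn (J%:R * frac t))%:R + 1.
  by rewrite natr1 truncn_itv // mulr_ge0 // frac_ge0.
have [n hn] := frac_int y; have [n' hn'] := frac_int y'.
apply: le_trans (cdist_le_dist_int y y' (n - n')) _.
rewrite intrB (_ : y - y' - _ = frac y - frac y'); last by rewrite hn hn'; ring.
rewrite -(ler_pM2l J0') -{1}(gtr0_norm J0') -normrM mulrBr divff ?gt_eqF //.
by have := ht y; have := ht y'; rewrite e2 ler_norml => /andP[? ?] /andP[? ?]; lra.
Qed.

Lemma root_gt1 (M : nat) : exists2 t : R, 1 < t & t ^+ M <= kap.
Proof.
have lk : 0 < ln kap by rewrite ln_gt0.
exists (expR (ln kap / M.+1%:R)); first by rewrite expR_gt1 divr_gt0.
apply: (@le_trans _ _ (expR (ln kap / M.+1%:R) ^+ M.+1)).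
  by rewrite ler_weXn2l // ltW // expR_gt1 divr_gt0.
by rewrite -expRM_natl mulrC divfK // lnK.
Qed.

(** The orbit is coded by short arcs. A closed walk through its words of length [n] is followed from
    occurrence to occurrence, switching in the middle of each word; two occurrences share the
    letters that remain, so a jump is exponentially small in [n], whereas the period grows at most
    like [t ^+ (3 * n)] with [t] close to 1. *)
Lemma close_returns (x0 : R) (a : nat) (tau : R) : 0 < tau ->
  exists p (x : nat -> R) (E : R), [/\ (0 < p)%N, x p = x 0%N, forall i, exists j, x i = iter j F x0, 0 < E &
    \sum_(i < p) cdist (F (x i)) (x i.+1) <= E /\ E * p%:R ^+ a <= tau].
Proof.
move=> tau0.
have b0 : 0 < b := lt_le_trans ltr01 (adapted_b1 aF).
(* The period is of order at most [t ^+ (3 * n)] and enters with power [a.+1], once for the number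
   of jumps; the last 1 absorbs the constants. The root below is taken of order [M * 2], as only
   half of each word yields contraction. *)
pose M := (a.+1 * 3 + 1)%N.
have [t t1 tM] := root_gt1 (M * 2).
have t0 : 0 < t := lt_trans ltr01 t1.
have tt : 0 < t - 1 by rewrite subr_gt0.
pose J := (Num.Def.truncn (B * 2)).+1.
have J0 : (0 : R) < J%:R by rewrite ltr0n.
have BJ : B * J%:R^-1 <= 1 / 2.
  have : B * 2 < J%:R by exact: truncnS_gt.
  by rewrite ler_pdivrMr // => hB; lra.
(* The walk will have at most [4 * k n] words; the exponent [2 * n] is what makes [k n ^ k n] reach
   [t ^+ ((k n + k n) * n)]. *)
pose k n := (Num.Def.truncn (t ^+ (2 * n))).+1.
have kl n : t ^+ (2 * n) <= (k n)%:R by rewrite ltW // truncnS_gt.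
have ku n : (k n)%:R <= 2 * t ^+ (2 * n).
  have -> : (k n)%:R = (Num.Def.truncn (t ^+ (2 * n)))%:R + 1 :> R by rewrite natr1.
  have : 1 <= t ^+ (2 * n) by rewrite exprn_ege1 // ltW.
  have : (Num.Def.truncn (t ^+ (2 * n)))%:R <= t ^+ (2 * n).
    by rewrite truncn_le // exprn_ge0 // ltW.
  lra.
pose D := b * kap * (8 / (t - 1)) ^+ a.+1.
have D0 : 0 < D by rewrite !mulr_gt0 // exprn_gt0 // divr_gt0.
have [n1 hn1] := expr_gt (D / tau) t1.
pose w i := cell J (iter i F x0).
have [|n nn [s [v [v0 vp vl vs]]]] := @closed_walk_exists R _ w t (fun n => k n + k n)%N n1.+1 t1 isT;
  last first.
  have n0 : (0 < n)%N := leq_ltn_trans (leq0n _) nn.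
  pose q := size v.
  have q0 : (0 < q)%N by rewrite lt0n size_eq0.
  pose V j := nth s (s :: v) j.
  have VI j : exists i, (j < q)%N -> word w n i = V j /\ word w n (i + n) = V j.+1.
    have [jq|_] := ltnP j q; last by exists 0%N.
    by move/(pathP s) : vp => /(_ j jq)/asboolP[i hi]; exists i.
  pose I j := projT1 (cid (VI j)).
  have hI j : (j < q)%N -> word w n (I j) = V j /\ word w n (I j + n) = V j.+1.
    exact: (projT2 (cid (VI j))).
  have Vq : V q = V 0%N by rewrite /V /= nth_last.
  pose hf := n./2.
  pose x j := iter (I (j %/ n %% q) + hf + j %% n)%N F x0.
  pose eta := b * J%:R^-1 / kap ^+ (n.-1 - hf).
  have eta0 : 0 < eta by rewrite /eta !mulr_gt0 ?invr_gt0 ?exprn_gt0.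
  have hfn : (hf < n)%N by rewrite /hf; move: n0; clear; lia.
  have jump i i' : word w n i = word w n i' ->
      cdist (iter (i + hf) F x0) (iter (i' + hf) F x0) <= eta.
    move=> ii'; rewrite ![(_ + hf)%N]addnC !iterD.
    rewrite ler_pdivlMr ?exprn_gt0 // mulrC.
    apply: (follow_contract BJ _ hfn) => j jn; rewrite -!iterD ![(j + _)%N]addnC.
    by apply: cell_eq => //; have := word_eq ii' jn.
  have step j : (j < q * n)%N -> cdist (F (x j)) (x j.+1) <= eta.
    move=> jqn; rewrite /x -iterS -addnS.
    have jq : (j %/ n < q)%N by rewrite ltn_divLR.
    have jn : (j %% n < n)%N by rewrite ltn_mod.
    have jE := divn_eq j n.
    have [jl|jl] := ltnP (j %% n).+1 n.
      have -> : (j.+1 %/ n = j %/ n)%N.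
        by rewrite [in LHS]jE -addnS divnMDl // (divn_small jl) addn0.
      have -> : (j.+1 %% n = (j %% n).+1)%N.
        by rewrite [in LHS]jE -addnS modnMDl (modn_small jl).
      by rewrite cdistxx ltW.
    have jl' : (j %% n).+1 = n by apply/eqP; rewrite eqn_leq jl jn.
    have jS : j.+1 = ((j %/ n).+1 * n)%N by rewrite [in LHS]jE -addnS jl' mulSn addnC.
    rewrite jl' jS mulnK // modnMl addn0 addnAC.
    apply: jump; rewrite modn_small //.
    have [_ ->] := hI _ jq.
    move: jq; rewrite leq_eqVlt => /predU1P[jq|jq].
      by rewrite jq modnn Vq; have [->] := hI 0%N q0.
    by rewrite modn_small //; have [->] := hI _ jq.
  have p0 : (0 < q * n)%N by rewrite muln_gt0 q0.
  exists (q * n)%N, x, ((q * n)%:R * eta); split => //.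
  - by rewrite /x mulnK // modnn modnMl div0n !mod0n.
  - by move=> i; exists (I (i %/ n %% q)%N + hf + i %% n)%N.
  - by rewrite mulr_gt0 // ltr0n.
  split.
    rewrite -[X in X%:R * _]card_ord mulrC mulr_natr -sumr_const.
    by apply: ler_sum => j _; exact: step.
  have pu : (q * n)%:R <= 8 / (t - 1) * t ^+ (3 * n).
    have h1 : q%:R <= 8 * t ^+ (2 * n).
      apply: (@le_trans _ _ (4 * (k n)%:R)); last by have := ku n; lra.
      rewrite -natrM ler_nat; move: vs; rewrite /q; clear; lia.
    have h2 : n%:R <= t ^+ n / (t - 1).
      by rewrite ler_pdivlMr //; have := bernoulli n (ltW t1); lra.
    rewrite natrM (_ : 8 / (t - 1) * t ^+ (3 * n) = (8 * t ^+ (2 * n)) * (t ^+ n / (t - 1))).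
      by apply: ler_pM.
    by rewrite (mulSn 2) exprD; ring.
  have kapn : t ^+ (M * n) <= kap ^+ (n.-1 - hf) * kap.
    rewrite -(@ler_pXn2r _ 2) ?nnegrE ?mulr_ge0 ?exprn_ge0 ?(ltW t0) ?(ltW kap0) //.
    rewrite -exprM mulnAC exprM -exprSr -[(kap ^+ _) ^+ 2]exprM.
    apply: (@le_trans _ _ (kap ^+ n)).
      by rewrite lerXn2r // ?nnegrE ?exprn_ge0 ?(ltW t0) ?(ltW kap0).
    by rewrite ler_weXn2l ?(ltW k1) // /hf; move: n0; clear; lia.
  rewrite mulrAC -exprS.
  apply: (@le_trans _ _ ((8 / (t - 1) * t ^+ (3 * n)) ^+ a.+1 * eta)).
    rewrite ler_wpM2r ?(ltW eta0) // lerXn2r // ?nnegrE //.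
    by rewrite mulr_ge0 ?exprn_ge0 ?divr_ge0 ?(ltW tt) ?(ltW t0).
  have kk : 0 < kap ^+ (n.-1 - hf) by rewrite exprn_gt0.
  rewrite exprMn /eta mulrA ler_pdivrMr //.
  have Dtau : D <= tau * t ^+ n.
    rewrite mulrC -ler_pdivrMr //; apply: ltW; apply: lt_le_trans hn1 _.
    by rewrite ler_weXn2l ?(ltW t1) // ltnW // ltnW.
  have J1 : (J%:R : R)^-1 <= 1 by rewrite invf_le1 // ler1n.
  apply: (@le_trans _ _ ((8 / (t - 1)) ^+ a.+1 * (t ^+ (3 * n)) ^+ a.+1 * b)).
    rewrite ler_wpM2l; last by rewrite ler_piMr // ltW.
      by [].
    by rewrite mulr_ge0 ?exprn_ge0 ?divr_ge0 ?(ltW tt) ?(ltW t0).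
  rewrite -(ler_pM2r kap0).
  have -> : (8 / (t - 1)) ^+ a.+1 * (t ^+ (3 * n)) ^+ a.+1 * b * kap
     = D * (t ^+ (3 * n)) ^+ a.+1 by rewrite /D; ring.
  apply: (@le_trans _ _ (tau * t ^+ n * (t ^+ (3 * n)) ^+ a.+1)).
    by rewrite ler_wpM2r // exprn_ge0 // exprn_ge0 // ltW.
  rewrite -!mulrA ler_wpM2l ?(ltW tau0) //.
  apply: le_trans kapn; rewrite -exprM -exprD le_eqVlt; apply/orP; left; apply/eqP.
  by congr (_ ^+ _); rewrite /M; clear; lia.
move=> m m0; split; first by rewrite addnn double_gt0.
apply: (@le_trans _ _ ((k m)%:R ^+ k m)); last by rewrite -natrX ler_nat factorial_lower.
rewrite (_ : (k m + k m) * m = 2 * m * k m)%N; last by rewrite addnn -mul2n mulnAC.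
by rewrite exprM lerXn2r // ?nnegrE ?exprn_ge0 ?(ltW t0).
Qed.

(** Both the return and its splittings consist of points of the orbit of [x0], where [g] vanishes,
    so the sum of [g] over the shadowing orbit is pure shadowing error. The exponent [a] is fixed by
    [Q] before the return is chosen. *)
Lemma good_orbit (g : R -> R) (l x0 Q tau : R) : clip l g -> 0 <= l -> 0 <= Q -> 0 < tau ->
  (forall i, g (iter i F x0) = 0) ->
  exists p (z E : R), [/\ (0 < p)%N, cdist (iter p F z) z = 0, 0 < E <= tau,
    birkhoff F g p z <= l * C * E &
    forall i j, (i < j)%N -> (j < p)%N -> Q * E <= cdist (iter i F z) (iter j F z)].
Proof.
move=> gl l0 Q0 tau0 g0.
have [a ha] : exists a : nat, 1 + C + Q < 2 ^+ a.
  by apply: expr_gt; rewrite ltr1n.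
have [p [x [E [p0 xp xK E0 [hE Etau]]]]] := close_returns x0 a tau0.
have [p' [x' [E' [z [p'0 x'K E'0 EE [hz hs gap]]]]]] :=
  @pseudo_orbit_split (fun y => exists j, y = iter j F x0) Q a Q0 (ltW ha) p x E p0 xp xK E0 hE.
exists p', z, E'; split => //.
  rewrite E'0 /= (le_trans _ Etau) // (le_trans _ EE) //.
  by rewrite ler_peMr ?(ltW E'0) // exprn_ege1 // ler1n.
rewrite -mulrA; apply: le_trans (ler_wpM2l l0 hs).
rewrite mulr_sumr; apply: ler_sum => i _.
have [j hj] := x'K i.
by have := gl (iter i F z) (x' i); rewrite {1}hj g0 subr0 => /(le_trans (ler_norm _)).
Qed.

End GoodOrbit.

(** * Adapted coordinates *)

Section Derivatives.
Variable R : realType.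
Implicit Types (f g df dg F G H : R -> R).

Definition has_deriv f df := forall x : R, is_derive x (1 : R) f (df x).

Lemma has_derivD f df g dg : has_deriv f df -> has_deriv g dg ->
  has_deriv (fun x => f x + g x) (fun x => df x + dg x).
Proof. by move=> hf hg x; exact: is_deriveD. Qed.

Lemma has_derivB f df g dg : has_deriv f df -> has_deriv g dg ->
  has_deriv (fun x => f x - g x) (fun x => df x - dg x).
Proof. by move=> hf hg x; exact: is_deriveB. Qed.

Lemma has_derivZ c f df : has_deriv f df ->
  has_deriv (fun x => c * f x) (fun x => c * df x).
Proof. by move=> hf x; exact: is_deriveZ. Qed.

Lemma has_deriv_comp f df g dg : has_deriv f df -> has_deriv g dg ->
  has_deriv (fun x => f (g x)) (fun x => df (g x) * dg x).
Proof. by move=> hf hg x; exact: is_derive1_comp. Qed.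

Lemma has_deriv_cst c : has_deriv (fun=> c) (fun=> 0).
Proof. by move=> x; exact: is_derive_cst. Qed.

Lemma has_deriv_id : has_deriv id (fun=> 1).
Proof. by move=> x; exact: is_derive_id. Qed.

Lemma has_deriv_derive1 f df : has_deriv f df -> derive1 f = df.
Proof. by move=> hf; apply/funext => x; rewrite derive1E; have [_ ->] := hf x. Qed.

Lemma has_deriv_continuous f df : has_deriv f df -> continuous f.
Proof.
move=> hf x; have [hd _] := hf x.
exact/differentiable_continuous/derivable1_diffP.
Qed.

Lemma mvt f df x y : has_deriv f df -> exists c, f x - f y = df c * (x - y).
Proof.
move=> hf; wlog xy : x y / y <= x.
  move=> hw; have [|/ltW xy] := leP y x; first exact: hw.
  have [c hc] := hw y x xy; exists c.
  by rewrite -opprB hc -mulrN opprB.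
have [|c _ ->] := MVT_segment xy (fun z _ => hf z); last by exists c.
exact/continuous_subspaceT/has_deriv_continuous.
Qed.

Lemma bounded_deriv_lipschitz f df B : has_deriv f df -> (forall x, `|df x| <= B) ->
  lipschitz1 B f.
Proof.
by move=> hf hB x y; have [c ->] := mvt x y hf; rewrite normrM ler_wpM2r.
Qed.

Lemma has_deriv_periodic f df h : has_deriv f df -> (forall x, f (x + 1) = f x + h) ->
  periodic1 df.
Proof.
move=> hf hper; have e : has_deriv f (fun x => df (x + 1) * (1 + 0)).
  have e1 : f = fun x => f (x + 1) - h by apply/funext => x; rewrite hper addrK.
  rewrite [X in has_deriv X]e1 => x.
  have := has_derivB (has_deriv_comp hf (has_derivD has_deriv_id (has_deriv_cst 1)))
    (has_deriv_cst h) x.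
  by rewrite subr0.
move=> x; have := has_deriv_derive1 e; rewrite (has_deriv_derive1 hf).
by move=> /(congr1 (fun g => g x)) ->; rewrite addr0 mulr1.
Qed.

Lemma lipschitzM (lf lg Mf Mg : R) f g : lipschitz1 lf f -> lipschitz1 lg g ->
  (forall x, `|f x| <= Mf) -> (forall x, `|g x| <= Mg) ->
  lipschitz1 (lf * Mg + Mf * lg) (fun x => f x * g x).
Proof.
move=> hf hg bf bg x y.
have -> : f x * g x - f y * g y = (f x - f y) * g x + f y * (g x - g y) by ring.
apply: le_trans (ler_normD _ _) _; rewrite !normrM mulrDl; apply: lerD.
  by rewrite mulrAC; apply: ler_pM.
by rewrite -mulrA; apply: ler_pM.
Qed.

Lemma lipschitzD (lf lg : R) f g : lipschitz1 lf f -> lipschitz1 lg g ->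
  lipschitz1 (lf + lg) (fun x => f x + g x).
Proof.
move=> hf hg x y; rewrite opprD addrACA mulrDl.
by apply: le_trans (ler_normD _ _) _; exact: lerD.
Qed.

Lemma lipschitz_comp (lf lg : R) f g : 0 <= lf -> lipschitz1 lf f -> lipschitz1 lg g ->
  lipschitz1 (lf * lg) (fun x => f (g x)).
Proof. by move=> l0 hf hg x y; apply: le_trans (hf _ _) _; rewrite -mulrA ler_wpM2l. Qed.

Lemma lipschitz_cst (c : R) : lipschitz1 0 (fun _ : R => c).
Proof. by move=> x y; rewrite subrr normr0 mul0r. Qed.

Lemma iter_lipschitz (B : R) F n : lipschitz1 B F -> lipschitz1 (B ^+ n) (iter n F).
Proof.
move=> hF; elim: n => [|n IH] x y; first by rewrite expr0 mul1r.
rewrite exprS; apply: (@lipschitz_comp B _ F (iter n F)) => //.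
exact: lipschitz1_ge0 hF.
Qed.

Lemma iter_has_deriv F n : has_deriv F (derive1 F) ->
  has_deriv (iter n F) (derive1 (iter n F)).
Proof.
move=> hF; elim: n => [|n IH].
  by rewrite [derive1 _](has_deriv_derive1 has_deriv_id); exact: has_deriv_id.
have h := has_deriv_comp hF IH.
by rewrite [derive1 _](has_deriv_derive1 h).
Qed.

Lemma iter_deriv_lipschitz F (L B : R) n : has_deriv F (derive1 F) ->
  lipschitz1 L (derive1 F) -> (forall x, `|derive1 F x| <= B) ->
  exists l M, lipschitz1 l (derive1 (iter n F)) /\ forall x, `|derive1 (iter n F) x| <= M.
Proof.
move=> hF LF BF; have B_lip := bounded_deriv_lipschitz hF BF.
elim: n => [|n [l [M [IH1 IH2]]]].
  exists 0, 1; rewrite [derive1 _](has_deriv_derive1 has_deriv_id); split.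
    exact: lipschitz_cst.
  by move=> x; rewrite normr1.
rewrite [derive1 (iter n.+1 F)](has_deriv_derive1 (has_deriv_comp hF (iter_has_deriv n hF))).
exists (L * B ^+ n * M + B * l), (B * M); split; last first.
  by move=> x; rewrite normrM ler_pM.
apply: lipschitzM => //; apply: lipschitz_comp => //; last exact: iter_lipschitz.
exact: lipschitz1_ge0 LF.
Qed.

End Derivatives.

(** * Quantitative regularity and the adapted coordinate of a map *)

Section E11Facts.
Variable R : realType.
Implicit Types (F G H : R -> R).

(** Bounds that persist, slightly weakened, under C^{1,1}-small changes; expansion is carried
    separately by [adapted]. *)
Record regular F (L B m : R) : Prop := Regular {
  regular_lift : is_lift F;
  regular_deriv : has_deriv F (derive1 F);
  regular_clip : clip L (derive1 F);
  regular_L0 : 0 <= L;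
  regular_le : forall x, `|derive1 F x| <= B;
  regular_m0 : 0 < m;
  regular_ge : forall x, m <= `|derive1 F x| }.

Lemma E11_regular F : E11 F -> exists L B m, regular F L B m.
Proof.
move=> [lF [[dF _] [[L hL] [C [lam [C0 [l1 hex]]]]]]].
have cl : clip `|L| (derive1 F).
  by move=> x y; apply: le_trans (hL x y) _; rewrite ler_wpM2r ?cdist_ge0 // ler_norm.
exists `|L|, (`|derive1 F 0| + `|L|), (C * lam); split => //.
- by move=> x; have := derivableP (dF x); rewrite derive1E.
- exact: clip_bounded.
- by rewrite mulr_gt0 // (lt_trans ltr01).
- by move=> x; have := hex x 1%N isT; rewrite expr1.
Qed.

Lemma regular_lip F L B m : regular F L B m -> lipschitz1 B F.
Proof. by move=> rF; apply: bounded_deriv_lipschitz (regular_deriv rF) (regular_le rF). Qed.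

Lemma regular_sign F L B m : regular F L B m ->
  exists s : R, `|s| = 1 /\ forall x, 0 < s * derive1 F x.
Proof.
move=> rF; pose s := Num.sg (derive1 F 0).
have nz x : derive1 F x != 0.
  by rewrite -normr_gt0 (lt_le_trans (regular_m0 rF)) // (regular_ge rF).
have s1 : `|s| = 1 by rewrite normr_sg nz.
exists s; split => // x; rewrite ltNge; apply/negP => hx.
have h0 : 0 < s * derive1 F 0 by rewrite /s -normrEsg normr_gt0.
have cF : continuous (fun y => s * derive1 F y).
  move=> y; apply: cvgM; first exact: cvg_cst.
  exact: lipschitz_continuous (clip_lipschitz (regular_L0 rF) (regular_clip rF)) _.
have [c hc] : exists c, s * derive1 F c = 0.
  have h a b : a <= b -> (s * derive1 F a <= 0 <= s * derive1 F b) \/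
      (s * derive1 F b <= 0 <= s * derive1 F a) -> exists c, s * derive1 F c = 0.
    move=> ab hh; have [||c _ hc] := @IVT R (fun y => s * derive1 F y) a b 0 ab.
    - exact: continuous_subspaceT.
    - rewrite ge_min le_max.
      by case: hh => /andP[-> ->]; rewrite ?orbT.
    - by exists c.
  have [x0|x0] := leP x 0; first by apply: (h _ _ x0); left; rewrite hx ltW.
  by apply: (h _ _ (ltW x0)); right; rewrite hx ltW.
have : `|s * derive1 F c| = 0 by rewrite hc normr0.
by rewrite normrM s1 mul1r => /eqP; rewrite normr_eq0 (negPf (nz c)).
Qed.

Lemma lift_iter F n : is_lift F -> is_lift (iter n F).
Proof.
move=> lF; elim: n => [|n [k hk]]; first by exists 1 => x.
have /cdist_eq0[j hj] : cdist (F (0 + 1)) (F 0) = 0.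
  by apply: lift_cdist0 => //; apply/cdist_eq0; exists 1.
case: lF => d hd.
have hz (m : int) x : F (x + m%:~R) = F x + (m * d)%:~R.
  have hn (i : nat) y : F (y + i%:R) = F y + (i%:Z * d)%:~R.
    elim: i => [|i IH]; first by rewrite mul0r !addr0.
    by rewrite -natr1 addrA hd IH -addrA -intrD -[in RHS]addn1 PoszD mulrDl mul1r.
  case: m => i; first by rewrite -pmulrn hn.
  rewrite NegzE intrN -pmulrn mulNr intrN.
  by apply/eqP; rewrite -subr_eq opprK -hn subrK.
by exists (k * d) => x; rewrite !iterS hk hz.
Qed.

Section Coordinate.
Variables (F : R -> R) (L B m : R) (C lam : R).
Hypothesis rF : regular F L B m.
Hypothesis C0 : 0 < C.
Hypothesis lam1 : 1 < lam.
Hypothesis hex : forall x (n : nat), (0 < n)%N -> C * lam ^+ n <= `|derive1 (iter n F) x|.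

(** For [r = s / kap], with [s] the sign of the derivative, all summands are increasing, so absolute
    values add up and distances between values of [coord] are the usual adapted metric; this is
    [coord_dist]. *)
Definition coord (r : R) N x := \sum_(i < N) r ^+ i * iter i F x.

Definition dcoord (r : R) N x := \sum_(i < N) r ^+ i * derive1 (iter i F) x.

Lemma coord_has_deriv r N : has_deriv (coord r N) (dcoord r N).
Proof.
elim: N => [|N IH].
  rewrite (_ : coord r 0 = fun=> 0); last by apply/funext => x; rewrite /coord big_ord0.
  rewrite (_ : dcoord r 0 = fun=> 0); last by apply/funext => x; rewrite /dcoord big_ord0.
  exact: has_deriv_cst.
rewrite (_ : coord r N.+1 = fun x => coord r N x + r ^+ N * iter N F x); last first.
  by apply/funext => x; rewrite /coord big_ord_recr.
rewrite (_ : dcoord r N.+1 = fun x => dcoord r N x + r ^+ N * derive1 (iter N F) x); last first.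
  by apply/funext => x; rewrite /dcoord big_ord_recr.
apply: has_derivD => //; apply: has_derivZ.
exact: iter_has_deriv (regular_deriv rF).
Qed.

Lemma dcoord_lipschitz r N : exists l, lipschitz1 l (dcoord r N).
Proof.
elim: N => [|N [l IH]].
  exists 0; rewrite (_ : dcoord r 0 = fun=> 0); last by apply/funext => x; rewrite /dcoord big_ord0.
  exact: lipschitz_cst.
have [l' [M [h1 h2]]] := iter_deriv_lipschitz N (regular_deriv rF)
  (clip_lipschitz (regular_L0 rF) (regular_clip rF)) (regular_le rF).
exists (l + (0 * M + `|r ^+ N| * l')).
rewrite (_ : dcoord r N.+1 = fun x => dcoord r N x + r ^+ N * derive1 (iter N F) x); last first.
  by apply/funext => x; rewrite /dcoord big_ord_recr.
by apply: lipschitzD => //; apply: lipschitzM => //; exact: lipschitz_cst.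
Qed.

Lemma coord_shift r N : exists h, forall x, coord r N (x + 1) = coord r N x + h.
Proof.
elim: N => [|N [h IH]]; first by exists 0 => x; rewrite /coord !big_ord0 addr0.
have [k hk] := lift_iter N (regular_lift rF).
exists (h + r ^+ N * k%:~R) => x.
by rewrite /coord !big_ord_recr /= -!/(coord _ _ _) IH hk; ring.
Qed.

Lemma coord_dist s kap N x y : `|s| = 1 -> (forall z, 0 < s * derive1 F z) -> 0 < kap ->
  `|coord (s / kap) N x - coord (s / kap) N y| =
  \sum_(i < N) kap^-1 ^+ i * `|iter i F x - iter i F y|.
Proof.
move=> s1 hs kap0; wlog xy : x y / y <= x.
  move=> hw; have [|/ltW xy] := leP y x; first exact: hw.
  by rewrite distrC hw //; apply: eq_bigr => i _; rewrite distrC.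
have pos i : 0 <= s ^+ i * (iter i F x - iter i F y).
  elim: i => [|i IH]; first by rewrite mul1r subr_ge0.
  have [c hc] := mvt (iter i F x) (iter i F y) (regular_deriv rF).
  rewrite !iterS hc exprS mulrACA mulr_ge0 // ltW //.
rewrite /coord -sumrB (eq_bigr (fun i : 'I_N => kap^-1 ^+ i * `|iter i F x - iter i F y|)).
  by rewrite ger0_norm // sumr_ge0 // => i _; rewrite mulr_ge0 // exprn_ge0 // invr_ge0 ltW.
move=> i _; rewrite -mulrBr exprMn mulrAC mulrC; congr (_ * _).
by rewrite -(ger0_norm (pos i)) normrM normrX s1 expr1n mul1r.
Qed.

(** Applying [F] shifts the terms of the adapted metric and multiplies them by [kap]. Only the first
    term is lost and a new last one gained; [N] is taken so large that [iter N F] expands by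
    [kap ^+ N], which makes the gain at least the loss. *)
Lemma adapted_exists : exists (H dH : R -> R) (h b kap l : R),
  [/\ adapted H F h b kap B, has_deriv H dH, 0 <= l & clip l dH].
Proof.
have [s [s1 hs]] := regular_sign rF.
pose kap := (1 + lam) / 2.
have l1 : 1 < lam := lam1.
have kap1 : 1 < kap by rewrite /kap; lra.
have kap0 : 0 < kap := lt_trans ltr01 kap1.
have lk : 1 < lam / kap by rewrite ltr_pdivlMr // mul1r /kap; lra.
have [N0 hN0] := expr_gt (C^-1) lk.
pose N := N0.+1.
have hN x y : kap ^+ N * `|x - y| <= `|iter N F x - iter N F y|.
  have [c ->] := mvt x y (iter_has_deriv N (regular_deriv rF)).
  rewrite normrM ler_wpM2r //; apply: le_trans (hex c _); last by [].
  have : C^-1 <= (lam / kap) ^+ N.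
    by rewrite (le_trans (ltW hN0)) // ler_weXn2l // ltW.
  rewrite expr_div_n ler_pdivlMr ?exprn_gt0 // => h.
  by move: h; rewrite mulrC ler_pdivrMr // mulrC.
pose r := s / kap.
have [l hl] := dcoord_lipschitz r N.
have [h hh] := coord_shift r N.
have ki0 i : 0 <= kap^-1 ^+ i by rewrite exprn_ge0 // invr_ge0 ltW.
exists (coord r N), (dcoord r N), h, (\sum_(i < N) kap^-1 ^+ i * B ^+ i), kap, l; split.
- split=> //.
  + exact: regular_lift rF.
  + exact: regular_lip rF.
  + move=> x y; rewrite coord_dist // big_ord_recl /= mul1r lerDl sumr_ge0 // => i _.
    by rewrite mulr_ge0.
  + move=> x y; rewrite coord_dist // mulr_suml; apply: ler_sum => i _.
    by rewrite -mulrA ler_wpM2l // iter_lipschitz //; exact: regular_lip rF.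
  + move=> x y; rewrite !coord_dist // mulr_sumr.
    pose a i := kap^-1 ^+ i * `|iter i F x - iter i F y|.
    rewrite (eq_bigr (fun i : 'I_N => kap * a i)) // [leRHS](eq_bigr (fun i : 'I_N => kap * a i.+1)); last first.
      move=> i _; rewrite /a -!iterSr exprS !mulrA divff ?mul1r //.
      by rewrite gt_eqF.
    rewrite -!mulr_sumr ler_wpM2l ?(ltW kap0) //.
    have := big_ord_recl N (fun i : 'I_N.+1 => a i) (idx := 0) (op := +%R).
    rewrite big_ord_recr /= => e.
    have aN : a 0%N <= a N.
      by rewrite /a expr0 mul1r exprVn mulrC ler_pdivlMr ?exprn_gt0 // mulrC.
    have e2 : \sum_(i < N) a (bump 0 i) = \sum_(i < N) a i.+1 by apply: eq_bigr.
    by move: e; rewrite e2; lra.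
- exact: coord_has_deriv.
- exact: lipschitz1_ge0 hl.
- apply: lipschitz_clip => //; apply: has_deriv_periodic hh; exact: coord_has_deriv.
Qed.

End Coordinate.

(** The derivative of [H \o G - H \o F] is at most [(kap - 1) / 2], half of the surplus expansion.
    One coordinate thus serves all nearby maps, with constants independent of the map. *)
Lemma adapted_near H F dH h b kap B l L m : adapted H F h b kap B -> has_deriv H dH ->
  0 <= l -> clip l dH -> regular F L B m ->
  exists e : R, 0 < e /\ forall G L' B' m', regular G L' B' m' ->
    (forall x, cdist (G x) (F x) <= e) -> (forall x, `|derive1 G x - derive1 F x| <= e) ->
    adapted H G h b ((1 + kap) / 2) (B + 1).
Proof.
move=> aF hH l0 cH rF.
have B0 := lipschitz1_ge0 (adapted_lip aF).
pose M := `|dH 0| + l.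
have M0 : 0 <= M by rewrite addr_ge0.
have hM : forall x, `|dH x| <= M := clip_bounded cH l0.
have k1 := adapted_kap aF.
pose D := 2 * (l * (B + 1) + M + 1).
have D0 : 0 < D.
  by rewrite mulr_gt0 // ltr_wpDl // addr_ge0 // mulr_ge0 // addr_ge0.
pose e := Num.min 1 ((kap - 1) / D).
have e0 : 0 < e by rewrite lt_min ltr01 divr_gt0 // subr_gt0.
have e1 : e <= 1 by rewrite ge_min lexx.
have eD : e * (l * (B + 1) + M) <= (kap - 1) / 2.
  have : e * D <= kap - 1 by rewrite -ler_pdivlMr // ge_min lexx orbT.
  rewrite /D; move: (ltW e0); lra.
exists e; split => // G L' B' m' rG GF dGF.
have hG := regular_deriv rG.
have dGB x : `|derive1 G x| <= B + 1.
  have h1 := dGF x; have h2 := regular_le rF x.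
  have := ler_normD (derive1 G x - derive1 F x) (derive1 F x); rewrite subrK; lra.
split=> //.
- by lra.
- exact: regular_lift rG.
- exact: bounded_deriv_lipschitz hG dGB.
- exact: adapted_shift aF.
- exact: adapted_ge aF.
- exact: adapted_le aF.
move=> x y.
have hd := has_derivB (has_deriv_comp hH hG) (has_deriv_comp hH (regular_deriv rF)).
have tau : lipschitz1 ((kap - 1) / 2) (fun z => H (G z) - H (F z)).
  apply: bounded_deriv_lipschitz hd _ => z /=.
  have -> : dH (G z) * derive1 G z - dH (F z) * derive1 F z =
    (dH (G z) - dH (F z)) * derive1 G z + dH (F z) * (derive1 G z - derive1 F z) by ring.
  apply: le_trans (ler_normD _ _) _; rewrite !normrM; apply: le_trans eD.
  rewrite mulrDr; apply: lerD.
    rewrite mulrA; apply: ler_pM => //.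
    by apply: le_trans (cH _ _) _; rewrite mulrC ler_wpM2r.
  by rewrite mulrC; apply: ler_pM.
have h1 := tau x y; have h2 := adapted_expand aF x y; have h3 := adapted_ge aF x y.
have h4 : (kap - 1) / 2 * `|x - y| <= (kap - 1) / 2 * `|H x - H y|.
  by rewrite ler_wpM2l // divr_ge0 // subr_ge0 ltW.
have := ler_normD (H (F x) - H (F y) + (H (G x) - H (F x) - (H (G y) - H (F y))))
   (- (H (G x) - H (F x) - (H (G y) - H (F y)))).
rewrite normrN addrK.
have -> : H (F x) - H (F y) + (H (G x) - H (F x) - (H (G y) - H (F y))) = H (G x) - H (G y).
  by ring.
lra.
Qed.

End E11Facts.

(** * The C^{1,1} distance *)

Section C11Distance.
Variable R : realType.
Implicit Types (F G S T : R -> R).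

Lemma sup_bounds (I : Type) (A : set I) (f : I -> R) (M : R) : A !=set0 ->
  (forall i, A i -> f i <= M) -> sup [set f i | i in A] <= M /\
  forall i, A i -> f i <= sup [set f i | i in A].
Proof.
move=> [i0 Ai0] hM; have ub : ubound [set f i | i in A] M by move=> _ [i Ai <-]; exact: hM.
split; first by apply: ge_sup => //; exists (f i0), i0.
by move=> i Ai; apply: ub_le_sup; [exists M|exists i].
Qed.

(** The [sup] of an unbounded set is a default value, so the regularity of both maps is what makes
    the three suprema genuine bounds. The last clause serves to bound [dC11] from above. *)
Lemma dC11_parts S T L B m L' B' m' : regular S L B m -> regular T L' B' m' ->
  exists a b c, [/\ dC11 S T = a + b + c, forall x, cdist (S x) (T x) <= a,
    forall x, `|derive1 S x - derive1 T x| <= b,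
    forall x y, `|(derive1 S x - derive1 T x) - (derive1 S y - derive1 T y)| <= c * cdist x y &
    forall a' b' c', (forall x, cdist (S x) (T x) <= a') ->
      (forall x, `|derive1 S x - derive1 T x| <= b') ->
      (forall x y, `|(derive1 S x - derive1 T x) - (derive1 S y - derive1 T y)|
         <= c' * cdist x y) -> dC11 S T <= a' + b' + c'].
Proof.
move=> rS rT.
have A1 : [set: R] !=set0 by exists 0.
pose A2 := [set xy : R * R | cdist xy.1 xy.2 != 0].
have A20 : A2 !=set0.
  exists (0, 1 / 2); rewrite /A2 /= cdist_small sub0r normrN gtr0_norm //; lra.
pose q := fun xy : R * R => `|(derive1 S xy.1 - derive1 T xy.1)
   - (derive1 S xy.2 - derive1 T xy.2)| / cdist xy.1 xy.2.
have [a1 a2] := sup_bounds A1 (fun x _ => cdist_le_half (S x) (T x)).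
have [|b1 b2] := @sup_bounds _ _ (fun x => `|derive1 S x - derive1 T x|) (B + B') A1.
  move=> x _; apply: le_trans (ler_normB _ _) _.
  exact: (lerD (regular_le rS x) (regular_le rT x)).
have [|c1 c2] := @sup_bounds _ A2 q (L + L') A20.
  move=> [x y]; rewrite /A2 /q /= => xy.
  rewrite ler_pdivrMr; last by rewrite lt_def xy cdist_ge0.
  rewrite opprD addrACA -[X in _ + X]opprD; apply: le_trans (ler_normB _ _) _.
  rewrite mulrDl; exact: (lerD (regular_clip rS x y) (regular_clip rT x y)).
exists (sup [set cdist (S x) (T x) | x in [set: R]]),
  (sup [set `|derive1 S x - derive1 T x| | x in [set: R]]), (sup [set q xy | xy in A2]).
split; first by [].
- by move=> x; exact: a2.
- by move=> x; exact: b2.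
- move=> x y; have [xy|xy] := eqVneq (cdist x y) 0.
    rewrite (clip_eq (regular_clip rS) xy) (clip_eq (regular_clip rT) xy).
    by rewrite subrr normr0 xy mulr0.
  rewrite -ler_pdivrMr; first exact: (c2 (x, y)).
  by rewrite lt_def xy cdist_ge0.
move=> a' b' c' ha hb hc; rewrite /dC11.
have [h1 _] := sup_bounds A1 (fun x _ => ha x).
have [h2 _] := sup_bounds A1 (fun x _ => hb x).
have [|h3 _] := @sup_bounds _ A2 q c' A20.
  move=> [x y]; rewrite /A2 /q /= => xy; rewrite ler_pdivrMr //.
  by rewrite lt_def xy cdist_ge0.
by rewrite !lerD.
Qed.

Lemma dC11_triangle S T U : E11 S -> E11 T -> E11 U -> dC11 S U <= dC11 S T + dC11 T U.
Proof.
move=> /E11_regular[? [? [? rS]]] /E11_regular[? [? [? rT]]] /E11_regular[? [? [? rU]]].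
have [a [b [c [-> a1 b1 c1 _]]]] := dC11_parts rS rT.
have [a' [b' [c' [-> a2 b2 c2 _]]]] := dC11_parts rT rU.
have [_ [_ [_ [_ _ _ _ h]]]] := dC11_parts rS rU.
apply: le_trans (h (a + a') (b + b') (c + c') _ _ _) _; last lra.
- by move=> x; apply: le_trans (cdist_triangle (T x) _ _) _; rewrite lerD.
- move=> x; have -> : derive1 S x - derive1 U x =
    (derive1 S x - derive1 T x) + (derive1 T x - derive1 U x) by ring.
  by apply: le_trans (ler_normD _ _) _; rewrite lerD.
- move=> x y; rewrite mulrDl.
  have -> : derive1 S x - derive1 U x - (derive1 S y - derive1 U y) =
    (derive1 S x - derive1 T x - (derive1 S y - derive1 T y)) +
    (derive1 T x - derive1 U x - (derive1 T y - derive1 U y)) by ring.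
  by apply: le_trans (ler_normD _ _) _; rewrite lerD.
Qed.

Lemma dC11_ge S T L B m L' B' m' : regular S L B m -> regular T L' B' m' ->
  [/\ forall x, cdist (S x) (T x) <= dC11 S T,
    forall x, `|derive1 S x - derive1 T x| <= dC11 S T &
    clip (dC11 S T) (fun x => derive1 S x - derive1 T x)].
Proof.
move=> rS rT; have [a [b [c [-> ha hb hc _]]]] := dC11_parts rS rT.
have a0 : 0 <= a := le_trans (cdist_ge0 _ _) (ha 0).
have b0 : 0 <= b := le_trans (normr_ge0 _) (hb 0).
have c0 : 0 <= c.
  have := le_trans (normr_ge0 _) (hc 0 (1 / 2)).
  rewrite cdist_small sub0r normrN ger0_norm ?pmulr_lge0 //; lra.
split.
- by move=> x; have := ha x; lra.
- by move=> x; have := hb x; lra.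
move=> x y; apply: le_trans (hc x y) _; rewrite ler_wpM2r ?cdist_ge0 //; lra.
Qed.

Lemma dC11_refl F : E11 F -> dC11 F F <= 0.
Proof.
move=> /E11_regular[? [? [? rF]]].
have [_ [_ [_ [_ _ _ _ h]]]] := dC11_parts rF rF.
apply: le_trans (h 0 0 0 _ _ _) _; rewrite ?addr0 //.
- by move=> x; rewrite cdistxx.
- by move=> x; rewrite subrr normr0.
- by move=> x y; rewrite !subrr normr0 mul0r.
Qed.

Lemma deriv_ge_of_expansive (g dg : R -> R) (c : R) : has_deriv g dg ->
  (forall x y, c * `|x - y| <= `|g x - g y|) -> forall x, c <= `|dg x|.
Proof.
move=> hg hc x; rewrite leNgt; apply/negP => lt.
have [hd he] := hg x.
have hl : h^-1 *: ((g \o shift x) (h *: 1) - g x) @[h --> 0^'] --> dg x.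
  by rewrite -he; exact: hd.
have /cvgrPdist_lt/(_ (c - `|dg x|)) := hl; rewrite subr_gt0 => /(_ lt) hn.
suff : \forall h \near (0 : R)^', False by move=> /filter_ex[].
near=> h.
have h0 : h != 0 by near: h; exact: nbhs_dnbhs_neq.
have : `|dg x - h^-1 *: ((g \o shift x) (h *: 1) - g x)| < c - `|dg x| by near: h.
rewrite /= /GRing.scale /= mulr1.
have := hc (h + x) x; rewrite addrK => h1 h2.
have h3 : c <= `|h^-1 * (g (h + x) - g x)|.
  by rewrite normrM normfV mulrC ler_pdivlMr ?normr_gt0.
have := ler_normD (h^-1 * (g (h + x) - g x) - dg x) (dg x); rewrite subrK.
by rewrite distrC in h2; lra.
Unshelve. all: by end_near. Qed.

(** Expansion in the coordinate [H] returns to the line at the cost of the factor [b], once for all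
    iterates. *)
Lemma adapted_E11 H G L B m h b kap B' : regular G L B m -> adapted H G h b kap B' -> E11 G.
Proof.
move=> rG aG; split; first exact: regular_lift rG.
split; [split|split].
- by move=> x; have [] := regular_deriv rG x.
- exact: lipschitz_continuous (clip_lipschitz (regular_L0 rG) (regular_clip rG)).
- by exists L; exact: regular_clip rG.
have b0 : 0 < b := lt_le_trans ltr01 (adapted_b1 aG).
exists b^-1, kap; split; first by rewrite invr_gt0.
split; first exact: adapted_kap aG.
move=> x n _; apply: deriv_ge_of_expansive (iter_has_deriv n (regular_deriv rG)) _ x.
move=> y z; rewrite -mulrA mulrC ler_pdivrMr // [leRHS]mulrC.
apply: le_trans (adapted_le aG _ _); apply: le_trans (adapted_iter aG _ _ _).
rewrite ler_wpM2l ?exprn_ge0 // ?(ltW (lt_trans ltr01 (adapted_kap aG))) //.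
exact: adapted_ge aG _ _.
Qed.

End C11Distance.

(** * The local perturbation *)

Section Bump.
Variable R : realType.
Implicit Types (f g F : R -> R) (x y t r : R).

Lemma cvg_is_derive f x (df : R) :
  h^-1 *: ((f \o shift x) (h *: 1) - f x) @[h --> 0^'] --> df -> is_derive x 1 f df.
Proof. by move=> h; apply: DeriveDef; [apply: cvgP; exact: h|exact: cvg_lim h]. Qed.

Lemma is_derive_local f g x df (d : R) : 0 < d -> (forall y, `|y - x| < d -> f y = g y) ->
  is_derive x 1 g df -> is_derive x 1 f df.
Proof.
move=> d0 fg [hd he]; apply: cvg_is_derive; rewrite -he.
apply: cvg_trans hd; apply: near_eq_cvg; near=> h.
have hh : `|h| < d by near: h; exact: dnbhs0_lt.
by rewrite /= /GRing.scale /= mulr1 !fg ?addrK // subrr normr0.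
Unshelve. all: by end_near. Qed.

(** Handles the function x|x|, and [cusp r] at its gluing points |t| = r. *)
Lemma is_derive_quadratic f x (df K : R) :
  (forall h, `|f (h + x) - f x - h * df| <= K * h ^+ 2) -> is_derive x 1 f df.
Proof.
move=> hf; apply: cvg_is_derive; apply/cvgrPdist_le => /= e e0; near=> h.
have h0 : h != 0 by near: h; exact: nbhs_dnbhs_neq.
have K1 : 0 < `|K| + 1 by rewrite ltr_wpDl.
have hh : `|h| < e / (`|K| + 1) by near: h; apply: dnbhs0_lt; rewrite divr_gt0.
rewrite /GRing.scale /= mulr1.
have -> : df - h^-1 * (f (h + x) - f x) = - (h^-1 * (f (h + x) - f x - h * df)).
  by field.
rewrite normrN normrM normfV mulrC ler_pdivrMr ?normr_gt0 //.
apply: le_trans (hf h) _; rewrite -(real_normK (num_real h)) expr2 mulrA.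
rewrite ler_wpM2r //; move: hh; rewrite ltr_pdivlMr // => hh; apply: le_trans (ltW hh).
by rewrite mulrC ler_wpM2l // (le_trans (ler_norm K)) // lerDl.
Unshelve. all: by end_near. Qed.

Lemma has_deriv_sqr_sign : has_deriv (fun x => x * `|x|) (fun x => 2 * `|x|).
Proof.
move=> x; apply: (@is_derive_quadratic _ _ _ 1) => h; rewrite mul1r ler_norml.
have [x0|x0] := leP 0 x; have [y0|y0] := leP 0 (h + x);
  rewrite ?(ger0_norm x0) ?(ltr0_norm x0) ?(ger0_norm y0) ?(ltr0_norm y0);
  apply/andP; split; nra.
Qed.


(* The derivative of [cusp r] has a corner at its minimum [0]; this is what lets
   the perturbation dominate the term [Lam * `|phi x|] of [perturbed_ln], which is
   linear in the distance to the orbit. *)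
Definition cusp (r t : R) := - t * (r - Num.min `|t| r) ^+ 2 / r.

Definition dcusp (r t : R) := - (r - Num.min `|t| r) * (r - 3 * Num.min `|t| r) / r.

Lemma has_deriv_cusp r : 0 < r -> has_deriv (cusp r) (dcusp r).
Proof.
move=> r0 t.
have hQ := has_deriv_sqr_sign.
have hsq : has_deriv (fun x => x * x) (fun x => x * 1 + x * 1).
  by move=> x; exact: (is_deriveM (has_deriv_id x) (has_deriv_id x)).
have hcu : has_deriv (fun x => x * (x * x)) (fun x => x * (x * 1 + x * 1) + (x * x) * 1).
  by move=> x; exact: (is_deriveM (has_deriv_id x) (hsq x)).
have [tr|tr] := ltP `|t| r.
  (* The square is expanded so that the absolute value occurs only in x|x|, whose derivative is
     known. *)
  pose g x := - r^-1 * (r ^+ 2 * x - 2 * r * (x * `|x|) + x * (x * x)).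
  have hg := has_derivZ (- r^-1) (has_derivD (has_derivB (has_derivZ (r ^+ 2) (@has_deriv_id R))
    (has_derivZ (2 * r) hQ)) hcu) t.
  have {}hg : is_derive t 1 g (dcusp r t).
    apply: is_derive_eq hg _; rewrite /dcusp /GRing.scale /= min_l ?(ltW tr) //.
    have [t0|t0] := leP 0 t; rewrite ?(ger0_norm t0) ?(ltr0_norm t0); field; exact: lt0r_neq0.
  apply: (@is_derive_local _ g _ _ (r - `|t|)); rewrite ?subr_gt0 //= => y yt.
  have yr : `|y| <= r by have := ler_normD (y - t) t; rewrite subrK; lra.
  rewrite /cusp /g min_l //.
  have [t0|t0] := leP 0 y; rewrite ?(ger0_norm t0) ?(ltr0_norm t0); field; exact: lt0r_neq0.
have [tr2|tr2] := ltP r `|t|.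
  have z : is_derive t 1 (fun=> 0 : R) (dcusp r t).
    by apply: is_derive_eq (has_deriv_cst 0 t) _; rewrite /dcusp min_r // subrr oppr0 !mul0r.
  apply: (@is_derive_local _ _ _ _ (`|t| - r)) z; rewrite ?subr_gt0 //= => y yt.
  have yr : r <= `|y|.
    by have := ler_normD (t - y) y; rewrite subrK distrC; lra.
  by rewrite /cusp min_r // subrr expr0n mulr0 mul0r.
have tE : `|t| = r by apply/le_anti; rewrite tr tr2.
apply: (@is_derive_quadratic _ _ _ 2) => h.
have -> : dcusp r t = 0 by rewrite /dcusp tE minxx subrr oppr0 !mul0r.
have -> : cusp r t = 0 by rewrite /cusp tE minxx subrr expr0n mulr0 mul0r.
rewrite mulr0 !subr0 /cusp.
have [hr|hr] := leP r `|h + t|; first by rewrite subrr expr0n mulr0 mul0r normr0 mulr_ge0 ?sqr_ge0.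
rewrite normrM normrM normrX normfV normrN (gtr0_norm r0) ler_pdivrMr //.
have h1 : `|h + t| <= r by exact: ltW.
have h2 : `|r - `|h + t| | ^+ 2 <= h ^+ 2.
  rewrite -[h ^+ 2]real_normK ?num_real // lerXn2r ?nnegrE //.
  rewrite [`|r - _|]ger0_norm ?subr_ge0 //.
  by have := ler_normB (h + t) h; rewrite [h + t - h]addrAC subrr add0r tE; lra.
rewrite mulrC; apply: (@le_trans _ _ (h ^+ 2 * r)); first by rewrite ler_pM ?exprn_ge0.
by rewrite ler_wpM2r ?(ltW r0) // ler_peMl ?sqr_ge0 // ler1n.
Qed.

Lemma cusp_le r t : 0 < r -> `|cusp r t| <= r * Num.min `|t| r.
Proof.
move=> r0; rewrite /cusp normrM normrM normrX normfV normrN (gtr0_norm r0) ler_pdivrMr //.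
have [tr|tr] := leP `|t| r; last by rewrite subrr normr0 expr0n mulr0 !mulr_ge0 // ltW.
rewrite [`|r - _|]ger0_norm ?subr_ge0 //.
rewrite [leRHS](_ : _ = `|t| * r ^+ 2) ?ler_wpM2l //; last by ring.
by rewrite lerXn2r ?nnegrE ?subr_ge0 ?(ltW r0) // gerBl.
Qed.

Lemma dcusp_le r t : 0 < r -> `|dcusp r t| <= r.
Proof.
move=> r0; rewrite /dcusp !normrM normfV normrN (gtr0_norm r0) ler_pdivrMr // -normrM.
set a := Num.min _ _; have a0 : 0 <= a by rewrite le_min normr_ge0 ltW.
have ar : a <= r by rewrite ge_min lexx orbT.
by rewrite ler_norml; apply/andP; split; nra.
Qed.

(** The corner in quantitative form: the derivative stays above an inverted tent of slope 1 with tip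
    [- r] at 0. *)
Lemma dcusp_ge r t : 0 < r -> Num.min `|t| r - r <= dcusp r t.
Proof.
move=> r0; rewrite /dcusp ler_pdivlMr //.
set a := Num.min _ _; have a0 : 0 <= a by rewrite le_min normr_ge0 ltW.
have ar : a <= r by rewrite ge_min lexx orbT.
nra.
Qed.

End Bump.

(** * Transporting the bump to the circle *)

Section PeriodicBump.
Variable R : realType.
Implicit Types (x y t r : R).

(** The representative nearest to 0 with its sign, which [cdist] loses and the odd function [cusp r]
    needs. *)
Definition wrap x := x - (Num.floor (x + 1 / 2))%:~R.

Lemma wrap_periodic : periodic1 wrap.
Proof.
move=> x; rewrite /wrap (_ : x + 1 + 1 / 2 = (x + 1 / 2) + 1%:~R); last by ring.
rewrite floorDrz ?intr_int // intrKfloor intrD; ring.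
Qed.

Lemma wrap_int x : exists n : int, x = wrap x + n%:~R.
Proof. by exists (Num.floor (x + 1 / 2)); rewrite subrK. Qed.

Lemma wrap_le x : `|wrap x| <= 1 / 2.
Proof.
have h0 := frac_ge0 (x + 1 / 2); have h1 := frac_lt1 (x + 1 / 2).
by rewrite /wrap ler_norml; rewrite /frac in h0 h1; apply/andP; split; lra.
Qed.

Lemma wrap_cdist x z : `|wrap (x - z)| = cdist x z.
Proof.
have [n hn] := wrap_int (x - z); have w := wrap_le (x - z).
move: hn w; set v := wrap _ => hn w.
have e : x = (v + z) + n%:~R by lra.
by rewrite [in RHS]e cdist_addzl cdist_small addrK.
Qed.

Lemma cusp_out r t : r <= `|t| -> cusp r t = 0.
Proof. by move=> h; rewrite /cusp min_r // subrr expr0n mulr0 mul0r. Qed.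

Lemma dcusp_out r t : r <= `|t| -> dcusp r t = 0.
Proof. by move=> h; rewrite /dcusp min_r // subrr oppr0 !mul0r. Qed.

Lemma cusp0 r : cusp r 0 = 0.
Proof. by rewrite /cusp oppr0 !mul0r. Qed.

Lemma dcusp0 r : 0 < r -> dcusp r 0 = - r.
Proof.
by move=> r0; rewrite /dcusp normr0 min_l ?ltW // mulr0 !subr0 mulfK // gt_eqF.
Qed.

(** If [n] is not the integer removed by [wrap], both arguments are at least [1 / 4] away from 0,
    where the bump vanishes; so the jump of [wrap] does no harm. *)
Lemma cusp_wrap r y (n : int) : r <= 1 / 4 -> `|y - n%:~R| <= 3 / 4 ->
  cusp r (wrap y) = cusp r (y - n%:~R).
Proof.
move=> r4 yn; have [k hk] := wrap_int y.
have [kn|kn] := eqVneq k n.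
  by congr cusp; rewrite -kn; lra.
have k1 : (1 : R) <= `|k%:~R - n%:~R|.
  by rewrite -intrB -intr_norm -[1]/(1%:~R) ler_int -gtz0_ge1 normr_gt0 subr_eq0.
have w := wrap_le y.
have h1 := ler_normB (y - n%:~R) (wrap y).
have e : y - n%:~R - wrap y = k%:~R - n%:~R by lra.
rewrite e in h1.
by rewrite !cusp_out //; lra.
Qed.

Lemma has_deriv_cusp_wrap r : 0 < r -> r <= 1 / 4 ->
  has_deriv (fun x => cusp r (wrap x)) (fun x => dcusp r (wrap x)).
Proof.
move=> r0 r4 x; have w := wrap_le x; have [n hn] := wrap_int x.
have -> : dcusp r (wrap x) = dcusp r (x - n%:~R) * (1 - 0).
  by rewrite subr0 mulr1; congr dcusp; lra.
have hd := has_deriv_comp (has_deriv_cusp r0)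
  (has_derivB (@has_deriv_id R) (has_deriv_cst (n%:~R))) x.
apply: (@is_derive_local _ _ _ _ _ (1 / 4)) hd => [|y yx]; first by rewrite divr_gt0.
apply: cusp_wrap => //.
have : `|x - n%:~R| <= 1 / 2 by rewrite (_ : x - _ = wrap x) //; lra.
by have := ler_normD (y - x) (x - n%:~R); rewrite addrA subrK; lra.
Qed.

Lemma dcusp_lipschitz r s t : 0 < r -> `|dcusp r s - dcusp r t| <= 4 * `| `|s| - `|t| |.
Proof.
move=> r0; rewrite /dcusp; set a := Num.min `|s| r; set c := Num.min `|t| r.
have a0 : 0 <= a by rewrite le_min normr_ge0 ltW.
have ar : a <= r by rewrite ge_min lexx orbT.
have c0 : 0 <= c by rewrite le_min normr_ge0 ltW.
have cr : c <= r by rewrite ge_min lexx orbT.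
have ac : `|a - c| <= `| `|s| - `|t| |.
  rewrite /a /c; have [h1|h1] := leP `|s| r; have [h2|h2] := leP `|t| r => //.
  - by rewrite [leLHS]ler0_norm ?[leRHS]ler0_norm; lra.
  - by rewrite [leLHS]ger0_norm ?[leRHS]ger0_norm; lra.
  - by rewrite subrr normr0.
have -> : - (r - a) * (r - 3 * a) / r - - (r - c) * (r - 3 * c) / r =
   (a - c) * ((4 * r - 3 * (a + c)) / r) by field; exact: lt0r_neq0.
rewrite normrM [leRHS]mulrC; apply: ler_pM => //.
rewrite normrM normfV (gtr0_norm r0) ler_pdivrMr // ler_norml.
by apply/andP; split; lra.
Qed.

End PeriodicBump.

(** * The perturbed map and its log-derivative *)

Section Perturbation.
Variable R : realType.
Variables (F : R -> R) (L B m : R) (z : nat -> R) (p : nat) (r eps : R).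
Hypothesis rF : regular F L B m.
Hypothesis r0 : 0 < r.
Hypothesis r4 : r <= 1 / 4.
Hypothesis eps0 : 0 < eps.
Hypothesis gap : forall i j, (i < j)%N -> (j < p)%N -> 2 * r <= cdist (z i) (z j).

Let B0 : 0 <= B := le_trans (normr_ge0 _) (regular_le rF 0).

(** [cusp r] vanishes at 0, so the orbit is kept; the weight [derive1 F (z i)] makes the derivative
    there change by the factor [1 - eps * r], whatever the orientation of [F]. *)
Definition phi x := eps * \sum_(i < p) derive1 F (z i) * cusp r (wrap (x - z i)).
Definition dphi x := eps * \sum_(i < p) derive1 F (z i) * dcusp r (wrap (x - z i)).
Definition perturbed x := F x + phi x.

Lemma phi_has_deriv : has_deriv phi dphi.
Proof.
apply: has_derivZ; elim: (p) => [|n IH].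
  have e (b : R -> R) : (fun x => \sum_(i < 0) derive1 F (z i) * b (wrap (x - z i))) = fun=> 0.
    by apply/funext => x; rewrite big_ord0.
  by rewrite !e; exact: has_deriv_cst.
have e (b : R -> R) : (fun x => \sum_(i < n.+1) derive1 F (z i) * b (wrap (x - z i))) =
    fun x => \sum_(i < n) derive1 F (z i) * b (wrap (x - z i)) +
             derive1 F (z n) * b (wrap (x - z n)).
  by apply/funext => x; rewrite big_ord_recr.
rewrite !e; apply: has_derivD; [exact: IH|apply: has_derivZ => x].
have := has_deriv_comp (has_deriv_cusp_wrap r0 r4)
  (has_derivB (@has_deriv_id R) (has_deriv_cst (z n))) x.
by rewrite subr0 mulr1.
Qed.

Lemma gap_unique x (i j : 'I_p) : cdist x (z i) < r -> cdist x (z j) < r -> i = j.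
Proof.
move=> xi xj; apply/val_inj => /=; case: (ltngtP i j) => // ij.
  have := gap ij (ltn_ord j); have := cdist_triangle x (z i) (z j).
  by rewrite (cdistC (z i) x) => h1 h2; exfalso; lra.
have := gap ij (ltn_ord i); have := cdist_triangle x (z j) (z i).
by rewrite (cdistC (z j) x) => h1 h2; exfalso; lra.
Qed.

Lemma cusp_sum_near (b : R -> R) x (i : 'I_p) : (forall t, r <= `|t| -> b t = 0) ->
  cdist x (z i) < r ->
  \sum_(j < p) derive1 F (z j) * b (wrap (x - z j)) = derive1 F (z i) * b (wrap (x - z i)).
Proof.
move=> hb xi; rewrite (bigD1 i) //= big1 ?addr0 // => j ji.
rewrite hb ?mulr0 // wrap_cdist leNgt; apply/negP => xj.
by rewrite (gap_unique xj xi) eqxx in ji.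
Qed.

Lemma cusp_sum_far (b : R -> R) x : (forall t, r <= `|t| -> b t = 0) ->
  (forall i : 'I_p, r <= cdist x (z i)) ->
  \sum_(j < p) derive1 F (z j) * b (wrap (x - z j)) = 0.
Proof. by move=> hb xi; rewrite big1 // => j _; rewrite hb ?mulr0 // wrap_cdist. Qed.

Lemma near_or_far x : (exists i : 'I_p, cdist x (z i) < r) \/ forall i : 'I_p, r <= cdist x (z i).
Proof.
have [h|h] := pselect (exists i : 'I_p, cdist x (z i) < r); [by left|right=> i].
by rewrite leNgt; apply/negP => hi; apply: h; exists i.
Qed.

Lemma phi_near x (i : 'I_p) : cdist x (z i) < r ->
  phi x = eps * (derive1 F (z i) * cusp r (wrap (x - z i))) /\
  dphi x = eps * (derive1 F (z i) * dcusp r (wrap (x - z i))).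
Proof.
move=> xi; rewrite /phi /dphi (cusp_sum_near (@cusp_out _ r) xi).
by rewrite (cusp_sum_near (@dcusp_out _ r) xi).
Qed.

Lemma phi_far x : (forall i : 'I_p, r <= cdist x (z i)) -> phi x = 0 /\ dphi x = 0.
Proof.
move=> xi; rewrite /phi /dphi (cusp_sum_far (@cusp_out _ r) xi).
by rewrite (cusp_sum_far (@dcusp_out _ r) xi) mulr0.
Qed.

Lemma phi_bound x : `|phi x| <= eps * B * r /\ `|dphi x| <= eps * B * r.
Proof.
have e0 := ltW eps0.
have [[i xi]|xi] := near_or_far x; last first.
  by have [-> ->] := phi_far xi; rewrite normr0 !mulr_ge0 // ltW.
have [-> ->] := phi_near xi.
have := cusp_le (wrap (x - z i)) r0; have := dcusp_le (wrap (x - z i)) r0.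
move: (cusp r _) (dcusp r _) => u v hv hu.
have {}hu : `|u| <= r.
  apply: le_trans hu _; rewrite ler_piMr ?(ltW r0) // ge_min; apply/orP; right; have := r4; lra.
rewrite !normrM (gtr0_norm eps0) -!mulrA.
by split; rewrite ler_wpM2l //; apply: ler_pM => //; exact: (regular_le rF).
Qed.

(** By the gap at most one bump is active at a point, so at most two terms change between [x] and
    [y], each by at most [4 * B * cdist x y]. Neither [p] nor [r] enters: the C^{1,1} size is
    governed by [eps] alone. *)
Lemma dphi_clip : clip (8 * (eps * B)) dphi.
Proof.
move=> x y; rewrite /dphi -mulrBr -sumrB normrM (gtr0_norm eps0).
pose c (i : 'I_p) := derive1 F (z i) * dcusp r (wrap (x - z i)) -
                     derive1 F (z i) * dcusp r (wrap (y - z i)).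
rewrite -/(\sum_(i < p) c i).
pose P (t : R) := [set i : 'I_p | cdist t (z i) < r]%SET.
have P1 t : (#|P t| <= 1)%N.
  apply/card_le1_eqP => i j; rewrite !inE; by move=> ti tj; exact: gap_unique tj ti.
have cz i : i \notin (P x :|: P y)%SET -> c i = 0.
  rewrite !inE negb_or -!leNgt => /andP[xi yi].
  by rewrite /c !dcusp_out ?mulr0 ?subrr // wrap_cdist.
have cB i : `|c i| <= 4 * B * cdist x y.
  rewrite /c -mulrBr normrM (_ : 4 * B * _ = B * (4 * cdist x y)); last by ring.
  apply: ler_pM => //; first by exact: (regular_le rF).
  apply: le_trans (dcusp_lipschitz _ _ r0) _.
  rewrite !wrap_cdist ler_wpM2l // ler_norml.
  have := cdist_triangle x y (z i); have := cdist_triangle y x (z i).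
  by rewrite (cdistC y x); move=> h1 h2; apply/andP; split; lra.
have hs : `|\sum_(i < p) c i| <= 2 * (4 * B * cdist x y).
  rewrite (bigID (fun i => i \in (P x :|: P y)%SET)) /= [X in _ + X]big1 ?addr0; last first.
    by move=> i; exact: cz.
  apply: le_trans (ler_norm_sum _ _ _) _.
  apply: (@le_trans _ _ (\sum_(i in (P x :|: P y)%SET) 4 * B * cdist x y)).
    by apply: ler_sum => i _; exact: cB.
  rewrite sumr_const -[leLHS]mulr_natl ler_wpM2r ?mulr_ge0 ?cdist_ge0 //.
  rewrite ler_nat (leq_trans (leq_card_setU _ _)) //.
  by rewrite (leq_trans (leq_add (P1 x) (P1 y))).
apply: le_trans (ler_wpM2l (ltW eps0) hs) _; rewrite le_eqVlt; apply/orP; left.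
by apply/eqP; ring.
Qed.

Lemma phi_periodic : periodic1 phi.
Proof.
move=> x; rewrite /phi; congr (_ * _); apply: eq_bigr => i _; congr (_ * cusp r _).
have -> : x + 1 - z i = (x - z i) + 1 by ring.
exact: wrap_periodic.
Qed.

Lemma perturbed_deriv : has_deriv perturbed (fun x => derive1 F x + dphi x).
Proof. exact: has_derivD (regular_deriv rF) phi_has_deriv. Qed.

Lemma perturbed_derive1 x : derive1 perturbed x = derive1 F x + dphi x.
Proof. by rewrite (has_deriv_derive1 perturbed_deriv). Qed.

Lemma perturbed_regular : eps * B * r <= m / 2 ->
  regular perturbed (L + 8 * (eps * B)) (B + eps * B * r) (m / 2).
Proof.
move=> em; have m0 := regular_m0 rF.
split.
- have [k hk] := regular_lift rF; exists k => x.
  by rewrite /perturbed hk phi_periodic addrAC.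
- by have := perturbed_deriv; rewrite -(has_deriv_derive1 perturbed_deriv).
- move=> x y; rewrite !perturbed_derive1 opprD addrACA mulrDl.
  by apply: le_trans (ler_normD _ _) _; rewrite lerD ?(regular_clip rF) // dphi_clip.
- by rewrite addr_ge0 ?(regular_L0 rF) // !mulr_ge0 // ltW.
- move=> x; rewrite perturbed_derive1; apply: le_trans (ler_normD _ _) _.
  by rewrite lerD ?(regular_le rF) //; have [] := phi_bound x.
- by rewrite divr_gt0.
- move=> x; rewrite perturbed_derive1.
  have := regular_ge rF x; have [_ h] := phi_bound x.
  by have := lerB_normD (derive1 F x) (dphi x); lra.
Qed.

Lemma perturbed_orbit (i : 'I_p) : perturbed (z i) = F (z i) /\
  `|derive1 perturbed (z i)| = `|derive1 F (z i)| * `|1 - eps * r|.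
Proof.
have zi : cdist (z i) (z i) < r by rewrite cdistxx.
have [h1 h2] := phi_near zi.
have w0 : wrap (z i - z i) = 0.
  by apply/eqP; rewrite -normr_eq0 wrap_cdist cdistxx.
split; first by rewrite /perturbed h1 w0 cusp0 !mulr0 addr0.
rewrite perturbed_derive1 h2 w0 dcusp0 // -normrM; congr `|_|; ring.
Qed.


(** The logarithm has slope at least 1 up to the point 1. *)
Lemma ln_increment (a d : R) : 0 < a -> 0 <= d -> a + d <= 1 -> ln a + d <= ln (a + d).
Proof.
move=> a0 d0 ad; have ad0 : 0 < a + d by rewrite ltr_wpDr.
have y1 : -1 < - (d / (a + d)).
  by rewrite ltrN2 ltr_pdivrMr // mul1r ltrDr.
have := le_ln1Dx y1.
have -> : 1 + - (d / (a + d)) = a / (a + d) by field; exact: lt0r_neq0.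
rewrite ln_div ?posrE // => h.
have : d <= d / (a + d) by rewrite ler_pdivlMr // ler_piMr.
lra.
Qed.

(** At distance [d < r] from an orbit point the corner raises the logarithm by [eps * d], compared
    with its value on the orbit. The variation of [F'] between the two points costs at most
    [eps * d / 4], and so does [Lam * |phi x|]; both need [r] small. The remaining [eps * d / 2] is
    at least [eps * r / 4] once [d >= r / 2]. *)
Lemma perturbed_ln (Lam : R) x : 0 <= Lam -> L * r <= m / 4 -> Lam * B * r <= 1 / 4 ->
  eps * r <= 1 / 2 ->
  ln (1 - eps * r) <= ln `|derive1 perturbed x| - ln `|derive1 F x| - Lam * `|phi x| /\
  ((forall i : 'I_p, r / 2 <= cdist x (z i)) ->
   ln (1 - eps * r) + eps * r / 4 <=
     ln `|derive1 perturbed x| - ln `|derive1 F x| - Lam * `|phi x|).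
Proof.
move=> Lam0 Lr LamB er; have e0 := eps0; have rr := r0.
have er0 : 0 < eps * r by rewrite mulr_gt0.
have [[i xi]|xfar] := near_or_far x; last first.
  rewrite perturbed_derive1; have [-> ->] := phi_far xfar.
  rewrite addr0 subrr normr0 mulr0 subr0.
  have : ln (1 + - (eps * r)) <= - (eps * r) by apply: le_ln1Dx; lra.
  by move=> h; split=> [|_]; lra.
set d := cdist x (z i) in xi *.
have d0 : 0 <= d by exact: cdist_ge0.
have w : `|wrap (x - z i)| = d by exact: wrap_cdist.
have [hphi hdphi] := phi_near xi.
have := cusp_le (wrap (x - z i)) rr; have := dcusp_le (wrap (x - z i)) rr.
have := dcusp_ge (wrap (x - z i)) rr.
rewrite w min_l ?(ltW xi) //; move: hphi hdphi.
move: (cusp r _) (dcusp r _) => u v hphi hdphi v1 v2 u1.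
have F0 : 0 < `|derive1 F x| := lt_le_trans (regular_m0 rF) (regular_ge rF x).
have Fx0 : derive1 F x != 0 by rewrite -normr_gt0.
pose rho := derive1 F (z i) / derive1 F x.
have hrho : `|rho - 1| * r <= d / 4.
  have -> : rho - 1 = (derive1 F (z i) - derive1 F x) / derive1 F x.
    by rewrite mulrBl divff.
  rewrite normrM normfV mulrAC ler_pdivrMr //.
  have h1 : `|derive1 F (z i) - derive1 F x| <= L * d.
    by rewrite distrC; exact: (regular_clip rF).
  apply: (@le_trans _ _ (L * d * r)); first by rewrite ler_wpM2r // ltW.
  apply: (@le_trans _ _ (d / 4 * m)).
    by rewrite mulrAC (_ : d / 4 * m = m / 4 * d) ?ler_wpM2r //; ring.
  by rewrite ler_wpM2l ?(regular_ge rF) // divr_ge0.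
pose q := 1 + eps * (rho * v).
have qE : derive1 perturbed x = derive1 F x * q.
  by rewrite perturbed_derive1 hdphi /q /rho; field.
have hq : 1 - eps * r + eps * (d * 3 / 4) <= q.
  have h1 : `|(rho - 1) * v| <= d / 4.
    by rewrite normrM (le_trans _ hrho) // ler_wpM2l.
  have h2 : (d - r) - d / 4 <= rho * v.
    have -> : rho * v = v + (rho - 1) * v by ring.
    by move: h1; rewrite ler_norml => /andP[h1 _]; lra.
  rewrite /q; have := ler_wpM2l (ltW e0) h2; lra.
have dr : eps * (d * 3 / 4) <= eps * r by rewrite ler_wpM2l ?(ltW e0) //; lra.
have ed0 : 0 <= eps * (d * 3 / 4) by rewrite mulr_ge0 ?(ltW e0) //; lra.
have q0 : 0 < q by lra.
have hln : ln (1 - eps * r) + eps * (d * 3 / 4) <= ln q.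
  apply: le_trans (ln_increment _ _ _) _; rewrite ?subr_gt0 //; try lra.
  by rewrite ler_ln ?posrE //; lra.
have -> : ln `|derive1 perturbed x| = ln `|derive1 F x| + ln q.
  by rewrite qE normrM (gtr0_norm q0) lnM // posrE.
have hphi2 : Lam * `|phi x| <= eps * (d / 4).
  rewrite hphi normrM (gtr0_norm e0) mulrCA ler_wpM2l ?(ltW e0) //.
  apply: (@le_trans _ _ (Lam * (B * (r * d)))).
    rewrite ler_wpM2l // normrM; apply: ler_pM => //; exact: (regular_le rF).
  rewrite (_ : Lam * (B * (r * d)) = Lam * B * r * d); last by ring.
  rewrite (_ : d / 4 = 1 / 4 * d); last by ring.
  by rewrite ler_wpM2r.
split=> [|/(_ i) di].
  have : 0 <= eps * d by rewrite mulr_ge0 // ltW.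
  lra.
have : eps * (r / 2) <= eps * d by rewrite ler_wpM2l // ltW.
lra.
Qed.

End Perturbation.

(** * Orbits near a periodic orbit *)

Section Locking.
Variable R : realType.
Variables (H G g : R -> R) (h b kap B M : R) (z0 : R) (p l : nat) (r delta C0 : R).
Hypothesis aG : adapted H G h b kap B.
Hypothesis gM : clip M g.
Hypothesis M0 : 0 <= M.
Hypothesis p0 : (0 < p)%N.
Hypothesis z_per : cdist (iter p G z0) z0 = 0.
Hypothesis r0 : 0 < r.
Hypothesis Br : B * r <= 1 / 2.
Hypothesis gap : forall i j, (i < j)%N -> (j < p)%N ->
  (B + 2) * r <= cdist (iter i G z0) (iter j G z0).
Hypothesis delta0 : 0 <= delta.
Hypothesis g_ge : forall x, - delta <= g x.
Hypothesis g_orbit : 0 <= birkhoff G g p z0.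

Let lG : is_lift G := adapted_lift aG.
Let k1 : 1 < kap := adapted_kap aG.
Let kap0 : 0 < kap := lt_trans ltr01 k1.

Definition near_orbit x := exists i : 'I_p, cdist x (iter i G z0) < r.

Lemma iter_mod_period n : cdist (iter n G z0) (iter (n %% p) G z0) = 0.
Proof.
rewrite {1}(divn_eq n p) addnC iterD; apply: iter_cdist0 => //.
elim: (n %/ p)%N => [|k IH]; first by rewrite cdistxx.
rewrite mulSn iterD.
by rewrite -[RHS]z_per; apply: cdist_eq0_trans; exact: iter_cdist0.
Qed.

(** The image of a point near one orbit point is within [B * r] of the next one and within [r] of
    some orbit point; the gap [(B + 2) * r] forces these to coincide. *)
Lemma near_follow n x (i0 : 'I_p) : cdist x (iter i0 G z0) < r ->
  (forall k, (k < n)%N -> near_orbit (iter k G x)) ->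
  forall k, (k < n)%N -> cdist (iter k G x) (iter k G (iter i0 G z0)) < r.
Proof.
move=> hi0 hn; elim=> [|k IH] kn //.
have [j hj] := hn k.+1 kn; rewrite !iterS in hj *.
have rr := r0.
have hB : cdist (G (iter k G x)) (G (iter k G (iter i0 G z0))) <= B * r.
  apply: le_trans (lipschitz_lift_cdist _ _ lG (adapted_lip aG)) _.
  rewrite ler_wpM2l ?(lipschitz1_ge0 (adapted_lip aG)) //.
  by apply/ltW/IH; exact: ltnW.
pose q := ((k.+1 + i0) %% p)%N.
have qp : (q < p)%N by rewrite ltn_mod.
have e : cdist (G (iter k G (iter i0 G z0))) (iter q G z0) = 0.
  by rewrite -iterS -iterD; exact: iter_mod_period.
have e2 t : cdist t (G (iter k G (iter i0 G z0))) = cdist t (iter q G z0).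
  by rewrite ![cdist t _]cdistC; exact: cdist_eq0_trans.
move: hB; rewrite !e2 => hB.
have jq : cdist (iter j G z0) (iter q G z0) < (B + 2) * r.
  have := cdist_triangle (G (iter k G x)) (iter j G z0) (iter q G z0).
  by rewrite (cdistC (iter j G z0) (G _)) mulrDl; lra.
suff <- : nat_of_ord j = q by [].
case: (ltngtP q j) => // hqj.
  by have := gap hqj (ltn_ord j); rewrite cdistC leNgt jq.
by have := gap hqj qp; rewrite leNgt jq.
Qed.

(** Following the orbit within [r] for [n] further steps bounds the initial distance by
    [b * r / kap ^+ n], for every [n]. *)
Lemma near_forever x : (forall k, near_orbit (iter k G x)) ->
  exists i : 'I_p, cdist x (iter i G z0) = 0.
Proof.
move=> hx; have [i0 hi0] := hx 0%N; rewrite /= in hi0.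
exists i0; apply/le_anti; rewrite cdist_ge0 andbT leNgt; apply/negP => d0.
have [n hn] := expr_gt (b * r / cdist x (iter i0 G z0)) k1.
have hy := @near_follow n.+1 x i0 hi0 (fun k _ => hx k).
have := @follow_contract R H G h b kap B aG r n.+1 x _ 0 Br (fun k hk => ltW (hy k hk)) isT.
rewrite subn0 /=.
by move: hn; rewrite ltr_pdivrMr // => hn; rewrite leNgt hn.
Qed.

Lemma birkhoff_ge n x : - delta * n%:R <= birkhoff G g n x.
Proof.
rewrite /birkhoff mulr_natr -[n in _ *+ n]card_ord -sumr_const.
by apply: ler_sum => i _; exact: g_ge.
Qed.

Lemma birkhoff_orbit_ge0 s (i0 : 'I_p) : 0 <= birkhoff G g (s * p) (iter i0 G z0).
Proof.
have hper : cdist (iter p G (iter i0 G z0)) (iter i0 G z0) = 0.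
  by rewrite -iterD addnC iterD; exact: iter_cdist0.
have e : birkhoff G g p (iter i0 G z0) = birkhoff G g p z0.
  exact: (birkhoff_periodic_shift aG i0 gM z_per).
elim: s => [|s IH]; first by rewrite /birkhoff big_ord0.
rewrite mulSn birkhoffD (birkhoff_cdist0 _ lG gM hper) e addr_ge0 //.
Qed.

Hypothesis C0_ge : M * (b / (kap - 1)) * (b * r / kap ^+ l) + delta * (p + l.+1)%:R <= C0.

(** Whole periods are compared with the orbit, whose sum is nonnegative. They stop while at least
    [l.+1] steps remain, so the distance at that time is at most [b * r / kap ^+ l], which bounds
    the distortion. The at most [p + l.+1] remaining steps lose [delta] each, so the loss is
    independent of [n]. *)
Lemma near_run n x : (forall k, (k < n)%N -> near_orbit (iter k G x)) ->
  - C0 <= birkhoff G g n x.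
Proof.
move=> hn; have C0h := C0_ge; have rr := r0; have dd := delta0.
have cc := adapted_const_ge0 aG.
have b0 : 0 <= b := le_trans ler01 (adapted_b1 aG).
have kl : 0 < kap ^+ l by rewrite exprn_gt0.
have T0 : 0 <= M * (b / (kap - 1)) * (b * r / kap ^+ l).
  by rewrite !mulr_ge0 ?invr_ge0 ?exprn_ge0 ?(ltW rr) ?(ltW kap0) // subr_ge0 ltW.
have short k y : (k <= p + l.+1)%N ->
    - (delta * (p + l.+1)%:R) <= birkhoff G g k y.
  move=> kp; apply: le_trans (birkhoff_ge k y).
  by rewrite mulNr lerN2 ler_wpM2l // ler_nat.
have [nl|nl] := leqP n l.+1.
  have := short n x (leq_trans nl (leq_addl _ _)); lra.
have n0 : (0 < n)%N := leq_ltn_trans (leq0n _) nl.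
have [i0 hi0] := hn 0%N n0; rewrite /= in hi0.
have [m hm] := cdist_attained x (iter i0 G z0).
pose y := iter i0 G z0 + m%:~R.
have ez : cdist (iter i0 G z0) y = 0 by rewrite /y cdist_addzr cdistxx.
have hy k : (k < n)%N -> cdist (iter k G x) (iter k G y) <= r.
  move=> kn; have := near_follow hi0 hn kn.
  rewrite cdistC (cdist_eq0_trans _ (iter_cdist0 k lG ez)) cdistC; exact: ltW.
have xy : `|x - y| <= 1 / 2 by rewrite /y opprD addrA hm cdist_le_half.
have fol := lifts_follow aG Br xy hy.
pose N := (n - l.+1)%N.
pose s := (N %/ p)%N.
have sN : (s * p <= N)%N by exact: leq_trunc_div.
have Nn : (l + s * p < n)%N by rewrite /N in sN; move: sN nl; clear; lia.
have snN : (s * p < n)%N by exact: leq_ltn_trans (leq_addl _ _) Nn.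
have h1 : `|iter (s * p) G x - iter (s * p) G y| <= b * r / kap ^+ l.
  rewrite ler_pdivlMr // mulrC; apply: le_trans (iter_contract aG _ _ _ _) _.
  by rewrite ler_wpM2l // fol // hy.
have h2 : birkhoff G g (s * p) y <= birkhoff G g (s * p) x +
    M * (b / (kap - 1)) * (b * r / kap ^+ l).
  apply: le_trans (birkhoff_distortion aG M0 gM (s * p) y x) _.
  rewrite lerD2l distrC ler_wpM2l //; exact: mulr_ge0.
have h3 : 0 <= birkhoff G g (s * p) y.
  by rewrite -(birkhoff_cdist0 _ lG gM ez) birkhoff_orbit_ge0.
have h4 : - (delta * (p + l.+1)%:R) <= birkhoff G g (n - s * p) (iter (s * p) G x).
  apply: short; have := ltn_ceil N p0; rewrite -/s mulSn /N; move: nl; clear; lia.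
rewrite -(subnKC (ltnW snN)) birkhoffD; lra.
Qed.

Definition far_count n x : R := \sum_(i < n) (~~ `[< near_orbit (iter i G x) >])%:R.

Hypothesis g_far : forall x, ~ near_orbit x -> 3 * C0 <= g x.

Lemma locking_const_ge0 : 0 <= C0.
Proof. by have := @near_run 0 0; rewrite /birkhoff big_ord0 oppr_le0; apply. Qed.

(** Cut at the first far visit. Of its gain [3 * C0], one part pays for the near run before it, one
    for the defect [- C0] of the induction hypothesis, and one is kept as the count. *)
Lemma birkhoff_far_count n x : C0 * far_count n x - C0 <= birkhoff G g n x.
Proof.
have c0 := locking_const_ge0.
elim/ltn_ind: n x => n IH x.
have [hnear|] := pselect (forall k, (k < n)%N -> near_orbit (iter k G x)).
  rewrite /far_count big1 ?mulr0 ?sub0r; first exact: near_run.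
  by move=> i _; rewrite asboolT //; exact: hnear.
move=> /existsNP[k0 /not_implyP[k0n k0far]].
have ex : exists k, (k < n)%N && ~~ `[< near_orbit (iter k G x) >].
  by exists k0; rewrite k0n; apply/asboolPn.
have [k /andP[kn /asboolPn kfar] kmin] := ex_minnP ex.
have kn' : n = (k + (1 + (n - k.+1)))%N by move: kn; clear; lia.
have h1 : - C0 <= birkhoff G g k x.
  apply: near_run => j jk; apply/asboolP; apply/negPn/negP => hj.
  by have := kmin j; rewrite (ltn_trans jk kn) hj => /(_ isT); rewrite leqNgt jk.
have h2 := g_far kfar.
have h3 := IH (n - k.+1)%N _ (iter k.+1 G x).
have /h3{}h3 : (n - k.+1 < n)%N by move: kn; clear; lia.
have e1 : birkhoff G g n x = birkhoff G g k x + g (iter k G x) +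
    birkhoff G g (n - k.+1) (iter k.+1 G x).
  by rewrite [in LHS]kn' birkhoffD birkhoffD /birkhoff big_ord_recl big_ord0 addr0 addrA.
have e2 : far_count n x = 1 + far_count (n - k.+1) (iter k.+1 G x).
  rewrite /far_count [in LHS]kn' -(big_mkord xpredT (fun i => (~~ `[< near_orbit (iter i G x) >])%:R)).
  rewrite (@big_cat_nat _ _ _ k) ?leq_addr //= big1_seq ?add0r; last first.
    move=> j; rewrite mem_index_iota => /andP[_ /andP[_ jk]].
    rewrite (_ : ~~ _ = false) //; apply/negbTE/negP => hj.
    by have := kmin j; rewrite (ltn_trans jk kn) hj => /(_ isT); rewrite leqNgt jk.
  rewrite -{1}(add0n k) big_addn addKn big_mkord big_ord_recl /= add0n.
  rewrite (_ : ~~ _ = true); last exact/asboolPn.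
  congr (_ + _); apply: eq_bigr => i _.
  by rewrite add0n -[G (iter k G x)]iterS -iterD addnS.
rewrite e1 e2 mulrDr mulr1; lra.
Qed.

End Locking.

(** * Invariant measures *)

Section InvariantMeasures.
Variable R : realType.
Implicit Types (nu : probability R R) (f : R -> R).

Lemma measurable_frac : measurable_fun [set: R] (@frac R).
Proof.
apply: measurable_funB; first exact: measurable_id.
apply: nondecreasing_measurable => // x y xy.
by rewrite ler_int; exact: le_floor.
Qed.

Lemma probability_setC_eq0 nu A : measurable A -> nu A = 1%E -> nu (~` A) = 0%E.
Proof. by move=> mA h; rewrite probability_setC // h subee. Qed.

Lemma probability_eq1 nu A : measurable A -> nu (~` A) = 0%E -> nu A = 1%E.
Proof.
by move=> mA h; rewrite -[A]setCK probability_setC ?h ?sube0 //; exact: measurableC.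
Qed.

Lemma bounded_measurable_integrable nu f (K : R) : measurable_fun setT f ->
  (forall x, `|f x| <= K) -> nu.-integrable setT (EFin \o f).
Proof.
move=> mf fK; apply: measurable_bounded_integrable => //.
  exact: (le_lt_trans (probability_le1 nu measurableT) (ltry 1)).
exists K; split; first exact: num_real.
by move=> M KM x _; apply: le_trans (fK x) (ltW KM).
Qed.

Variable G : R -> R.
Hypothesis cG : continuous G.
Hypothesis lG : is_lift G.

Lemma measurable_circ_map : measurable_fun setT (circ_map G).
Proof.
apply: (measurableT_comp measurable_frac); exact: continuous_measurable_fun.
Qed.

Lemma cdist_frac (x : R) : cdist (frac x) x = 0.
Proof. by have [n ->] := frac_int x; rewrite -intrN cdist_addzl cdistxx. Qed.

Lemma cdist_circ_iter n x y : cdist x y = 0 ->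
  cdist (iter n (circ_map G) x) (iter n G y) = 0.
Proof.
move=> xy; elim: n => //= n IH.
by rewrite (cdist_eq0_trans _ (cdist_frac _)); exact: lift_cdist0.
Qed.

Lemma periodic1_eq f x y : periodic1 f -> cdist x y = 0 -> f x = f y.
Proof. by move=> fp /cdist_eq0[n ->]; rewrite periodic1z. Qed.

Lemma Rintegral_circ_map nu f (K : R) : invariant G nu -> measurable_fun setT f ->
  (forall x, `|f x| <= K) ->
  \int[nu]_x f (circ_map G x) = \int[nu]_x f x.
Proof.
move=> [_ inv] mf fK; have mT := measurable_circ_map.
pose T : {mfun R >-> R} := HB.pack (circ_map G) (isMeasurableFun.Build _ _ _ _ _ mT).
rewrite /Rintegral; congr fine.
have h := @integral_pushforward _ _ _ _ _ T mT nu setT (EFin \o f) _ _ measurableT.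
rewrite preimage_setT in h; rewrite -h.
- by apply: eq_measure_integral => A mA _; rewrite /pushforward; exact: inv.
- exact/measurable_EFinP.
- apply: (@bounded_measurable_integrable _ (f \o circ_map G) K).
    exact: measurableT_comp.
  by move=> x; exact: fK.
Qed.

Lemma measurable_iter n : measurable_fun setT (iter n (circ_map G)).
Proof.
elim: n => [|n IH]; first exact: measurable_id.
exact: (measurableT_comp measurable_circ_map).
Qed.

Lemma Rintegral_iter nu f (K : R) n : invariant G nu -> measurable_fun setT f ->
  (forall x, `|f x| <= K) ->
  \int[nu]_x f (iter n (circ_map G) x) = \int[nu]_x f x.
Proof.
move=> inv mf fK; elim: n => // n IH; rewrite -{}IH.
rewrite -(@Rintegral_circ_map nu (fun x => f (iter n (circ_map G) x)) K inv) //.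
  by apply: eq_Rintegral => x _; rewrite -iterSr.
by apply: (measurableT_comp mf); exact: measurable_iter.
Qed.

(** Invariance of a measure on [[0, 1)] concerns [circ_map G], the estimates concern the lift [G];
    for periodic [f] the two sums agree. *)
Definition circ_birkhoff f n x := \sum_(i < n) f (iter i (circ_map G) x).

Lemma circ_birkhoffE f n x : periodic1 f -> circ_birkhoff f n x = birkhoff G f n x.
Proof.
move=> fp; apply: eq_bigr => i _; apply: periodic1_eq => //.
by apply: cdist_circ_iter; exact: cdistxx.
Qed.

Lemma circ_birkhoff_measurable f n : measurable_fun setT f ->
  measurable_fun setT (circ_birkhoff f n).
Proof.
move=> mf; elim: n => [|n IH].
  rewrite (_ : circ_birkhoff f 0 = fun=> 0); first exact: measurable_cst.
  by apply/funext => x; rewrite /circ_birkhoff big_ord0.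
rewrite (_ : circ_birkhoff f n.+1 =
  circ_birkhoff f n \+ (f \o iter n (circ_map G))); last first.
  by apply/funext => x; rewrite /circ_birkhoff big_ord_recr.
apply: measurable_funD => //; apply: measurableT_comp => //; exact: measurable_iter.
Qed.

Lemma circ_birkhoff_bounded f (K : R) n : (forall x, `|f x| <= K) ->
  forall x, `|circ_birkhoff f n x| <= K *+ n.
Proof.
move=> fK x; apply: le_trans (ler_norm_sum _ _ _) _.
rewrite -[X in K *+ X]card_ord -sumr_const; apply: ler_sum => i _; exact: fK.
Qed.

Lemma Rintegral_circ_birkhoff nu f (K : R) n : invariant G nu -> measurable_fun setT f ->
  (forall x, `|f x| <= K) ->
  \int[nu]_x circ_birkhoff f n x = n%:R * \int[nu]_x f x.
Proof.
move=> inv mf fK; elim: n => [|n IH].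
  rewrite mul0r (_ : circ_birkhoff f 0 = fun=> 0); first by rewrite Rintegral_cst // mul0r.
  by apply/funext => x; rewrite /circ_birkhoff big_ord0.
rewrite (_ : circ_birkhoff f n.+1 =
  fun x => circ_birkhoff f n x + f (iter n (circ_map G) x)); last first.
  by apply/funext => x; rewrite /circ_birkhoff big_ord_recr.
rewrite RintegralD //.
- by rewrite IH (Rintegral_iter n inv mf fK) -natr1 mulrDl mul1r.
- apply: (@bounded_measurable_integrable _ _ (K *+ n)).
    exact: circ_birkhoff_measurable.
  exact: circ_birkhoff_bounded.
- apply: (@bounded_measurable_integrable _ (f \o iter n (circ_map G)) K).
    apply: measurableT_comp => //; exact: measurable_iter.
  by move=> x; exact: fK.
Qed.

(** By invariance the [n]-step sum has integral [n] times that of [f]; dividing the integrated bound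
    by [n] makes [D] negligible. *)
Lemma Rintegral_lower nu f (K a D : R) : invariant G nu -> measurable_fun setT f ->
  (forall x, `|f x| <= K) -> periodic1 f ->
  (forall n x, n%:R * a - D <= birkhoff G f n x) -> a <= \int[nu]_x f x.
Proof.
move=> inv mf fK fp hb; rewrite leNgt; apply/negP => lt.
set J := Rintegral _ _ _ in lt.
have [n hn] : exists n : nat, D < n%:R * (a - J).
  exists (Num.Def.truncn (D / (a - J))).+1.
  by rewrite -ltr_pdivrMr ?subr_gt0 // truncnS_gt.
have := @le_Rintegral _ _ _ nu setT (fun=> n%:R * a - D) (circ_birkhoff f n) measurableT.
rewrite Rintegral_cst // (_ : fine _ = 1) ?mulr1; last exact: (congr1 fine (probability_setT nu)).
rewrite (Rintegral_circ_birkhoff n inv mf fK) -/J => h.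
have : n%:R * a - D <= n%:R * J.
  apply: h => //.
  - by apply: (@bounded_measurable_integrable _ _ `|n%:R * a - D|) => //; exact: measurable_cst.
  - apply: (@bounded_measurable_integrable _ _ (K *+ n)).
      exact: circ_birkhoff_measurable.
    exact: circ_birkhoff_bounded.
  - by move=> x _; rewrite circ_birkhoffE.
by move: hn; rewrite mulrBr; lra.
Qed.

Section PeriodicOrbit.
Variables (z0 : R) (p : nat).
Hypothesis p0 : (0 < p)%N.
Hypothesis z_per : cdist (iter p G z0) z0 = 0.
Hypothesis distinct : forall i j, (i < j)%N -> (j < p)%N ->
  0 < cdist (iter i G z0) (iter j G z0).

Definition orbit_point i := frac (iter i G z0).
Local Notation q := orbit_point.

Lemma frac_eq (x y : R) : cdist x y = 0 -> frac x = frac y.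
Proof. by move=> /cdist_eq0[n ->]; rewrite frac_addz. Qed.

Lemma orbit_pointE i : q i = iter i (circ_map G) (q 0).
Proof.
elim: i => // i IH; rewrite iterS -IH /circ_map /q iterS.
by apply/frac_eq; rewrite cdistC; apply: lift_cdist0 => //; exact: cdist_frac.
Qed.

Lemma orbit_point_step i : circ_map G (q i) = q i.+1.
Proof. by rewrite [RHS]orbit_pointE iterS -orbit_pointE. Qed.

Lemma orbit_point_period : q p = q 0.
Proof. by apply: frac_eq. Qed.

Lemma orbit_point_inj (i j : 'I_p) : q i = q j -> i = j.
Proof.
move=> e; have c0 : cdist (iter i G z0) (iter j G z0) = 0.
  rewrite -(cdist_eq0_trans _ (cdist_frac _)) -/(q i) e; exact: cdist_frac.
apply/val_inj => /=; case: (ltngtP i j) => // ij.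
  by have := distinct ij (ltn_ord j); rewrite c0 ltxx.
by have := distinct ij (ltn_ord i); rewrite cdistC c0 ltxx.
Qed.

Definition orbit_set : set R := [set q i | i in [set i : nat | (i < p)%N]].

Lemma orbit_set_bigcup : orbit_set = \bigcup_(i < p) [set q i].
Proof. by apply/seteqP; split=> [x [i ip <-]|x [i ip ->]]; exists i. Qed.

Lemma measurable_orbit_set : measurable orbit_set.
Proof. rewrite orbit_set_bigcup; apply: bigcup_measurable => i _; exact: measurable_set1. Qed.

Lemma orbit_set_step i : orbit_set (q i) -> orbit_set (q i.+1).
Proof.
move=> [j jp e]; rewrite -orbit_point_step -e orbit_point_step.
move: jp => /=; rewrite leq_eqVlt => /predU1P[->|jp]; last by exists j.+1.
by rewrite orbit_point_period; exists 0%N.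
Qed.

Section Carried.
Variable nu : probability R R.
Hypothesis inv : invariant G nu.
Hypothesis carried : nu orbit_set = 1%E.

Lemma carriedI A : measurable A -> nu A = nu (A `&` orbit_set).
Proof.
move=> mA; have mO := measurable_orbit_set.
have mC := measurableC mO.
have z : nu (A `&` ~` orbit_set) = 0%E.
  apply/eqP; rewrite eq_le measure_ge0 andbT.
  have <- : nu (~` orbit_set) = 0%E by exact: probability_setC_eq0.
  by apply: le_measure; rewrite ?inE //; exact: measurableI.
rewrite {1}(_ : A = (A `&` orbit_set) `|` (A `&` ~` orbit_set)); last first.
  by rewrite -setIUr setUv setIT.
rewrite measureU; [|exact: measurableI|exact: measurableI|].
  exact: (etrans (congr1 (fun t => (nu (A `&` orbit_set) + t)%E) z) (adde0 _)).
by rewrite setIACA setICr setI0.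
Qed.

(** The map permutes the orbit, so the preimage of [q i.+1] meets it only in [q i]; the rest of the
    preimage is null. *)
Lemma carried_point i : nu [set q i] = nu [set q 0].
Proof.
elim: i => // i <-.
have [_ hi] := inv.
have m1 (x : R) : measurable [set x] by exact: measurable_set1.
rewrite -(hi _ (m1 (q i.+1))).
have mpre : measurable (circ_map G @^-1` [set q i.+1]).
  by rewrite -[X in measurable X]setTI; exact: measurable_circ_map.
rewrite (carriedI mpre) (carriedI (m1 (q i))); congr (nu _).
apply/seteqP; split=> x [] /= e [j jp jx].
  split; last by exists j.
  have oi k : exists2 k', (k' < p)%N & q k = q k'.
    elim: k => [|k [k' kp' e']]; first by exists 0%N.
    have [|j' jp' e''] := @orbit_set_step k'; first by exists k'.
    by exists j' => //; rewrite e'' -!orbit_point_step e'.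
  have [k kp ek] := oi i; rewrite -jx ek.
  have e2 : q j.+1 = q k.+1.
    by rewrite -!orbit_point_step -ek jx orbit_point_step.
  suff -> : j = k by [].
  move: jp kp e2 => /=; rewrite leq_eqVlt => /predU1P[jp|jp]; rewrite leq_eqVlt => /predU1P[kp|kp].
  - by move=> _; move: jp kp; clear; lia.
  - rewrite jp orbit_point_period => e2.
    by have := @orbit_point_inj (Ordinal p0) (Ordinal kp) e2 => /(congr1 val).
  - rewrite kp orbit_point_period => e2.
    by have := @orbit_point_inj (Ordinal jp) (Ordinal p0) e2 => /(congr1 val).
  - by move=> e2; have /(congr1 val) [] := @orbit_point_inj (Ordinal jp) (Ordinal kp) e2.
by split; [rewrite e orbit_point_step|exists j].
Qed.

Lemma carried_sum A : measurable A ->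
  nu A = (\sum_(i < p | q i \in A) nu [set q 0])%E.
Proof.
move=> mA; rewrite (carriedI mA).
have -> : A `&` orbit_set = \big[setU/set0]_(i < p | q i \in A) [set q i].
  rewrite -(bigcup_pred (fun i : 'I_p => q i \in A) (fun i : 'I_p => [set q i])).
  apply/seteqP; split=> [x [Ax [i ip ix]]|x [i /= Ai ->]].
    by exists (Ordinal ip) => //=; rewrite ?inE ix.
  by rewrite inE in Ai; split => //; exists i => /=.
rewrite measure_bigsetU_ord //=.
- by apply: eq_bigr => i _; exact: carried_point.
- by move=> i j _ _ [x [/= -> e]]; exact: (orbit_point_inj e).
Qed.

Lemma carried_weight : nu [set q 0] = (p%:R^-1)%:E.
Proof.
have := carried_sum measurable_orbit_set; rewrite carried.
rewrite (eq_bigl xpredT) => [|i]; last by apply/mem_set; exists i => //=.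
have fin : nu [set q 0] \is a fin_num by rewrite fin_num_measure //; exact: measurable_set1.
rewrite -(fineK fin) sumEFin sumr_const card_ord => /(congr1 fine) /= h.
congr EFin; have P0 : (p%:R : R) != 0 by rewrite pnatr_eq0 -lt0n.
by apply: (mulIf P0); rewrite mulVf // mulr_natr.
Qed.

End Carried.

Lemma carried_unique (nu nu' : probability R R) : invariant G nu -> invariant G nu' ->
  nu orbit_set = 1%E -> nu' orbit_set = 1%E ->
  forall A, measurable A -> nu A = nu' A.
Proof.
move=> inv inv' c c' A mA.
by rewrite (carried_sum inv c mA) (carried_sum inv' c' mA) !carried_weight.
Qed.

(** The second argument is the fallback of [mnormalize] for total mass zero or infinity; here the
    mass is [p]. *)
Definition orbit_measure : probability R R :=
  mnormalize (msum (fun i => dirac (q i)) p) (dirac (q 0)).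

Lemma orbit_measureE A :
  orbit_measure A = ((\sum_(i < p) \d_(q i) A) * (p%:R^-1)%:E)%E.
Proof.
have e : (\sum_(i < p) \d_(q i) [set: R])%E = (p%:R)%:E :> \bar R.
  rewrite (eq_bigr (fun=> 1%:E)) => [|i _]; last by rewrite diracT.
  by rewrite sumEFin sumr_const card_ord.
rewrite /orbit_measure /= /mnormalize /= /msum /= e ifF //.
by apply/negbTE; rewrite negb_or eqe pnatr_eq0 -lt0n p0.
Qed.

Lemma orbit_measure_carried : orbit_measure orbit_set = 1%E.
Proof.
rewrite orbit_measureE (eq_bigr (fun=> 1%:E)) => [|i _]; last first.
  by rewrite diracE mem_set //; exists i => //=.
rewrite sumEFin sumr_const card_ord -EFinM divff //.
by rewrite pnatr_eq0 -lt0n.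
Qed.

Lemma orbit_measure_invariant : invariant G orbit_measure.
Proof.
split.
  rewrite /circ_prob; apply/eqP; rewrite eq_le probability_le1 //=.
  rewrite -orbit_measure_carried; apply: le_measure; rewrite ?inE //.
    exact: measurable_orbit_set.
  move=> x [i ip <-]; rewrite /= in_itv /=; apply/andP; split; first exact: frac_ge0.
  exact: frac_lt1.
move=> A mA; rewrite !orbit_measureE; congr (_ * _)%E.
have h i : \d_(q i) (circ_map G @^-1` A) = \d_(q i.+1) A :> \bar R.
  rewrite !diracE; congr ((nat_of_bool _)%:R%:E).
  by apply/idP/idP; rewrite !inE /= orbit_point_step.
rewrite (eq_bigr (fun i : 'I_p => \d_(q i.+1) A)) => [|i _]; last exact: h.
case: p p0 orbit_point_period => // n _ e.
rewrite [LHS]big_ord_recr [RHS]big_ord_recl /= e addeC; congr (_ + _)%E.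
Qed.

End PeriodicOrbit.
End InvariantMeasures.

(** * From a Birkhoff bound with penalty to uniqueness of the minimizing measure *)

Section UniqueMinimizer.
Variable R : realType.
Variables (G : R -> R) (L B m : R) (z0 : R) (p : nat) (r a K c : R).
Hypothesis rG : regular G L B m.
Hypothesis p0 : (0 < p)%N.
Hypothesis z_per : cdist (iter p G z0) z0 = 0.
Hypothesis distinct : forall i j, (i < j)%N -> (j < p)%N ->
  0 < cdist (iter i G z0) (iter j G z0).
Let f (x : R) := ln `|derive1 G x|.
Let near := near_orbit G z0 p r.
Hypothesis c0 : 0 < c.
Hypothesis f_orbit : birkhoff G f p z0 = p%:R * a.
Hypothesis f_lower : forall n x,
  n%:R * a - K + c * far_count G z0 p r n x <= birkhoff G f n x.
Hypothesis forever : forall x, (forall k, near (iter k G x)) ->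
  exists i : 'I_p, cdist x (iter i G z0) = 0.

Let lG : is_lift G := regular_lift rG.
Let cG : continuous G := has_deriv_continuous (regular_deriv rG).

Lemma ln_lipschitz (u v : R) : m <= u -> m <= v -> `|ln u - ln v| <= m^-1 * `|u - v|.
Proof.
have m0 := regular_m0 rG.
have h (s t : R) : m <= s -> m <= t -> ln s - ln t <= m^-1 * `|s - t|.
  move=> ms mt; have s0 := lt_le_trans m0 ms; have t0 := lt_le_trans m0 mt.
  rewrite -ln_div ?posrE //.
  have -> : s / t = 1 + (s - t) / t by field; exact: lt0r_neq0.
  apply: le_trans (le_ln1Dx _) _.
    have : 0 < s / t by rewrite divr_gt0.
    by rewrite (_ : (s - t) / t = s / t - 1); [lra|field; exact: lt0r_neq0].
  apply: le_trans (ler_norm _) _; rewrite normrM normfV (gtr0_norm t0) mulrC.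
  by rewrite ler_wpM2r // lef_pV2.
move=> mu mv; have h1 := h _ _ mu mv; have h2 := h _ _ mv mu.
by rewrite distrC in h2; rewrite ler_norml; apply/andP; split; lra.
Qed.

Lemma log_deriv_clip : clip (L / m) f.
Proof.
move=> x y; apply: le_trans (ln_lipschitz (regular_ge rG x) (regular_ge rG y)) _.
rewrite (mulrC L) -mulrA ler_wpM2l ?invr_ge0 ?(ltW (regular_m0 rG)) //.
by apply: le_trans (ler_dist_dist _ _) (regular_clip rG _ _).
Qed.

Let Lm0 : 0 <= L / m. Proof. by rewrite divr_ge0 ?(regular_L0 rG) // ltW // (regular_m0 rG). Qed.

Lemma log_deriv_measurable : measurable_fun setT f.
Proof.
apply: continuous_measurable_fun.
exact: lipschitz_continuous (clip_lipschitz Lm0 log_deriv_clip).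
Qed.

Lemma log_deriv_bounded x : `|f x| <= `|f 0| + L / m.
Proof. exact: clip_bounded log_deriv_clip Lm0 x. Qed.

Lemma log_deriv_integrable (nu : probability R R) : nu.-integrable setT (EFin \o f).
Proof. exact: bounded_measurable_integrable log_deriv_measurable log_deriv_bounded. Qed.

Lemma lyapE (nu : probability R R) : lyap G nu = (\int[nu]_x f x)%:E.
Proof.
rewrite /lyap /Rintegral fineK //.
exact: integrable_fin_num (log_deriv_integrable nu).
Qed.

Definition far_set : set R := [set x | ~ near x].

Lemma measurable_far_set : measurable far_set.
Proof.
rewrite (_ : far_set = ~` \bigcup_(i in [set i : nat | (i < p)%N]) [set x | cdist x (iter i G z0) < r]).
  apply: measurableC; apply: bigcup_measurable => i _; apply: open_measurable.
  have ci : continuous (fun x => cdist x (iter i G z0)).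
    apply: (@lipschitz_continuous _ 1) => x y; rewrite mul1r.
    have := cdist_triangle y x (iter i G z0); have := cdist_triangle x y (iter i G z0).
    have := cdist_le_dist x y; rewrite (cdistC y x) ler_norml => h1 h2 h3.
    by apply/andP; split; lra.
  have -> : [set x | cdist x (iter i G z0) < r] =
    (fun x => cdist x (iter i G z0)) @^-1` [set y | y < r] by [].
  by apply: open_comp => [x _|]; [exact: ci|exact: open_lt].
apply/seteqP; split=> x /= hx; contra: hx.
  by move=> [i ip xi]; exists (Ordinal ip).
by move=> [i xi]; exists i => //=.
Qed.

Let iota (x : R) : R := (~~ `[< near x >])%:R.

Lemma iotaE : iota = \1_far_set.
Proof.
apply/funext => x; rewrite /iota indicE; congr (_%:R); congr nat_of_bool.
apply/idP/idP => [/asboolPn h|]; first exact/mem_set.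
by rewrite inE => h; apply/asboolPn.
Qed.

Lemma iota_bounded x : `|iota x| <= 1.
Proof. by rewrite /iota; case: (~~ _); rewrite ?normr1 ?normr0. Qed.

Lemma iota_measurable : measurable_fun setT iota.
Proof. by rewrite iotaE; apply: measurable_indic; exact: measurable_far_set. Qed.

Lemma iota_periodic : periodic1 iota.
Proof.
move=> x; rewrite /iota; congr (~~ _)%:R; apply: asbool_equiv_eq.
by split=> -[i hi]; exists i; move: hi; rewrite (cdist_addzl _ _ 1).
Qed.

(** [Rintegral_lower] for [f] minus [c] times the indicator of the far set, whose sums are bounded
    below by [f_lower]. *)
Lemma Rintegral_log_deriv_ge nu : invariant G nu ->
  a + c * fine (nu far_set) <= \int[nu]_x f x.
Proof.
move=> inv.
pose g x := f x - c * iota x.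
have ci : nu.-integrable setT (EFin \o (fun x => c * iota x)).
  apply: (@bounded_measurable_integrable _ _ _ `|c|).
    by apply: measurable_funM; [exact: measurable_cst|exact: iota_measurable].
  by move=> x; rewrite normrM ler_piMr // iota_bounded.
have ii : nu.-integrable setT (EFin \o iota).
  exact: bounded_measurable_integrable iota_measurable iota_bounded.
have hI : \int[nu]_x iota x = fine (nu far_set).
  rewrite /Rintegral iotaE; congr fine.
  by rewrite integral_indic ?setIT //; exact: measurable_far_set.
have hg : \int[nu]_x g x = \int[nu]_x f x - c * fine (nu far_set).
  rewrite RintegralB //; last exact: log_deriv_integrable.
  by rewrite RintegralZl // hI.
suff : a <= \int[nu]_x g x by rewrite hg; lra.
apply: (@Rintegral_lower _ G cG lG nu g (`|f 0| + L / m + `|c|) a K inv).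
- by apply: measurable_funB; [exact: log_deriv_measurable|apply: measurable_funM;
    [exact: measurable_cst|exact: iota_measurable]].
- move=> x; apply: le_trans (ler_normB _ _) _; rewrite lerD ?log_deriv_bounded //.
  by rewrite normrM ler_piMr // iota_bounded.
- by move=> x; rewrite /g iota_periodic (clip_periodic log_deriv_clip).
move=> n x; have := f_lower n x.
have -> : birkhoff G g n x = birkhoff G f n x - c * far_count G z0 p r n x.
  by rewrite /birkhoff /far_count mulr_sumr -sumrB.
lra.
Qed.

(** The penalty makes the far set null, and invariance does so for all its preimages. Hence almost
    every point stays near forever and lies on the orbit. *)
Lemma minimizing_carried nu : invariant G nu -> \int[nu]_x f x <= a ->
  nu (orbit_set G z0 p) = 1%E.
Proof.
move=> inv Ja; have [cp hinv] := inv.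
have far0 : nu far_set = 0%E.
  have fin : nu far_set \is a fin_num.
    by rewrite fin_num_measure //; exact: measurable_far_set.
  have f0 : 0 <= fine (nu far_set) by rewrite fine_ge0.
  have cc := c0.
  rewrite -(fineK fin); congr EFin; apply/le_anti; rewrite f0 andbT.
  rewrite -(pmulr_rle0 _ cc); have := Rintegral_log_deriv_ge inv; lra.
have farn n : nu (iter n (circ_map G) @^-1` far_set) = 0%E.
  elim: n => [|n IH]; first exact: far0.
  rewrite -[RHS]IH -[RHS]hinv; first by congr (nu _); apply/funext => x; rewrite /preimage /= -iterS iterSr.
  rewrite -[X in measurable X]setTI; apply: (measurable_iter cG n) => //.
  exact: measurable_far_set.
have mO := measurable_orbit_set G z0 p.
have neg : nu.-negligible (~` orbit_set G z0 p).
  have sub : ~` orbit_set G z0 p `<=`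
      ~` `[0, 1[%classic `|` \bigcup_n (iter n (circ_map G) @^-1` far_set).
    move=> x xO; have [x01|] := pselect (`[0, 1[%classic x); last by left.
    right; apply: contrapT => hx; apply: xO.
    have [i hi] : exists i : 'I_p, cdist x (iter i G z0) = 0.
      apply: forever => k; apply: contrapT => hk; apply: hx; exists k => //=.
      move=> [i xi]; apply: hk; exists i.
      by rewrite -(cdist_eq0_trans _ (cdist_circ_iter lG k (cdistxx x))).
    exists i => //=; rewrite /orbit_point -(frac_eq hi).
    move: x01; rewrite /= in_itv /= => /andP[x0 x1].
    rewrite /frac (_ : Num.floor x = 0) ?subr0 //.
    by apply/eqP; rewrite floor_eq x0 /= add0r.
  apply: (negligibleS sub); apply: negligibleU.
    apply/negligibleP; first exact: measurableC.
    exact: probability_setC_eq0.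
  apply: negligible_bigcup => n; apply/negligibleP; last exact: farn.
  rewrite -[X in measurable X]setTI; apply: (measurable_iter cG n) => //.
  exact: measurable_far_set.
apply: probability_eq1 => //; apply/negligibleP => //; exact: measurableC.
Qed.

(** The [p]-step sum is constant on the orbit, so its integral is [p * a], and by invariance it is
    [p] times the integral of [f]. *)
Lemma carried_integral nu : invariant G nu -> nu (orbit_set G z0 p) = 1%E ->
  \int[nu]_x f x = a.
Proof.
move=> inv carr.
have P0 : (0 : R) < p%:R by rewrite ltr0n.
apply: (mulfI (lt0r_neq0 P0)).
rewrite -(Rintegral_circ_birkhoff cG p inv log_deriv_measurable log_deriv_bounded).
have -> : p%:R * a = \int[nu]_x (fun=> p%:R * a) x.
  by rewrite Rintegral_cst // (_ : fine _ = 1) ?mulr1 //; exact: (congr1 fine (probability_setT nu)).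
congr fine; apply: ae_eq_integral => //.
- apply/measurable_EFinP; apply: circ_birkhoff_measurable => //; exact: log_deriv_measurable.
have mO := measurable_orbit_set G z0 p.
exists (~` orbit_set G z0 p); split; first exact: measurableC.
  exact: probability_setC_eq0.
move=> x /= hx xO; apply: hx => _; congr EFin.
have fp := clip_periodic log_deriv_clip.
rewrite (circ_birkhoffE lG p x fp); case: xO => i ip <-.
rewrite /orbit_point (birkhoff_cdist0 p lG log_deriv_clip (cdist_frac _)).
rewrite -f_orbit.
have := birkhoffD G f i p z0; rewrite addnC birkhoffD.
by rewrite (birkhoff_cdist0 i lG log_deriv_clip z_per); lra.
Qed.

Lemma unique_minimizer : exists mu : probability R R,
  lyap_min G mu /\
  (forall nu : probability R R, lyap_min G nu -> forall A, measurable A -> nu A = mu A) /\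
  periodic_orbit_support G mu.
Proof.
pose mu := orbit_measure G z0 p.
have imu : invariant G mu := orbit_measure_invariant lG p0 z_per.
have cmu : mu (orbit_set G z0 p) = 1%E := orbit_measure_carried G z0 p0.
have lmu : lyap G mu = a%:E by rewrite lyapE carried_integral.
have al : alpha G = a%:E.
  apply/eqP; rewrite eq_le; apply/andP; split.
    by rewrite -lmu; apply: ereal_inf_lbound; exists mu.
  apply: le_ereal_inf_tmp => _ [nu inv <-]; rewrite lyapE lee_fin.
  apply: le_trans (Rintegral_log_deriv_ge inv); rewrite lerDl mulr_ge0 ?(ltW c0) //.
  exact: fine_ge0.
exists mu; split; first by split => //; rewrite al.
split.
  move=> nu [inv hnu] A mA; apply: (carried_unique cG lG p0 z_per distinct) => //.
  by apply: minimizing_carried => //; rewrite -lee_fin -lyapE hnu al lexx.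
exists (orbit_point G z0 0), p; split => //; split.
  by rewrite -(orbit_pointE lG) orbit_point_period.
rewrite -cmu; congr (mu _); apply/seteqP; split=> x [i ip <-]; exists i => //=.
  exact: (orbit_pointE lG).
exact/esym/(orbit_pointE lG).
Qed.

End UniqueMinimizer.

(** * Openness and density *)

Section NearPerturbed.
Variable R : realType.
Variables (F G H u : R -> R) (L B m LG BG LT BT h b kap B1 Lam alpha : R).
Variables (z0 : R) (p l : nat) (r eps sigma theta delta : R).
Let z i := iter i F z0.
Let T := perturbed F z p r eps.
Let f (x : R) := ln `|derive1 F x|.
Let fG (x : R) := ln `|derive1 G x|.
Let red x := f x - alpha - u (F x) + u x.
Let ck := b / (kap - 1).
Let Mf := LG / (m / 2).
Let C0 := eps * r / 32.
Hypothesis rF : regular F L B m.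
Hypothesis rT : regular T LT BT (m / 2).
Hypothesis rG : regular G LG BG (m / 2).
Hypothesis aG : adapted H G h b kap B1.
Hypothesis uLam : clip Lam u.
Hypothesis Lam0 : 0 <= Lam.
Hypothesis red0 : forall x, 0 <= red x.
Hypothesis p0 : (0 < p)%N.
Hypothesis z_per : cdist (iter p F z0) z0 = 0.
Hypothesis red_orbit : birkhoff F red p z0 <= sigma.
Hypothesis r0 : 0 < r.
Hypothesis r4 : r <= 1 / 4.
Hypothesis eps0 : 0 < eps.
Hypothesis eps_r : eps * r <= 1 / 2.
Hypothesis Lr : L * r <= m / 4.
Hypothesis LamBr : Lam * B * r <= 1 / 4.
Hypothesis B1r : B1 * r <= 1 / 2.
Hypothesis gap : forall i j, (i < j)%N -> (j < p)%N -> (B1 + 4) * r <= cdist (z i) (z j).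
Hypothesis GT : forall x, cdist (G x) (T x) <= theta.
Hypothesis dGT : forall x, `|derive1 G x - derive1 T x| <= theta.
Hypothesis theta_r : ck * (p%:R * theta) <= r / 2.
Hypothesis delta_ge :
  sigma / p%:R + theta * (4 / m + Lam + Mf * ck * p%:R) <= delta.
Hypothesis C0_ge : (Mf + Lam * B1 + Lam) * ck * (b * r / kap ^+ l) + delta * (p + l.+1)%:R <= C0.

Let B10 : 0 <= B1 := lipschitz1_ge0 (adapted_lip aG).
Let m0 : 0 < m := regular_m0 rF.
Let P0 : (0 : R) < p%:R. Proof. by rewrite ltr0n. Qed.
Let theta0 : 0 <= theta := le_trans (cdist_ge0 _ _) (GT 0).
Let ck0 : 0 <= ck := adapted_const_ge0 aG.
Let Mf0 : 0 <= Mf.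
Proof. by rewrite divr_ge0 ?(regular_L0 rG) // ltW // (regular_m0 rG). Qed.
Let fG_clip : clip Mf fG := log_deriv_clip rG.

Let gap2 i j : (i < j)%N -> (j < p)%N -> 2 * r <= cdist (z i) (z j).
Proof.
move=> ij jp; apply: le_trans (gap ij jp); rewrite ler_wpM2r ?(ltW r0) //.
have := B10; lra.
Qed.

Lemma near_T_log x : `|fG x - ln `|derive1 T x| | <= 2 / m * theta.
Proof.
apply: le_trans (ln_lipschitz rG (regular_ge rG x) (regular_ge rT x)) _.
rewrite invf_div ler_wpM2l ?divr_ge0 ?(ltW m0) //.
exact: le_trans (ler_dist_dist _ _) (dGT x).
Qed.

(** The continuation of the orbit to [G]: the points [z i] form an orbit of [T], hence a
    pseudo-orbit of [G] with jumps at most [theta]. *)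
Lemma shadow_orbit : exists y, [/\ cdist (iter p G y) y = 0,
  \sum_(i < p) cdist (iter i G y) (z i) <= ck * (p%:R * theta) &
  forall i : 'I_p, cdist (iter i G y) (z i) <= ck * (p%:R * theta)].
Proof.
have [y [hy hs]] := shadowing aG p0 (x := z) z_per.
have hsum : \sum_(i < p) cdist (iter i G y) (z i) <= ck * (p%:R * theta).
  apply: le_trans hs _; rewrite ler_wpM2l //.
  rewrite mulr_natl -[X in theta *+ X]card_ord -sumr_const; apply: ler_sum => i _.
  have [e _] := perturbed_orbit eps rF r0 r4 gap2 i.
  have <- : T (z i) = z i.+1 by rewrite /T e.
  exact: GT.
exists y; split => // i; apply: le_trans hsum; rewrite (bigD1 i) //= lerDl.
by apply: sumr_ge0 => j _; exact: cdist_ge0.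
Qed.

(** The function [g] is the log-derivative of [G], normalised by its average [a] on the continued
    orbit and corrected by the old [u]. It is shown to be at least [- delta] everywhere and at least
    [3 * C0] off the neighbourhood, which feeds the locking estimates. *)
Lemma near_perturbed_minimizer : exists mu : probability R R,
  lyap_min G mu /\
  (forall nu : probability R R, lyap_min G nu -> forall A, measurable A -> nu A = mu A) /\
  periodic_orbit_support G mu.
Proof.
have [y [y_per ysum yz]] := shadow_orbit.
have rr := r0; have ee := eps0; have pp := P0; have BB := B10; have th0 := theta0.
have mm := m0; have tr := theta_r; have lG := adapted_lift aG.
pose a := birkhoff G fG p y / p%:R.
have aE : birkhoff G fG p y = p%:R * a by rewrite /a mulrC divfK // lt0r_neq0.
pose g x := fG x - u (G x) + u x - a.
have gM : clip (Mf + Lam * B1 + Lam) g.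
  move=> x t; have h1 := fG_clip x t; have h2 := uLam x t; have h3 := uLam (G x) (G t).
  have h4 : Lam * cdist (G x) (G t) <= Lam * B1 * cdist x t.
    by rewrite -mulrA ler_wpM2l // (lipschitz_lift_cdist _ _ lG (adapted_lip aG)).
  move: h1 h2 h3; rewrite /g !ler_norml => /andP[? ?] /andP[? ?] /andP[? ?].
  by rewrite !mulrDl; apply/andP; split; lra.
have M0 : 0 <= Mf + Lam * B1 + Lam := addr_ge0 (addr_ge0 Mf0 (mulr_ge0 Lam0 BB)) Lam0.
have Sg n x : birkhoff G g n x =
    birkhoff G fG n x - n%:R * a - u (iter n G x) + u x.
  elim: n => [|n IH]; first by rewrite /birkhoff !big_ord0 /=; lra.
  by rewrite !birkhoffS IH /g -natr1 iterS; lra.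
have g_orbit : 0 <= birkhoff G g p y.
  by rewrite Sg aE (clip_eq uLam y_per) subrr sub0r addNr.
have z_iter i : z i = iter i F z0 by [].
have a_le : p%:R * a <= p%:R * alpha + sigma + p%:R * ln (1 - eps * r) +
    p%:R * (2 / m * theta) + Mf * (ck * (p%:R * theta)).
  have Sred : birkhoff F f p z0 <= p%:R * alpha + sigma.
    have e : birkhoff F red p z0 = birkhoff F f p z0 - p%:R * alpha - u (iter p F z0) + u z0.
      elim: (p) => [|n IH]; first by rewrite /birkhoff !big_ord0 /=; lra.
      by rewrite !birkhoffS IH /red -natr1 iterS; lra.
    by have := red_orbit; rewrite e (clip_eq uLam z_per); lra.
  rewrite -aE; apply: (@le_trans _ _ (birkhoff F f p z0 + p%:R * ln (1 - eps * r) +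
    p%:R * (2 / m * theta) + Mf * \sum_(i < p) cdist (iter i G y) (z i))); last first.
    have := ler_wpM2l Mf0 ysum; lra.
  have hn (c : R) : p%:R * c = \sum_(i < p) c by rewrite sumr_const card_ord mulr_natl.
  rewrite mulr_sumr !hn /birkhoff -!big_split /=.
  apply: ler_sum => i _.
  have := fG_clip (iter i G y) (z i); have := near_T_log (z i).
  have [_ ->] := perturbed_orbit eps rF r0 r4 gap2 i.
  have er : 0 < 1 - eps * r by have := eps_r; lra.
  rewrite (gtr0_norm er) lnM ?posrE //; last first.
    by rewrite (lt_le_trans mm) // (regular_ge rF).
  by rewrite -/(f (z i)) -z_iter !ler_norml => /andP[_ ?] /andP[_ ?]; lra.
have alpha_a : - (sigma / p%:R) - ln (1 - eps * r) - 2 / m * theta -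
    Mf * ck * (p%:R * theta) <= alpha - a.
  have h1 : Mf * (ck * (p%:R * theta)) <= p%:R * (Mf * ck * (p%:R * theta)).
    rewrite -[Mf * ck * _]mulrA ler_peMl ?ler1n //.
    exact: (mulr_ge0 Mf0 (mulr_ge0 ck0 (mulr_ge0 (ltW pp) th0))).
  suff : p%:R * (- (sigma / p%:R) - ln (1 - eps * r) - 2 / m * theta -
      Mf * ck * (p%:R * theta)) <= p%:R * (alpha - a) by rewrite ler_pM2l.
  rewrite !mulrBr mulrN mulrCA divff ?lt0r_neq0 // mulr1.
  by move: a_le h1; lra.
(* [alpha_a] supplies the drop of the average. In [delta_ge], [2 / m * theta] occurs twice, for
   replacing [T] by [G] on the orbit and at [x]; [Lam * theta] is for [u], and the term with [ck]
   for the displacement of the orbit. *)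
have key x : (ln `|derive1 T x| - ln `|derive1 F x| - Lam * `|phi F z p r eps x|) -
    ln (1 - eps * r) - delta <= g x.
  have h1 := near_T_log x; have h2 := uLam (F x) (G x).
  have h3 : Lam * cdist (F x) (G x) <= Lam * `|phi F z p r eps x| + Lam * theta.
    rewrite -mulrDr ler_wpM2l //; apply: le_trans (cdist_triangle (T x) _ _) _.
    rewrite [cdist (T x) _]cdistC lerD ?GT //; apply: le_trans (cdist_le_dist _ _) _.
    by rewrite /T /perturbed opprD addrA subrr sub0r normrN.
  have h4 := red0 x; rewrite /red /f in h4.
  have h5 := delta_ge.
  have e4 : theta * (4 / m + Lam + Mf * ck * p%:R) =
      2 / m * theta + 2 / m * theta + Lam * theta + Mf * ck * (p%:R * theta) by field; exact: lt0r_neq0.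
  rewrite e4 in h5.
  by move: h1 h2; rewrite /g !ler_norml => /andP[? ?] /andP[? ?]; lra.
have ln_key x := perturbed_ln rF rr r4 ee gap2 x Lam0 Lr LamBr eps_r.
have g_ge x : - delta <= g x by have := key x; have [] := ln_key x; lra.
have delta0 : 0 <= delta.
  apply: le_trans delta_ge; rewrite addr_ge0 //.
    rewrite divr_ge0 ?(ltW pp) //; apply: le_trans red_orbit.
    by apply: sumr_ge0 => i _; exact: red0.
  have h4 : 0 <= 4 / m by rewrite divr_ge0 // ltW.
  exact: (mulr_ge0 th0 (addr_ge0 (addr_ge0 h4 Lam0) (mulr_ge0 (mulr_ge0 Mf0 ck0) (ltW pp)))).
have C00 : 0 < C0 by rewrite divr_gt0 // mulr_gt0.
have k1 := adapted_kap aG.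
have b0 : 0 <= b := le_trans ler01 (adapted_b1 aG).
have deltaC : delta <= C0.
  apply: le_trans C0_ge.
  apply: (@le_trans _ _ (delta * (p + l.+1)%:R)).
    by rewrite ler_peMr // ler1n addnS.
  have kl : 0 <= kap ^+ l by rewrite exprn_ge0 // ltW // (lt_trans ltr01).
  by rewrite lerDr; apply: (mulr_ge0 (mulr_ge0 M0 ck0)); rewrite divr_ge0 // mulr_ge0 // ltW.
(* Points [r]-far from the continued orbit are [r / 2]-far from the old one, so [g] is at least
   [eps * r / 4 - delta], where [eps * r / 4] is [8 * C0] and [delta <= C0]. *)
have g_far x : ~ near_orbit G y p r x -> 3 * C0 <= g x.
  move=> hx; have [_ hfar] := ln_key x.
  have /hfar hh : forall i : 'I_p, r / 2 <= cdist x (z i).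
    move=> i; have hi : r <= cdist x (iter i G y).
      by rewrite leNgt; apply/negP => hi; apply: hx; exists i.
    have := yz i; have := cdist_triangle (z i) x (iter i G y).
    by rewrite (cdistC (z i) (iter i G y)); lra.
  have := key x; move: deltaC C00; rewrite /C0; lra.
(* Two displacements of at most [r / 2] each reduce the gap by at most [r]. *)
have gapG i j : (i < j)%N -> (j < p)%N ->
    (B1 + 2) * r <= cdist (iter i G y) (iter j G y).
  move=> ij jp; have ip := ltn_trans ij jp.
  have h1 := yz (Ordinal ip); have h2 := yz (Ordinal jp); rewrite /= in h1 h2.
  have h3 := gap ij jp.
  have h4 := cdist_triangle (iter i G y) (z i) (z j).
  have h5 := cdist_triangle (iter j G y) (iter i G y) (z j).
  rewrite (cdistC (z i) (iter i G y)) in h4.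
  rewrite mulrDl in h3; rewrite mulrDl; lra.
have count := birkhoff_far_count aG gM M0 p0 y_per rr B1r gapG delta0 g_ge g_orbit C0_ge g_far.
have ub t : `|u t| <= `|u 0| + Lam := clip_bounded uLam Lam0 t.
apply: (@unique_minimizer R G LG BG (m / 2) y p r a (C0 + 2 * (`|u 0| + Lam)) C0) => //.
- move=> i j ij jp; apply: lt_le_trans (gapG i j ij jp).
  by rewrite mulr_gt0 //; lra.
- move=> n x; have := count n x; rewrite Sg.
  by have := ub (iter n G x); have := ub x; rewrite !ler_norml => /andP[? ?] /andP[? ?]; lra.
- by move=> x hx; apply: near_forever aG p0 y_per rr B1r gapG _ hx.
Qed.

End NearPerturbed.

(** * Choice of the constants *)

Section Density.
Variable R : realType.
Implicit Types (F G H : R -> R).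

Lemma sub_action_exists H F f (h b kap B L : R) : adapted H F h b kap B -> 0 <= L -> clip L f ->
  exists (alpha : R) u (Lam M : R) x0,
    let red x := f x - alpha - u (F x) + u x in
    [/\ 0 <= Lam, clip Lam u, 0 <= M, clip M red &
      (forall x, 0 <= red x) /\ forall i, red (iter i F x0) = 0].
Proof.
move=> aF L0 fL.
have [x0 hx0] := reduced_zero_orbit aF L0 fL.
exists (min_average F f), (subaction F f b kap L), (L * (b / (kap - 1))),
  (L + L * (b / (kap - 1)) * B + L * (b / (kap - 1))), x0; split.
- by rewrite mulr_ge0 // (adapted_const_ge0 aF).
- exact: (subaction_clip aF).
- exact: (reduced_lip0 aF).
- exact: (reduced_clip aF).
- by split=> [x|//]; exact: (reduced_ge0 aF).
Qed.

Lemma regular_near F G L B m L' B' m' d : regular F L B m -> regular G L' B' m' ->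
  dC11 G F <= d -> d <= 1 -> d <= m / 2 -> regular G (L + 1) (B + 1) (m / 2).
Proof.
move=> rF rG dd d1 dm; have [_ hb hc] := dC11_ge rG rF; have m0 := regular_m0 rF.
split.
- exact: regular_lift rG.
- exact: regular_deriv rG.
- move=> x y; have h1 := hc x y; have h2 := regular_clip rF x y.
  have h3 : dC11 G F * cdist x y <= 1 * cdist x y.
    by rewrite ler_wpM2r ?cdist_ge0 //; lra.
  have := ler_normD (derive1 G x - derive1 F x - (derive1 G y - derive1 F y))
    (derive1 F x - derive1 F y).
  have -> : derive1 G x - derive1 F x - (derive1 G y - derive1 F y) +
    (derive1 F x - derive1 F y) = derive1 G x - derive1 G y by ring.
  by rewrite mulrDl; lra.
- by have := regular_L0 rF; lra.
- move=> x; have := hb x; have := regular_le rF x.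
  by have := ler_normD (derive1 G x - derive1 F x) (derive1 F x); rewrite subrK; lra.
- by rewrite divr_gt0.
- move=> x; have := hb x; have := regular_ge rF x.
  have := ler_normB (derive1 G x) (derive1 G x - derive1 F x).
  by rewrite opprB addrCA subrr addr0; lra.
Qed.

Definition has_unique_periodic_minimizer G := exists mu : probability R R,
  lyap_min G mu /\
  (forall nu : probability R R, lyap_min G nu -> forall A, measurable A -> nu A = mu A) /\
  periodic_orbit_support G mu.

Lemma min_gt0 (x y : R) : 0 < x -> 0 < y -> 0 < Num.min x y.
Proof. by move=> x0 y0; rewrite lt_min x0 y0. Qed.

Lemma locked_perturbation F (e : R) : E11 F -> 0 < e ->
  exists T, [/\ E11 T, dC11 T F < e & exists d : R, 0 < d /\
    forall G, E11 G -> dC11 G T < d -> has_unique_periodic_minimizer G].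
Proof.
move=> EF e0; have [L [B [m rF]]] := E11_regular EF.
have [_ [_ [_ [Cx [lam [Cx0 [lam1 hex]]]]]]] := EF.
have [H [dH [h [b [kap [lH [aF hH lH0 cH]]]]]]] := adapted_exists rF Cx0 lam1 hex.
have [e1 [e10 adapt]] := adapted_near aF hH lH0 cH rF.
have m0 := regular_m0 rF; have L0 := regular_L0 rF.
have B0 : 0 <= B := le_trans (normr_ge0 _) (regular_le rF 0).
have fclip := log_deriv_clip rF.
have Lm0 : 0 <= L / m by rewrite divr_ge0 // ltW.
have [alpha [u [Lam [M [x0 [Lam0 uLam M0 redM [red0 redz]]]]]]] :=
  sub_action_exists aF Lm0 fclip.
set red := fun x => _ - alpha - _ + _ in redM red0 redz.
have k1 := adapted_kap aF.
have b0 : 0 < b := lt_le_trans ltr01 (adapted_b1 aF).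
pose C := b / (kap - 1).
have C0 : 0 <= C := adapted_const_ge0 aF.
pose kap1 := (1 + kap) / 2.
have kk1 : 1 < kap1 by rewrite /kap1; lra.
pose ck := b / (kap1 - 1).
have ck0 : 0 <= ck by rewrite divr_ge0 ?(ltW b0) // subr_ge0 ltW.
pose e2 := Num.min (Num.min e e1) (Num.min 1 (m / 2)).
have e20 : 0 < e2 by rewrite !min_gt0 // divr_gt0.
have e2e : e2 <= e by rewrite !ge_min lexx.
have e2e1 : e2 <= e1 by rewrite !ge_min lexx orbT.
have e21 : e2 <= 1 by rewrite !ge_min lexx orbT.
have e2m : e2 <= m / 2 by rewrite !ge_min lexx !orbT.
(* The three parts of [dC11 T F] add up to at most [10 * (eps * B) <= e2 / 2]; the other half of
   [e2] is left for the maps near [T]. *)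
pose eps := Num.min 1 (e2 / (20 * (B + 1))).
have B10 : 0 < B + 1 by rewrite ltr_wpDl.
have eps0 : 0 < eps by rewrite min_gt0 // divr_gt0 // mulr_gt0.
have eps1 : eps <= 1 by rewrite ge_min lexx.
have epsB : eps * (B + 1) * 20 <= e2.
  have : eps <= e2 / (20 * (B + 1)) by rewrite ge_min lexx orbT.
  by rewrite ler_pdivlMr ?mulr_gt0 // => hh; move: hh; clear; lra.
have epsB2 : 10 * (eps * B) <= e2 / 2 by move: epsB eps0; clear; lra.
pose Mf := (L + 1) / (m / 2).
have Mf0 : 0 <= Mf by rewrite divr_ge0 ?addr_ge0 // divr_ge0 // ltW.
pose Mg := Mf + Lam * (B + 1) + Lam.
have Mg0 : 0 <= Mg by rewrite /Mg !addr_ge0 // mulr_ge0 // ltW.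
(* Makes the distortion term of [near_run] at most [eps * r / 64], half of the budget
   [eps * r / 32], uniformly in [r]. *)
have [l hl] := expr_gt (64 * (Mg * ck * b) / eps) kk1.
(* [M * C * E] bounds the sum of [red] over the orbit; the extra 1 absorbs the difference between
   [G] and [T]. *)
pose eta := M * C + 1.
have eta0 : 0 < eta by rewrite ltr_wpDl // mulr_ge0.
(* With [r = A0 * E] and [delta = eta * E / p], the loss [delta * (p + l.+1)] is at most
   [eta * E * l.+2 = eps * r / 64], the other half of the budget. *)
pose A0 := 64 * (l.+2)%:R * eta / eps.
have A00 : 0 < A0 by rewrite /A0 divr_gt0 // !mulr_gt0 // ltr0n.
pose rmax := Num.min (Num.min (1 / 4) (1 / (2 * (B + 1))))
   (Num.min (m / (4 * (L + 1))) (1 / (4 * (Lam * B + 1)))).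
have LB0 : 0 <= Lam * B by rewrite mulr_ge0.
have rmax0 : 0 < rmax.
  by rewrite !min_gt0 // divr_gt0 // ?mulr_gt0 // ltr_wpDl.
(* The ratio [(B + 1 + 4) * A0] turns into a gap of [(B + 1 + 4) * r], and the tolerance [rmax / A0]
   into [r <= rmax]. Both are fixed before the period [p] is known. *)
have [p [z0 [E [p0 z_per /andP[E0 Etau] red_orb gap]]]] :=
  @good_orbit R H F h b kap B aF red M x0 ((B + 1 + 4) * A0) (rmax / A0) redM M0
    (mulr_ge0 (addr_ge0 (ltW B10) (ler0n _ 4)) (ltW A00)) (divr_gt0 rmax0 A00) redz.
pose r := A0 * E.
have r0 : 0 < r by rewrite mulr_gt0.
have rr : r <= rmax by rewrite /r mulrC -ler_pdivlMr.
have r4 : r <= 1 / 4 by apply: le_trans rr _; rewrite !ge_min lexx.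
have rB : (B + 1) * r <= 1 / 2.
  have : r <= 1 / (2 * (B + 1)) by apply: le_trans rr _; rewrite !ge_min lexx orbT.
  by rewrite ler_pdivlMr ?mulr_gt0 // => hh; move: hh; clear; lra.
have rL : L * r <= m / 4.
  have : r <= m / (4 * (L + 1)) by apply: le_trans rr _; rewrite !ge_min lexx !orbT.
  by rewrite ler_pdivlMr ?mulr_gt0 ?ltr_wpDl // => hh; move: r0 hh; clear; lra.
have rLam : Lam * B * r <= 1 / 4.
  have : r <= 1 / (4 * (Lam * B + 1)) by apply: le_trans rr _; rewrite !ge_min lexx !orbT.
  by rewrite ler_pdivlMr ?mulr_gt0 ?ltr_wpDl // => hh; move: r0 hh; clear; lra.
have P0 : (0 : R) < p%:R by rewrite ltr0n.
have gap2 i j : (i < j)%N -> (j < p)%N ->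
    (B + 1 + 4) * r <= cdist (iter i F z0) (iter j F z0).
  by move=> ij jp; rewrite /r mulrA; exact: gap.
have gap3 i j : (i < j)%N -> (j < p)%N ->
    2 * r <= cdist (iter i F z0) (iter j F z0).
  move=> ij jp; apply: le_trans (gap2 i j ij jp); rewrite ler_wpM2r ?(ltW r0) //.
  by move: B0; clear; lra.
pose T := perturbed F (fun i => iter i F z0) p r eps.
have epsBr : eps * B * r <= eps * B.
  by rewrite ler_piMr ?mulr_ge0 ?(ltW eps0) //; move: r4; clear; lra.
have epsB0 : 0 <= eps * B by rewrite mulr_ge0 // ltW.
have em : eps * B * r <= m / 2 by move: epsBr epsB0 epsB2 e2m m0; clear; lra.
have rT := perturbed_regular rF r0 r4 eps0 gap3 em.
have bound := phi_bound rF r0 r4 eps0 gap3.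
have TF x : cdist (T x) (F x) <= eps * B * r.
  apply: le_trans (cdist_le_dist _ _) _; rewrite /T /perturbed addrAC subrr add0r.
  by have [] := bound x.
have dTF x : `|derive1 T x - derive1 F x| <= eps * B * r.
  rewrite (perturbed_derive1 _ _ _ rF r0 r4) addrAC subrr add0r.
  by have [] := bound x.
have dT : dC11 T F <= e2 / 2.
  have [_ [_ [_ [_ _ _ _ hle]]]] := dC11_parts rT rF.
  apply: le_trans (hle _ _ (8 * (eps * B)) TF dTF _) _; last by move: epsBr epsB2; clear; lra.
  move=> x y; rewrite !(perturbed_derive1 _ _ _ rF r0 r4).
  have -> : derive1 F x + dphi F (fun i => iter i F z0) p r eps x - derive1 F x -
    (derive1 F y + dphi F (fun i => iter i F z0) p r eps y - derive1 F y) =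
    dphi F (fun i => iter i F z0) p r eps x - dphi F (fun i => iter i F z0) p r eps y by ring.
  exact: (dphi_clip rF r0 eps0 gap3).
have aT := adapt T _ _ _ rT.
have ET : E11 T.
  apply: (adapted_E11 rT); apply: aT => x.
    by apply: le_trans (TF x) _; move: epsBr epsB0 epsB2 e20 e2e1; clear; lra.
  by apply: le_trans (dTF x) _; move: epsBr epsB0 epsB2 e20 e2e1; clear; lra.
exists T; split => //; first by move: dT e20 e2e; clear; lra.
pose D := 4 / m + Lam + Mf * ck * p%:R.
have D0 : 0 < D.
  have h4 : 0 < 4 / m by rewrite divr_gt0.
  exact: (ltr_wpDr (mulr_ge0 (mulr_ge0 Mf0 ck0) (ltW P0)) (ltr_wpDr Lam0 h4)).
(* Respectively: [G] stays within [e2] of [F], the orbit moves by at most [r / 2], and the error of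
   replacing [T] by [G] is at most [E / p]. This radius may depend on [p] and [E]. *)
pose d := Num.min (e2 / 2) (Num.min (r / (2 * (ck * p%:R + 1))) (E / p%:R / D)).
have cp0 : 0 <= ck * p%:R by rewrite mulr_ge0 // ltW.
have d0 : 0 < d.
  have h1 : 0 < 2 * (ck * p%:R + 1) by rewrite mulr_gt0 // ltr_wpDl.
  have h2 : 0 < e2 / 2 by rewrite divr_gt0.
  exact: (min_gt0 h2 (min_gt0 (divr_gt0 r0 h1) (divr_gt0 (divr_gt0 E0 P0) D0))).
exists d; split => // G EG GT.
have [L' [B' [m' rG']]] := E11_regular EG.
have dGF : dC11 G F <= e2.
  have h1 : dC11 G T <= e2 / 2 by apply: le_trans (ltW GT) _; rewrite ge_min lexx.
  apply: (le_trans (dC11_triangle EG ET EF)); rewrite [leRHS]splitr.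
  exact: (lerD h1 dT).
have rG := regular_near rF rG' dGF e21 e2m.
have [GF dGF' _] := dC11_ge rG rF.
have [GT' dGT' _] := dC11_ge rG rT.
have aG : adapted H G h b kap1 (B + 1).
  apply: (adapt G _ _ _ rG) => x.
    exact: le_trans (GF x) (le_trans dGF e2e1).
  exact: le_trans (dGF' x) (le_trans dGF e2e1).
have dr : ck * (p%:R * d) <= r / 2.
  have : d <= r / (2 * (ck * p%:R + 1)) by rewrite !ge_min lexx !orbT.
  by rewrite ler_pdivlMr ?mulr_gt0 ?ltr_wpDl // => hh; move: d0 hh; clear; lra.
have dD : d * D <= E / p%:R.
  by rewrite -ler_pdivlMr // !ge_min lexx !orbT.
pose delta := eta * E / p%:R.
have hdelta : (M * C * E) / p%:R + d * D <= delta.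
  rewrite /delta /eta; have -> : (M * C + 1) * E / p%:R = M * C * E / p%:R + E / p%:R by ring.
  by rewrite lerD2l.
have hC : Mg * ck * (b * r / kap1 ^+ l) + delta * (p + l.+1)%:R <= eps * r / 32.
  have kl : 0 < kap1 ^+ l by rewrite exprn_gt0 // (lt_trans ltr01).
  have h1 : Mg * ck * (b * r / kap1 ^+ l) <= eps * r / 64.
    have -> : Mg * ck * (b * r / kap1 ^+ l) = (Mg * ck * b) * r / kap1 ^+ l by ring.
    rewrite ler_pdivrMr //.
    have : 64 * (Mg * ck * b) <= kap1 ^+ l * eps by rewrite -ler_pdivrMr // ltW.
    move=> hh; have := ler_wpM2r (ltW r0) hh; clear; lra.
  have h2 : delta * (p + l.+1)%:R <= eps * r / 64.
    have -> : eps * r / 64 = eta * E * (l.+2)%:R.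
      by rewrite /r /A0; field; exact: lt0r_neq0.
    rewrite /delta mulrAC ler_pdivrMr // -[leRHS]mulrA ler_wpM2l ?mulr_ge0 ?(ltW eta0) ?(ltW E0) //.
    rewrite -natrM ler_nat; move: p0; clear; nia.
  by move: h1 h2; clear; lra.
apply: (@near_perturbed_minimizer R F G H u L B m (L + 1) (B + 1) (L + 8 * (eps * B))
   (B + eps * B * r) h b kap1 (B + 1) Lam alpha z0 p l r eps (M * C * E) d delta) => //.
- by move: r4 eps1 eps0 r0; clear; nra.
- by move=> x; apply: le_trans (GT' x) _; exact: ltW.
- by move=> x; apply: le_trans (dGT' x) _; exact: ltW.
Qed.

End Density.

Theorem theoremB (R : realType) :
  exists U : set (R -> R),
    U `<=` @E11 R /\
    (* U is open in E^{1,1} for the C^{1,1} topology *)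
    (forall F, U F -> exists e : R, 0 < e /\
        forall G, @E11 R G -> dC11 G F < e -> U G) /\
    (* U is dense in E^{1,1} *)
    (forall F, @E11 R F -> forall e : R, 0 < e ->
        exists G, U G /\ dC11 G F < e) /\
    (forall F, U F -> exists mu : probability R R,
        lyap_min F mu /\
        (forall nu : probability R R, lyap_min F nu ->
            forall A : set R, measurable A -> nu A = mu A) /\
        periodic_orbit_support F mu).
Proof.
pose locked (F : R -> R) (e : R) :=
  forall G, E11 G -> dC11 G F < e -> has_unique_periodic_minimizer G.
(* Asking for a whole ball of maps with the property builds openness into the set, by the triangle
   inequality; density is [locked_perturbation]. *)
exists [set F | E11 F /\ exists e : R, 0 < e /\ locked F e]; split; first by move=> F [].
split.
  move=> F [EF [e [e0 hF]]]; exists (e / 2); split; first by rewrite divr_gt0.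
  move=> G EG GF; split => //; exists (e / 2); split; first by rewrite divr_gt0.
  move=> G' EG' G'G; apply: hF => //.
  apply: (le_lt_trans (dC11_triangle EG' EG EF)); rewrite [ltRHS]splitr.
  exact: (ltrD G'G GF).
split.
  move=> F EF e e0; have [T [ET TF [d [d0 hd]]]] := locked_perturbation EF e0.
  by exists T; split => //; split => //; exists d.
move=> F [EF [e [e0 hF]]]; apply: hF => //.
exact: le_lt_trans (dC11_refl EF) e0.
Qed.
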